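(* Let $(G,\Sigma)$ be a twisted locally compact étale groupoid, not necessarily Hausdorff, with locally compact Hausdorff unit space. Let $H$ be any infinite-dimensional Hilbert space, and let $\mathcal Q(H)=B(H)/\mathcal K(H)$. Every $*$-homomorphism from $B(H)$ or $\mathcal Q(H)$ into either $C_r^*(G,\Sigma)$ or $B_r^*(G,\Sigma)$ is zero. In particular, neither $B(H)$ nor $\mathcal Q(H)$ embeds as a $C^*$-subalgebra of either algebra, and neither is $*$-isomorphic to either algebra. The same conclusions hold for every nonzero quotient of $B(H)$ (by a norm-closed two-sided ideal).
   Context: $\mathcal K(H)$ denotes the compact operators; $*$-homomorphisms are not assumed unital. Groupoids. A topological groupoid $G$ is a small category in which every arrow is invertible, with a topology making multiplication and inversion continuous. Its unit space is $G^{(0)}$; $s,r$ are source and range; $\alpha\beta$ is defined iff $s(\alpha)=r(\beta)$. $G$ is étale if $s\colon G\to G^{(0)}$ is a local homeomorphism. Twists. A twist over $G$ is a central extension of topological groupoids $G^{(0)}\times\mathbb T\xrightarrow{\iota}\Sigma\xrightarrow{p}G$ such that $p$ is the identity on unit spaces and makes $\Sigma$ a locally trivial principal $\mathbb T$-bundle over $G$; $p^{-1}(G^{(0)})=\iota(G^{(0)}\times\mathbb T)$; and $\iota(r(\sigma),z)\sigma=\sigma\,\iota(s(\sigma),z)$. Write $z\sigma=\iota(r(\sigma),z)\sigma$. The Fell line bundle is $L=(\Sigma\times\mathbb C)/\mathbb T$ for $z\cdot(\sigma,a)=(z\sigma,\overline z a)$, with class $[\sigma,a]\in L_{p(\sigma)}$,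 norm $|a|$, product $[\sigma,a][\tau,b]=[\sigma\tau,ab]$ and involution $[\sigma,a]^*=[\sigma^{-1},\overline a]$. Algebras. If $G$ is Hausdorff, $C_c(G,L)$ is the space of compactly supported continuous sections of $L$; in general it is the linear span of continuous sections on open Hausdorff subsets whose supports are compact in those subsets, extended by zero. $B_c(G,L)$ is the space of bounded Borel sections of $L$ that vanish outside some compact subset of $G$. Both are $*$-algebras under $(f*g)(\gamma)=\sum_{\alpha\beta=\gamma}f(\alpha)g(\beta)$, $f^*(\gamma)=f(\gamma^{-1})^*$ (finite sums). For $u\in G^{(0)}$ put $G_u=s^{-1}(u)$, $\mathcal H_u=\bigoplus_{\gamma\in G_u}L_\gamma$ ($\ell^2$-sum) and $(\lambda_u(f)\xi)_\gamma=\sum_{\eta\in G_u}f(\gamma\eta^{-1})\xi_\eta$. With $\|f\|_r=\sup_u\|\lambda_u(f)\|$, $C_r^*(G,\Sigma)$ and $B_r^*(G,\Sigma)$ are the completions of $C_c(G,L)$ and $B_c(G,L)$ in $\|\cdot\|_r$. *)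

(* Defs.v *)
From HB Require Import structures.
From mathcomp Require Import all_boot all_order all_algebra.
From mathcomp Require Export generic_quotient complex.
From mathcomp Require Import all_classical all_reals all_analysis.
Import Order.TTheory GRing.Theory Num.Theory numFieldNormedType.Exports.

Set Implicit Arguments.
Unset Strict Implicit.
Unset Printing Implicit Defensive.

Local Open Scope classical_set_scope.
Local Open Scope ring_scope.
Local Open Scope quotient_scope.

(* The usual metric topology on the complex numbers: the library only puts it
   on the alias R[i]^o. *)
HB.instance Definition _ (R : rcfType) := PseudoPointedMetric.copy R[i] R[i]^o.
HB.instance Definition _ (R : rcfType) := GRing.ComAlgebra.copy R[i] R[i]^o.
HB.instance Definition _ (R : rcfType) := Vector.copy R[i] R[i]^o.
HB.instance Definition _ (R : rcfType) := NormedModule.copy R[i] R[i]^o.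

(* Norms of normed modules over R[i] take values in R[i]; they are real. *)
Definition rnorm (R : realType) (V : normedModType R[i]) (x : V) : R :=
  complex.Re `|x|.

Definition circle (R : realType) : set R[i] := [set z | `|z| = 1].

(* The library's [locally_compact] asks for neighbourhoods with compact closure,
   which is too strong for spaces that are not Hausdorff. *)
Definition locally_compact_space (T : topologicalType) : Prop :=
  forall (x : T) (U : set T), nbhs x U ->
    exists K : set T, [/\ nbhs x K, compact K & K `<=` U].

Definition local_homeomorphism (X Y : topologicalType) (f : X -> Y) : Prop :=
  forall x, exists U : set X,
    [/\ open U, U x, {within U, continuous f}, set_inj U f
      & forall W, open W -> W `<=` U -> open (f @` W)].

Definition borel (T : topologicalType) : set (set T) :=
  <<s [set U : set T | open U] >>.

Definition borel_fun (X Y : topologicalType) (f : X -> Y) : Prop :=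
  forall B, borel B -> borel (f @^-1` B).

(* A small category is identified with its set of arrows, objects being
   identified with their identity arrows; [gmul x y] is only meaningful when
   [gsrc x = grng y]. *)
Record top_groupoid (G : topologicalType) := TopGroupoid {
  gsrc : G -> G;
  grng : G -> G;
  gmul : G -> G -> G;
  ginv : G -> G;
  gsrc_src : forall x, gsrc (gsrc x) = gsrc x;
  grng_src : forall x, grng (gsrc x) = gsrc x;
  gsrc_rng : forall x, gsrc (grng x) = grng x;
  grng_rng : forall x, grng (grng x) = grng x;
  gsrc_mul : forall x y, gsrc x = grng y -> gsrc (gmul x y) = gsrc y;
  grng_mul : forall x y, gsrc x = grng y -> grng (gmul x y) = grng x;
  gmulA : forall x y z, gsrc x = grng y -> gsrc y = grng z ->
    gmul x (gmul y z) = gmul (gmul x y) z;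
  gmul_rng : forall x, gmul (grng x) x = x;
  gmul_src : forall x, gmul x (gsrc x) = x;
  gsrc_inv : forall x, gsrc (ginv x) = grng x;
  grng_inv : forall x, grng (ginv x) = gsrc x;
  gmulVx : forall x, gmul (ginv x) x = gsrc x;
  gmulxV : forall x, gmul x (ginv x) = grng x;
  gmul_continuous : {within [set x : G * G | gsrc x.1 = grng x.2],
    continuous (fun x : G * G => gmul x.1 x.2)};
  ginv_continuous : continuous ginv }.

Definition gunits (G : topologicalType) (g : top_groupoid G) : set G :=
  [set u | gsrc g u = u].

Lemma gsrc_unit (G : topologicalType) (g : top_groupoid G) x :
  gsrc g x \in gunits g.
Proof. by rewrite inE /gunits /= gsrc_src. Qed.

(* The source map, with values in the unit space with its subspace topology. *)
Definition gsrc0 (G : topologicalType) (g : top_groupoid G) (x : G) :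
  set_type (gunits g) := exist _ (gsrc g x) (gsrc_unit g x).

Definition etale (G : topologicalType) (g : top_groupoid G) : Prop :=
  local_homeomorphism (gsrc0 g).

(* [tiota u z] is only meaningful for a unit [u] of G and [z] in the circle.
   [tproj_iota] and [tiota_unit] identify the units of S with those of G via p;
   so iota(r(x), z) x is written [gmul s (tiota (tproj (grng s x)) z) x]. *)
Record twist (R : realType) (G S : topologicalType)
    (g : top_groupoid G) (s : top_groupoid S) := Twist {
  tiota : G -> R[i] -> S;
  tproj : S -> G;
  tiota_continuous : {within gunits g `*` @circle R,
    continuous (fun x : G * R[i] => tiota x.1 x.2)};
  tiota_src : forall u z, gunits g u -> circle z ->
    gsrc s (tiota u z) = tiota u 1;
  tiota_rng : forall u z, gunits g u -> circle z ->
    grng s (tiota u z) = tiota u 1;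
  tiotaM : forall u z w, gunits g u -> circle z -> circle w ->
    gmul s (tiota u z) (tiota u w) = tiota u (z * w);
  tiota_inj : forall u v z w, gunits g u -> gunits g v ->
    circle z -> circle w -> tiota u z = tiota v w -> u = v /\ z = w;
  tproj_continuous : continuous tproj;
  tproj_surj : forall x, exists y, tproj y = x;
  tproj_src : forall y, tproj (gsrc s y) = gsrc g (tproj y);
  tproj_rng : forall y, tproj (grng s y) = grng g (tproj y);
  tprojM : forall x y, gsrc s x = grng s y ->
    tproj (gmul s x y) = gmul g (tproj x) (tproj y);
  tproj_iota : forall u z, gunits g u -> circle z -> tproj (tiota u z) = u;
  tiota_unit : forall e, gunits s e -> tiota (tproj e) 1 = e;
  tproj_ker : tproj @^-1` gunits g =
    [set tiota x.1 x.2 | x in gunits g `*` @circle R];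
  tcentral : forall y z, circle z ->
    gmul s (tiota (tproj (grng s y)) z) y =
    gmul s y (tiota (tproj (gsrc s y)) z);
  (* Around each point, p is isomorphic to the trivial bundle U * T: [f] is an
     equivariant homeomorphism onto p^-1(U), with inverse (p, c). *)
  tlocally_trivial : forall x, exists (U : set G) (f : G -> R[i] -> S)
      (c : S -> R[i]),
    [/\ open U /\ U x,
        {within U `*` @circle R, continuous (fun a : G * R[i] => f a.1 a.2)},
        {within tproj @^-1` U, continuous c},
        (forall a z, U a -> circle z -> tproj (f a z) = a /\ c (f a z) = z) /\
        (forall y, U (tproj y) -> circle (c y) /\ f (tproj y) (c y) = y)
      & forall a z w, U a -> circle z -> circle w ->
          f a (z * w) = gmul s (tiota (tproj (grng s (f a w))) z) (f a w)] }.

Section FellLineBundle.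
Context {R : realType} {G S : topologicalType}.
Context {g : top_groupoid G} {s : top_groupoid S} (t : twist R g s).

Definition tact (z : R[i]) (x : S) : S :=
  gmul s (tiota t (tproj t (grng s x)) z) x.

Let proj_rng_unit x : gunits g (tproj t (grng s x)).
Proof. by rewrite /gunits /= tproj_rng gsrc_rng. Qed.

Let iota1 x : tiota t (tproj t (grng s x)) 1 = grng s x.
Proof. by apply: tiota_unit; rewrite /gunits /= gsrc_rng. Qed.

Lemma circle1 : circle (1 : R[i]). Proof. by rewrite /circle /= normr1. Qed.

Lemma circleM (z w : R[i]) : circle z -> circle w -> circle (z * w).
Proof. by rewrite /circle /= normrM => -> ->; rewrite mulr1. Qed.

Lemma circleJ (z : R[i]) : circle z -> circle (z^*)%C.
Proof. by rewrite /circle /= normcJ. Qed.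

Lemma circle_mulJ (z : R[i]) : circle z -> (z^*)%C * z = 1.
Proof. by move=> zT; rewrite mulrC -sqr_normc zT expr1n. Qed.

Lemma tact1 x : tact 1 x = x.
Proof. by rewrite /tact iota1 gmul_rng. Qed.

Lemma tactM z w x : circle z -> circle w -> tact z (tact w x) = tact (z * w) x.
Proof.
move=> zT wT.
have cw v : circle v -> gsrc s (tiota t (tproj t (grng s x)) v) = grng s x.
  by move=> vT; rewrite tiota_src// iota1.
have rw : grng s (tact w x) = grng s x.
  by rewrite /tact grng_mul ?cw// tiota_rng// iota1.
rewrite {1}/tact rw {1}/tact gmulA ?cw// ?tiotaM//.
by rewrite tiota_rng// iota1.
Qed.

Definition fell_rel (x y : S * R[i]) : bool :=
  `[< exists2 z, circle z & y = (tact z x.1, (z^*)%C * x.2) >].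

Lemma fell_rel_refl : reflexive fell_rel.
Proof.
move=> [x a]; apply/asboolP; exists 1; first exact: circle1.
by rewrite tact1 rmorph1 mul1r.
Qed.

Lemma fell_rel_sym : symmetric fell_rel.
Proof.
suff H x y : fell_rel x y -> fell_rel y x by move=> x y; apply/idP/idP; apply: H.
case: x y => [x a] [y b] /asboolP[z zT [-> ->]]; apply/asboolP.
exists (z^*)%C; first exact: circleJ.
have zJ := circleJ zT.
by rewrite tactM// mulrA -rmorphM/= circle_mulJ// tact1 rmorph1 mul1r.
Qed.

Lemma fell_rel_trans : transitive fell_rel.
Proof.
move=> [y b] [x a] [w c] /asboolP[z zT [-> ->]] /asboolP[z' zT' [-> ->]].
apply/asboolP; exists (z' * z); first exact: circleM.
by rewrite tactM// rmorphM mulrA.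
Qed.

Canonical fell_equiv :=
  EquivRel fell_rel fell_rel_refl fell_rel_sym fell_rel_trans.

(* The quotient of S * C by the circle action, with the quotient topology. *)
Definition fell_bundle : topologicalType :=
  quotient_topology {eq_quot fell_equiv}.

Definition Lclass (x : S) (a : R[i]) : fell_bundle :=
  (\pi_({eq_quot fell_equiv}) (x, a))%qT.

Definition Lrepr (l : fell_bundle) : S * R[i] :=
  repr (l : {eq_quot fell_equiv}).

Definition Lbase (l : fell_bundle) : G := tproj t (Lrepr l).1.

Definition fell_norm (l : fell_bundle) : R := rnorm (Lrepr l).2.

Definition Lmul (l m : fell_bundle) : fell_bundle :=
  Lclass (gmul s (Lrepr l).1 (Lrepr m).1) ((Lrepr l).2 * (Lrepr m).2).

Definition Lstar (l : fell_bundle) : fell_bundle :=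
  Lclass (ginv s (Lrepr l).1) ((Lrepr l).2^*)%C.

Definition Lscale (a : R[i]) (l : fell_bundle) : fell_bundle :=
  Lclass (Lrepr l).1 (a * (Lrepr l).2).

(* For l in the fibre over p(x), the unique a with l = [x, a]. *)
Definition Lcoord (x : S) (l : fell_bundle) : R[i] :=
  xget 0 [set a | Lclass x a = l].

(* [x, a] + [x, b] = [x, a + b]; only meaningful within one fibre. *)
Definition Ladd (l m : fell_bundle) : fell_bundle :=
  Lclass (Lrepr l).1 ((Lrepr l).2 + Lcoord (Lrepr l).1 m).

Definition tlift (x : G) : S := projT1 (cid (tproj_surj t x)).

Definition Lzero (x : G) : fell_bundle := Lclass (tlift x) 0.

(* Sum, in the fibre over x, of a family with finitely many nonzero terms. *)
Definition Lsum (x : G) (I : choiceType) (A : set I) (F : I -> fell_bundle) :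
    fell_bundle :=
  Lclass (tlift x) (\sum_(i \in A) Lcoord (tlift x) (F i)).

Definition is_section (f : G -> fell_bundle) : Prop :=
  forall x, Lbase (f x) = x.

Definition sec_add (f h : G -> fell_bundle) : G -> fell_bundle :=
  fun x => Ladd (f x) (h x).

Definition sec_scale (a : R[i]) (f : G -> fell_bundle) : G -> fell_bundle :=
  fun x => Lscale a (f x).

Definition sec_conv (f h : G -> fell_bundle) : G -> fell_bundle :=
  fun x => Lsum x
    [set ab : G * G | gsrc g ab.1 = grng g ab.2 /\ gmul g ab.1 ab.2 = x]
    (fun ab => Lmul (f ab.1) (h ab.2)).

Definition sec_star (f : G -> fell_bundle) : G -> fell_bundle :=
  fun x => Lstar (f (ginv g x)).

Definition Cc_generator (f : G -> fell_bundle) : Prop :=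
  is_section f /\ exists U : set G,
    [/\ open U, hausdorff_space (set_type U), {within U, continuous f},
        forall x, ~ U x -> f x = Lzero x
      & compact (U `&` closure [set x | U x /\ f x <> Lzero x])].

(* The linear span; when G is Hausdorff it is the space of compactly supported
   continuous sections. *)
Inductive Cc : (G -> fell_bundle) -> Prop :=
| Cc_zero : Cc Lzero
| Cc_step a f h : Cc_generator f -> Cc h -> Cc (sec_add (sec_scale a f) h).

Definition Bc (f : G -> fell_bundle) : Prop :=
  [/\ is_section f, borel_fun f, exists M : R, forall x, fell_norm (f x) <= M
    & exists2 K : set G, compact K & forall x, ~ K x -> f x = Lzero x].

Definition gfibre (u : G) : set G := [set x | gsrc g x = u].

(* The norm of the l^2-direct sum of the L_x over x in G_u; vectors are
   represented by sections on G, whose values outside G_u are irrelevant. *)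
Definition l2norm (u : G) (xi : G -> fell_bundle) : \bar R :=
  sqrte (\esum_(x in gfibre u) (fell_norm (xi x) ^+ 2)%:E).

Definition lambda (u : G) (f xi : G -> fell_bundle) : G -> fell_bundle :=
  fun x => Lsum x (gfibre u) (fun y => Lmul (f (gmul g x (ginv g y))) (xi y)).

Definition lambda_norm (u : G) (f : G -> fell_bundle) : \bar R :=
  ereal_sup [set l2norm u (lambda u f xi) |
    xi in [set xi | is_section xi /\ (l2norm u xi <= 1)%E]].

(* The maximum with 0 only matters for the empty groupoid, where the supremum
   over the units is -oo. *)
Definition reduced_norm (f : G -> fell_bundle) : \bar R :=
  maxe 0%E (ereal_sup [set lambda_norm u f | u in gunits g]).

End FellLineBundle.

(* The operations of a (possibly non-unital) complex *-algebra. *)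
Record star_ops (K : Type) := StarOps {
  so_car :> Type;
  so_add : so_car -> so_car -> so_car;
  so_scale : K -> so_car -> so_car;
  so_mul : so_car -> so_car -> so_car;
  so_star : so_car -> so_car }.

Record cstar_algebra (R : realType) := CstarAlgebra {
  cs_car :> completeNormedModType R[i];
  cs_mul : cs_car -> cs_car -> cs_car;
  cs_star : cs_car -> cs_car;
  cs_mulA : associative cs_mul;
  cs_mulDl : left_distributive cs_mul +%R;
  cs_mulDr : right_distributive cs_mul +%R;
  cs_scalerAl : forall a x y, a *: cs_mul x y = cs_mul (a *: x) y;
  cs_scalerAr : forall a x y, a *: cs_mul x y = cs_mul x (a *: y);
  cs_starD : {morph cs_star : x y / x + y};
  cs_starZ : forall a x, cs_star (a *: x) = (a^*)%C *: cs_star x;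
  cs_starM : forall x y, cs_star (cs_mul x y) = cs_mul (cs_star y) (cs_star x);
  cs_starK : involutive cs_star;
  cs_normM : forall x y, `|cs_mul x y| <= `|x| * `|y|;
  cs_norm_star : forall x, `|cs_mul (cs_star x) x| = `|x| ^+ 2 }.

Section StarHom.
Context {R : realType} {X : star_ops R[i]} {A : cstar_algebra R}.

(* [phi] restricts to a *-homomorphism on the *-subalgebra [D] of [X]. *)
Definition star_hom_on (D : set X) (phi : X -> A) : Prop :=
  [/\ forall x y, D x -> D y -> phi (so_add x y) = phi x + phi y,
      forall a x, D x -> phi (so_scale a x) = a *: phi x,
      forall x y, D x -> D y -> phi (so_mul x y) = cs_mul (phi x) (phi y)
    & forall x, D x -> phi (so_star x) = cs_star (phi x)].

Definition star_hom (phi : X -> A) : Prop := star_hom_on setT phi.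

End StarHom.

Definition every_star_hom_zero (R : realType) (X : star_ops R[i])
    (A : cstar_algebra R) : Prop :=
  forall phi : X -> A, star_hom phi -> forall x, phi x = 0.

(* Injective *-homomorphisms of C*-algebras are isometric, hence have closed
   range. *)
Definition embeds_in (R : realType) (X : star_ops R[i])
    (A : cstar_algebra R) : Prop :=
  exists2 phi : X -> A, star_hom phi & injective phi.

Definition star_isomorphic (R : realType) (X : star_ops R[i])
    (A : cstar_algebra R) : Prop :=
  exists2 phi : X -> A, star_hom phi & bijective phi.

Definition no_nonzero_image (R : realType) (X : star_ops R[i])
    (A : cstar_algebra R) : Prop :=
  [/\ every_star_hom_zero X A, ~ embeds_in X A & ~ star_isomorphic X A].

Definition sec_ops (R : realType) (G S : topologicalType)
    (g : top_groupoid G) (s : top_groupoid S) (t : twist R g s) :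
    star_ops R[i] :=
  StarOps (@sec_add _ _ _ _ _ t) (@sec_scale _ _ _ _ _ t)
    (@sec_conv _ _ _ _ _ t) (@sec_star _ _ _ _ _ t).

(* A is the completion of the *-algebra D in the norm N: it contains an
   isometric dense copy of D. *)
Definition is_completion (R : realType) (X : star_ops R[i]) (D : set X)
    (N : X -> \bar R) (A : cstar_algebra R) : Prop :=
  exists j : X -> A,
    [/\ star_hom_on D j, forall x, D x -> (rnorm (j x))%:E = N x
      & dense (j @` D)].

Section ReducedAlgebras.
Context {R : realType} {G S : topologicalType}.
Context {g : top_groupoid G} {s : top_groupoid S} (t : twist R g s).

Definition is_reduced_Cstar (A : cstar_algebra R) : Prop :=
  @is_completion R (sec_ops t) (@Cc R G S g s t) (@reduced_norm R G S g s t) A.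

Definition is_reduced_Bstar (A : cstar_algebra R) : Prop :=
  @is_completion R (sec_ops t) (@Bc R G S g s t) (@reduced_norm R G S g s t) A.

End ReducedAlgebras.

Record hilbert_space (R : realType) := HilbertSpace {
  hs_car :> completeNormedModType R[i];
  inner : hs_car -> hs_car -> R[i];
  inner_linear : forall a x y z,
    inner (a *: x + y) z = a * inner x z + inner y z;
  inner_conj : forall x y, inner y x = ((inner x y)^*)%C;
  inner_norm : forall x, inner x x = `|x| ^+ 2 }.

Definition infinite_dimensional (R : realType) (H : hilbert_space R) : Prop :=
  forall (n : nat) (v : 'I_n -> H),
    exists x : H, forall c : 'I_n -> R[i], x <> \sum_(i < n) c i *: v i.

Record bounded_op (R : realType) (H : hilbert_space R) := BoundedOp {
  bo_fun :> H -> H;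
  bo_linear : linear bo_fun;
  bo_bounded : exists M : R[i], forall x, `|bo_fun x| <= M * `|x| }.

Section Operators.
Context {R : realType} {H : hilbert_space R}.
Implicit Types T U : bounded_op H.

Lemma bo_bound_ge0 T : exists2 M : R[i], 0 <= M & forall x, `|T x| <= M * `|x|.
Proof.
have [M TM] := bo_bounded T.
exists `|M| => // x; have [->|x0] := eqVneq x 0.
  by have := TM 0; rewrite !normr0 !mulr0.
have nx : 0 < `|x| by rewrite normr_gt0.
have M0 : 0 <= M.
  by rewrite -(pmulr_lge0 _ nx); exact: le_trans (TM x).
by rewrite ger0_norm.
Qed.

Lemma bo_add_linear T U : linear (fun x => T x + U x).
Proof. by move=> a x y; rewrite !bo_linear scalerDr addrACA. Qed.

Lemma bo_add_bounded T U :
  exists M : R[i], forall x, `|T x + U x| <= M * `|x|.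
Proof.
have [M _ TM] := bo_bound_ge0 T; have [N _ UN] := bo_bound_ge0 U.
exists (M + N) => x; rewrite mulrDl.
by apply: le_trans (ler_normD _ _) _; exact: lerD.
Qed.

Definition bo_add T U : bounded_op H :=
  BoundedOp (bo_add_linear T U) (bo_add_bounded T U).

Lemma bo_scale_linear (a : R[i]) T : linear (fun x => a *: T x).
Proof. by move=> b x y; rewrite bo_linear scalerDr !scalerA mulrC. Qed.

Lemma bo_scale_bounded (a : R[i]) T :
  exists M : R[i], forall x, `|a *: T x| <= M * `|x|.
Proof.
have [M _ TM] := bo_bound_ge0 T.
by exists (`|a| * M) => x; rewrite normrZ -mulrA ler_wpM2l.
Qed.

Definition bo_scale a T : bounded_op H :=
  BoundedOp (bo_scale_linear a T) (bo_scale_bounded a T).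

Lemma bo_comp_linear T U : linear (fun x => T (U x)).
Proof. by move=> a x y; rewrite !bo_linear. Qed.

Lemma bo_comp_bounded T U :
  exists M : R[i], forall x, `|T (U x)| <= M * `|x|.
Proof.
have [M M0 TM] := bo_bound_ge0 T; have [N _ UN] := bo_bound_ge0 U.
exists (M * N) => x; apply: le_trans (TM _) _.
by rewrite -mulrA ler_wpM2l.
Qed.

Definition bo_comp T U : bounded_op H :=
  BoundedOp (bo_comp_linear T U) (bo_comp_bounded T U).

Definition is_adjoint T U : Prop :=
  forall x y, inner (T x) y = inner x (U y).

(* The adjoint exists by Riesz representation, so the default is never used. *)
Definition bo_adj T : bounded_op H :=
  if pselect (exists U, is_adjoint T U) is left e then projT1 (cid e) else T.

Definition op_norm T : R := sup [set rnorm (T x) | x in [set x : H | rnorm x <= 1]].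

Definition bo_sub T U : bounded_op H := bo_add T (bo_scale (-1) U).

Definition compact_operators : set (bounded_op H) :=
  [set T | compact (closure (T @` [set x : H | rnorm x <= 1]))].

Definition norm_closed_ideal (J : set (bounded_op H)) : Prop :=
  [/\ J !=set0,
      forall T U, J T -> J U -> J (bo_add T U),
      forall a T, J T -> J (bo_scale a T),
      forall T U, J T -> J (bo_comp U T) /\ J (bo_comp T U)
    & forall T, (forall e : R, 0 < e -> exists2 U, J U & op_norm (bo_sub T U) < e) ->
        J T].

End Operators.

Definition BH (R : realType) (H : hilbert_space R) : star_ops R[i] :=
  StarOps (@bo_add R H) (@bo_scale R H) (@bo_comp R H) (@bo_adj R H).

Section Quotient.
Context {R : realType} {H : hilbert_space R} (J : set (bounded_op H)).

Definition coset (T : bounded_op H) : set (bounded_op H) :=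
  [set U | J (bo_sub U T)].

Definition quot_car : Type :=
  {C : set (bounded_op H) | exists T, C = coset T}.

Definition quot_class (T : bounded_op H) : quot_car :=
  exist _ (coset T) (ex_intro _ T erefl).

Definition quot_repr (C : quot_car) : bounded_op H :=
  projT1 (cid (proj2_sig C)).

(* B(H)/J, for a norm-closed two-sided ideal J. *)
Definition BH_quot : star_ops R[i] :=
  @StarOps R[i] quot_car
    (fun C D => quot_class (bo_add (quot_repr C) (quot_repr D)))
    (fun a C => quot_class (bo_scale a (quot_repr C)))
    (fun C D => quot_class (bo_comp (quot_repr C) (quot_repr D)))
    (fun C => quot_class (bo_adj (quot_repr C))).

End Quotient.

Definition calkin (R : realType) (H : hilbert_space R) : star_ops R[i] :=
  BH_quot (@compact_operators R H).

(* Main.v *)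
(* Let phi be a *-homomorphism on B(H) and p = phi(1). In B(H) there are isometries
   S_m with pairwise orthogonal ranges and, for all integers n_k and all signs, an
   operator T such that T S_k = R_k for every k, where R_k is the normalized signed
   sum of n_k isometries S_(k,j). Approximate phi(S_k) within 1/k by a compactly
   supported section g_k; its columns, that is its coefficients on the source
   fibres G_u, have finite support. A section approximating phi(T) has at most N
   nonzero coefficients on each source fibre, so a column of phi(R_k) =
   phi(T) phi(S_k) is close to a vector with at most N |supp g_k| nonzero entries.
   But n_k may be chosen after g_k, and a fourth moment estimate then yields signs
   for which the column of phi(R_k), whose mass is bounded below in terms of that
   of p, is spread over more entries than that. Hence p = 0.

   That Cc and Bc are closed under convolution follows from their being spanned by
   sections supported on open bisections, whose products are of the same kind. *)
From HB Require Import structures.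
Require Import Defs.
From mathcomp Require Import finmap.
From mathcomp Require Import all_boot all_order all_algebra.
From mathcomp Require Import all_classical all_reals all_analysis.
From mathcomp Require Import ring lra.
Import Order.TTheory GRing.Theory Num.Theory numFieldNormedType.Exports.

Set Implicit Arguments.
Unset Strict Implicit.
Unset Printing Implicit Defensive.

Local Open Scope classical_set_scope.
Local Open Scope ring_scope.

(** The order of the choices is the crux. [T] depends on all the n_k and all the signs, so the
    number N of an approximant of phi(T) is not known when n_k is chosen. A single [T] serving all k
    resolves this: n_k defeats columns with at most k |supp g_k| nonzero entries, and k is picked
    last, at least N and so large that |phi(T)| / k is negligible. The g_k can be fixed before the
    n_k because the S_m depend neither on the n_k nor on the signs.

    Fourth powers measure spreading: by Cauchy-Schwarz, mass d on N entries forces the fourth powers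
    to sum to at least d^2 / N, whereas suitable signs bring this sum down to 3 / n for the
    normalized sum of n orthogonal isometries.

    The coefficients have to be extended to the completion, and they must still separate its points,
    since the estimate only shows that all coefficients of p vanish. For a quotient of B(H) one
    composes with the quotient map, which respects adjoints because norm-closed ideals are
    self-adjoint. *)

Lemma complex_gt0 (R : rcfType) (e : R[i]) : 0 < e -> exists2 r : R, 0 < r & e = r%:C%C.
Proof.
by case: e => a b; rewrite ltcE/= => /andP[/eqP -> a0]; exists a.
Qed.

(** * Real-valued norms *)

Section RealNorm.
Context {R : realType}.
Implicit Types (V : normedModType R[i]).

Lemma rnormE V (x : V) : `|x| = (rnorm x)%:C%C.
Proof. by rewrite /rnorm RRe_real// realE normr_ge0. Qed.

Lemma rnorm_ge0 V (x : V) : 0 <= rnorm x.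
Proof. by rewrite -lecR -rnormE normr_ge0. Qed.

Lemma rnorm0 V : rnorm (0 : V) = 0.
Proof. by rewrite /rnorm normr0. Qed.

Lemma rnorm_eq0 V (x : V) : (rnorm x == 0) = (x == 0).
Proof. by rewrite -[RHS]normr_eq0 rnormE -(inj_eq (@complexI R)). Qed.

Lemma rnormN V (x : V) : rnorm (- x) = rnorm x.
Proof. by rewrite /rnorm normrN. Qed.

Lemma rnormB V (x y : V) : rnorm (x - y) = rnorm (y - x).
Proof. by rewrite /rnorm distrC. Qed.

Lemma ler_rnormD V (x y : V) : rnorm (x + y) <= rnorm x + rnorm y.
Proof. by rewrite -lecR rmorphD/= -!rnormE ler_normD. Qed.

Lemma rnormZ V (a : R[i]) (x : V) : rnorm (a *: x) = rnorm a * rnorm x.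
Proof.
by apply: complexI; rewrite rmorphM/= -!rnormE normrZ.
Qed.

Lemma rnormM (a b : R[i]) : rnorm (a * b) = rnorm a * rnorm b.
Proof. exact: (rnormZ a b). Qed.

Lemma rnormC (a : R) : rnorm (a%:C%C) = `|a|.
Proof. by rewrite /rnorm normc_def/= expr0n/= addr0 sqrtr_sqr. Qed.

Lemma rnormJ (a : R[i]) : rnorm (a^*)%C = rnorm a.
Proof. by rewrite /rnorm normcJ. Qed.

Lemma rnorm_circle (z : R[i]) : circle z -> rnorm z = 1.
Proof. by rewrite /circle /= /rnorm => ->. Qed.

Lemma rnorm_sqr (a : R[i]) : rnorm a ^+ 2 = complex.Re a ^+ 2 + complex.Im a ^+ 2.
Proof. by rewrite /rnorm normc_def/= sqr_sqrtr// addr_ge0 ?sqr_ge0. Qed.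

Lemma rnorm_sqr_mulJ (a : R[i]) : (rnorm a ^+ 2)%:C%C = a * (a^*)%C.
Proof. by rewrite -sqr_normc rnormE rmorphXn. Qed.

Lemma rnorm_sqrD_le V (x y : V) :
  rnorm (x + y) ^+ 2 <= 2 * rnorm x ^+ 2 + 2 * rnorm y ^+ 2.
Proof.
have h := ler_rnormD x y.
have := rnorm_ge0 (x + y); have := rnorm_ge0 x; have := rnorm_ge0 y.
have : 0 <= (rnorm x - rnorm y) ^+ 2 by exact: sqr_ge0.
nra.
Qed.

Lemma rnorm_sum V (I : Type) (r : seq I) (P : pred I) (F : I -> V) :
  rnorm (\sum_(i <- r | P i) F i) <= \sum_(i <- r | P i) rnorm (F i).
Proof.
elim/big_ind2 : _ => [|x a y b xa yb|//]; first by rewrite rnorm0.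
by apply: (le_trans (ler_rnormD _ _)); exact: lerD.
Qed.

End RealNorm.

(** * Arithmetic of C*-algebras *)

Section CstarNorm.
Context {R : realType} {A : cstar_algebra R}.
Implicit Types a b x y : A.

Lemma cs_mul0l x : cs_mul 0 x = 0 :> A.
Proof. by apply: (addIr (cs_mul 0 x)); rewrite -cs_mulDl !add0r. Qed.

Lemma cs_mul0r x : cs_mul x 0 = 0 :> A.
Proof. by apply: (addIr (cs_mul x 0)); rewrite -cs_mulDr !add0r. Qed.

Lemma cs_star0 : cs_star (0 : A) = 0.
Proof. by apply: (addIr (cs_star 0)); rewrite -cs_starD !add0r. Qed.

Lemma cs_mulBl x y z : cs_mul (x - y) z = cs_mul x z - cs_mul y z :> A.
Proof.
by rewrite cs_mulDl -[- y]scaleN1r -cs_scalerAl scaleN1r.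
Qed.

Lemma cs_mulBr x y z : cs_mul x (y - z) = cs_mul x y - cs_mul x z :> A.
Proof.
by rewrite cs_mulDr -[- z]scaleN1r -cs_scalerAr scaleN1r.
Qed.

Lemma cs_mul_suml (I : Type) (r : seq I) (P : pred I) (F : I -> A) x :
  cs_mul (\sum_(i <- r | P i) F i) x = \sum_(i <- r | P i) cs_mul (F i) x.
Proof. by apply: (big_morph (fun y => cs_mul y x) _ (cs_mul0l x)) => a b; exact: cs_mulDl. Qed.

Lemma cs_mul_sumr (I : Type) (r : seq I) (P : pred I) (F : I -> A) x :
  cs_mul x (\sum_(i <- r | P i) F i) = \sum_(i <- r | P i) cs_mul x (F i).
Proof. by apply: (big_morph (cs_mul x) _ (cs_mul0r x)) => a b; exact: cs_mulDr. Qed.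

Lemma cs_star_sum (I : Type) (r : seq I) (P : pred I) (F : I -> A) :
  cs_star (\sum_(i <- r | P i) F i) = \sum_(i <- r | P i) cs_star (F i).
Proof. by apply: (big_morph _ _ cs_star0) => a b; exact: cs_starD. Qed.

Lemma rnorm_cs_mul x y : rnorm (cs_mul x y) <= rnorm x * rnorm y.
Proof. by rewrite -lecR rmorphM/= -!rnormE cs_normM. Qed.

Lemma rnorm_cs_star_mul x : rnorm (cs_mul (cs_star x) x) = rnorm x ^+ 2.
Proof. by apply: complexI; rewrite rmorphXn/= -!rnormE cs_norm_star. Qed.

(** The C*-identity and submultiplicativity give |y|^2 <= |y^*| |y|; cancel |y|, then apply the
    result to both x and its adjoint. *)
Lemma rnorm_cs_star x : rnorm (cs_star x) = rnorm x.
Proof.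
suff H y : rnorm y <= rnorm (cs_star y).
  by apply/eqP; rewrite eq_le H -{2}(cs_starK x) H.
have := rnorm_cs_mul (cs_star y) y; rewrite rnorm_cs_star_mul.
have := rnorm_ge0 y; rewrite le_eqVlt => /predU1P[<- _|y0].
  exact: rnorm_ge0.
by rewrite expr2 ler_pM2r.
Qed.

End CstarNorm.

(** * Signed averages of orthogonal isometries *)

Section Signs.
Context {R : realType} {X : eqType}.
Implicit Types (S : X -> R[i]) (Y : seq X).

(* [psi z t] dominates the mean of [rnorm (z + X) ^+ 4] over random signed sums X
   of variance t, and does not increase when one of the signs is averaged out;
   choosing signs one by one hence derandomizes the fourth moment bound. *)
Lemma sign_potential (S b : R[i]) (t : R) : 0 <= t ->
  let psi (z : R[i]) (t : R) :=
    rnorm z ^+ 4 + 6 * rnorm z ^+ 2 * t + 3 * t ^+ 2 in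
  psi (S + b) t + psi (S - b) t <= 2 * psi S (t + rnorm b ^+ 2).
Proof.
move=> t0 /=; rewrite -![4%N]/(2 * 2)%N !exprM !rnorm_sqr.
case: S => S1 S2; case: b => b1 b2 /=.
(* Cauchy-Schwarz in the plane. With the abbreviations below, the right side minus the left side of
   the goal is 8 (p q - r^2) + 4 q^2. *)
have h : (S1 * b1 + S2 * b2) ^+ 2 <= (S1 ^+ 2 + S2 ^+ 2) * (b1 ^+ 2 + b2 ^+ 2).
  rewrite -subr_ge0; suff -> : (S1 ^+ 2 + S2 ^+ 2) * (b1 ^+ 2 + b2 ^+ 2) -
     (S1 * b1 + S2 * b2) ^+ 2 = (S1 * b2 - S2 * b1) ^+ 2 by exact: sqr_ge0.
  by ring.
set r := S1 * b1 + S2 * b2 in h; set p := S1 ^+ 2 + S2 ^+ 2 in h *.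
set q := b1 ^+ 2 + b2 ^+ 2 in h *.
have -> : (S1 + b1) ^+ 2 + (S2 + b2) ^+ 2 = p + q + 2 * r by rewrite /p /q /r; ring.
have -> : (S1 - b1) ^+ 2 + (S2 - b2) ^+ 2 = p + q - 2 * r by rewrite /p /q /r; ring.
have p0 : 0 <= p by rewrite addr_ge0 ?sqr_ge0.
have q0 : 0 <= q by rewrite addr_ge0 ?sqr_ge0.
have qq : 0 <= q ^+ 2 by exact: sqr_ge0.
nra.
Qed.

(** The offset [S] makes the induction go: the sign of the last term is fixed first and that term
    joins the offset. By [sign_potential] the potentials for the two signs add up to at most twice
    the old one, so one of them does not exceed it. *)
Lemma choose_signs_from n (w : nat -> X -> R[i]) Y S :
  exists s : nat -> bool,
    \sum_(y <- Y) rnorm (S y + \sum_(j < n) (-1) ^+ s j * w j y) ^+ 4 <=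
    \sum_(y <- Y) (rnorm (S y) ^+ 4 +
      6 * rnorm (S y) ^+ 2 * (\sum_(j < n) rnorm (w j y) ^+ 2) +
      3 * (\sum_(j < n) rnorm (w j y) ^+ 2) ^+ 2).
Proof.
elim: n S => [|n IH] S.
  exists xpredT; apply: ler_sum => y _.
  by rewrite !big_ord0 addr0 mulr0 addr0 expr0n/= mulr0 addr0.
pose t n y := \sum_(j < n) rnorm (w j y) ^+ 2.
pose psi (z : R[i]) (t : R) :=
  rnorm z ^+ 4 + 6 * rnorm z ^+ 2 * t + 3 * t ^+ 2.
have t0 y : 0 <= t n y by apply: sumr_ge0 => j _; exact: sqr_ge0.
have [b hb] : exists b : bool,
    \sum_(y <- Y) psi (S y + (-1) ^+ b * w n y) (t n y) <=
    \sum_(y <- Y) psi (S y) (t n.+1 y).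
  have h : \sum_(y <- Y) psi (S y + w n y) (t n y) +
           \sum_(y <- Y) psi (S y - w n y) (t n y) <=
           2 * \sum_(y <- Y) psi (S y) (t n.+1 y).
    rewrite -big_split mulr_sumr; apply: ler_sum => y _.
    have := sign_potential (S y) (w n y) (t0 y).
    by rewrite [t n.+1 y]big_ord_recr.
  case: (lerP (\sum_(y <- Y) psi (S y + w n y) (t n y))
              (\sum_(y <- Y) psi (S y) (t n.+1 y))) => h1.
    by exists false; under eq_bigr => y _ do rewrite expr0 mul1r.
  exists true; under eq_bigr => y _ do rewrite expr1 mulN1r.
  move: h h1; set u := \sum_(y <- Y) _; set v := \sum_(y <- Y) _.
  by set w' := \sum_(y <- Y) _ => h h1; lra.
have [s hs] := IH (fun y => S y + (-1) ^+ b * w n y).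
exists (fun j => if (j < n)%N then s j else b).
apply: le_trans _ hb; apply: le_trans _ hs.
rewrite le_eqVlt; apply/orP; left; apply/eqP; apply: eq_bigr => y _.
rewrite big_ord_recr/= ltnn addrA addrAC; congr (rnorm (_ + _ + _) ^+ 4).
by apply: eq_bigr => j _; rewrite ltn_ord.
Qed.

Lemma choose_signs n (w : nat -> X -> R[i]) Y :
  exists s : nat -> bool,
    \sum_(y <- Y) rnorm (\sum_(j < n) (-1) ^+ s j * w j y) ^+ 4 <=
    3 * \sum_(y <- Y) (\sum_(j < n) rnorm (w j y) ^+ 2) ^+ 2.
Proof.
have [s hs] := choose_signs_from n w Y (fun=> 0).
exists s; move: hs; under eq_bigr do rewrite add0r.
move=> /le_trans; apply; rewrite mulr_sumr; apply: ler_sum => y _.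
by rewrite rnorm0 !expr0n/= mulr0 mul0r !add0r.
Qed.

End Signs.

Lemma ler_sum_uniq_sub (R : numDomainType) (X : eqType) (Y Z : seq X)
    (F : X -> R) : uniq Y -> uniq Z -> {subset Y <= Z} ->
  (forall x, 0 <= F x) -> \sum_(y <- Y) F y <= \sum_(y <- Z) F y.
Proof.
move=> uY uZ YZ F0.
have YZ' : perm_eq Y [seq y <- Z | y \in Y].
  apply: uniq_perm; rewrite ?filter_uniq// => y; rewrite mem_filter.
  by case: (boolP (y \in Y)) => // /YZ ->.
rewrite (perm_big _ YZ') /= big_filter big_mkcond; apply: ler_sum => y _.
by case: ifP.
Qed.

(** * Columns with few nonzero entries *)

Section SparseColumns.
Context {R : realType} {A : cstar_algebra R} {X : eqType}.
(* The coefficients [ev x a], for [x] in [P], stand for one column of a matrix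
   representing [a]. *)
Variables (P : set X) (ev : X -> A -> R[i]).

Definition finite_in (Y : seq X) : Prop := uniq Y /\ forall y, y \in Y -> P y.

Definition column_mass (Y : seq X) (a : A) : R :=
  \sum_(y <- Y) rnorm (ev y a) ^+ 2.

Definition column_support (Y : seq X) (a : A) : Prop :=
  forall y, P y -> y \notin Y -> ev y a = 0.

Hypothesis evD : forall y a b, P y -> ev y (a + b) = ev y a + ev y b.
Hypothesis evZ : forall y c a, P y -> ev y (c *: a) = c * ev y a.
Hypothesis mass_le : forall Y a, finite_in Y -> column_mass Y a <= rnorm a ^+ 2.
(** [C] bounds the mass over every finite subset of [P], because one entry of a product involves the
    whole column of the right factor. The factor 4 is what two approximations cost in [ev_massM]. *)
Hypothesis massM : forall a b (C : R),
  (forall Y, finite_in Y -> column_mass Y b <= C) ->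
  forall Y, finite_in Y -> column_mass Y (cs_mul a b) <= 4 * (rnorm a ^+ 2 * C).

Lemma ev0 y : P y -> ev y 0 = 0.
Proof. by move=> Py; rewrite -(scale0r 0) evZ// mul0r. Qed.

Lemma ev_sum y (I : Type) (r : seq I) (Q : pred I) (F : I -> A) : P y ->
  ev y (\sum_(i <- r | Q i) F i) = \sum_(i <- r | Q i) ev y (F i).
Proof.
move=> Py; apply: (big_morph (ev y) _ (ev0 Py)) => a b; exact: evD.
Qed.

Variables (p : A) (a : nat -> A).
Hypothesis p_self_adjoint : cs_star p = p.
Hypothesis p_idempotent : cs_mul p p = p.
Hypothesis a_orthogonal :
  forall l m, cs_mul (cs_star (a l)) (a m) = if l == m then p else 0.

(** The C*-identity reads |p| = |p|^2 here. *)
Lemma rnorm_projection : rnorm p <= 1.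
Proof.
have := rnorm_cs_star_mul p; rewrite p_self_adjoint p_idempotent.
have := rnorm_ge0 p; nra.
Qed.

Lemma comb_star_mul n (h : nat -> nat) (c : nat -> R[i]) :
  injective h ->
  cs_mul (cs_star (\sum_(j < n) c j *: a (h j))) (\sum_(j < n) c j *: a (h j)) =
  (\sum_(j < n) rnorm (c j) ^+ 2)%:C%C *: p.
Proof.
move=> hI; rewrite cs_star_sum cs_mul_suml rmorph_sum scaler_suml.
apply: eq_bigr => i _; rewrite cs_mul_sumr (bigD1 i)//= big1 ?addr0.
  rewrite cs_starZ -cs_scalerAl -cs_scalerAr a_orthogonal eqxx scalerA.
  by rewrite rnorm_sqr_mulJ mulrC.
move=> j ji; rewrite cs_starZ -cs_scalerAl -cs_scalerAr a_orthogonal.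
case: eqP => [/hI/ord_inj ij|_]; last by rewrite !scaler0.
by rewrite ij eqxx in ji.
Qed.

(** A duality argument. Let q be the sum and B the combination of the [a (h j)] with the conjugates
    of their entries at y as coefficients. Then [ev y B] is q and |B|^2 <= q, while [mass_le] on the
    single entry y gives |ev y B| <= |B|. Hence q^2 <= q. *)
Lemma bessel_column n (h : nat -> nat) y : injective h -> P y ->
  \sum_(j < n) rnorm (ev y (a (h j))) ^+ 2 <= 1.
Proof.
move=> hI Py; set q := (X in X <= 1).
pose c j := ((ev y (a (h j)))^*)%C.
pose B := \sum_(j < n) c j *: a (h j).
have q0 : 0 <= q by apply: sumr_ge0 => j _; exact: sqr_ge0.
have evB : ev y B = q%:C%C.
  rewrite ev_sum// rmorph_sum; apply: eq_bigr => j _.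
  by rewrite evZ//= rnorm_sqr_mulJ mulrC.
have nB : rnorm B ^+ 2 <= q.
  rewrite -rnorm_cs_star_mul comb_star_mul// rnormZ rnormC.
  under eq_bigr do rewrite rnormJ.
  rewrite ger0_norm// -[leRHS]mulr1 ler_wpM2l//; exact: rnorm_projection.
have : column_mass [:: y] B <= rnorm B ^+ 2.
  by apply: mass_le; split => // z; rewrite inE => /eqP ->.
rewrite /column_mass big_seq1 evB rnormC ger0_norm//.
nra.
Qed.

Definition signed_average n (h : nat -> nat) (s : nat -> bool) : A :=
  \sum_(j < n) (((Num.sqrt n%:R)^-1)%:C%C * (-1) ^+ s j) *: a (h j).

Lemma signed_average_star_mul n (h : nat -> nat) (s : nat -> bool) :
  injective h -> (0 < n)%N ->
  cs_mul (cs_star (signed_average n h s)) (signed_average n h s) = p.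
Proof.
move=> hI n0.
have := comb_star_mul n (fun j => ((Num.sqrt n%:R)^-1)%:C%C * (-1) ^+ s j) hI.
rewrite -/(signed_average n h s) => ->; rewrite -[RHS]scale1r; congr (_ *: _).
have nR : 0 < n%:R :> R by rewrite ltr0n.
rewrite (eq_bigr (fun=> n%:R^-1)); last first.
  move=> j _; rewrite rnormM rnormC /rnorm normr_sign/= mulr1.
  by rewrite ger0_norm ?invr_ge0 ?sqrtr_ge0// exprVn sqr_sqrtr// ltW.
by rewrite sumr_const card_ord -[X in X%:C%C]mulr_natr mulVf ?gt_eqF.
Qed.

(** Cauchy-Schwarz for the squares x = |ev y b|^2, obtained by summing 2 N d x <= N^2 x^2 + d^2 over
    the at most N entries of [Z]. *)
Lemma mass_amgm N Z b (d : R) : (size Z <= N)%N -> d <= column_mass Z b -> 0 < d ->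
  d ^+ 2 <= N%:R * \sum_(y <- Z) rnorm (ev y b) ^+ 4.
Proof.
move=> ZN dZ d0.
have h : 2 * N%:R * d * column_mass Z b <=
   N%:R ^+ 2 * (\sum_(y <- Z) rnorm (ev y b) ^+ 4) + N%:R * d ^+ 2.
  have : (size Z)%:R * d ^+ 2 <= N%:R * d ^+ 2.
    by rewrite ler_wpM2r ?sqr_ge0// ler_nat.
  rewrite -(lerD2l (N%:R ^+ 2 * (\sum_(y <- Z) rnorm (ev y b) ^+ 4))).
  apply: le_trans; rewrite !mulr_sumr.
  have -> : (size Z)%:R * d ^+ 2 = \sum_(y <- Z) d ^+ 2.
    by rewrite big_const_seq count_predT iter_addr_0 mulr_natl.
  rewrite -big_split/=; apply: ler_sum => y _.
  rewrite -[4%N]/(2 * 2)%N exprM -subr_ge0.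
  set x := rnorm _ ^+ 2.
  suff -> : N%:R ^+ 2 * x ^+ 2 + d ^+ 2 - 2 * N%:R * d * x = (N%:R * x - d) ^+ 2.
    exact: sqr_ge0.
  by ring.
(* For N = 0 the list [Z] is empty and its mass 0 contradicts 0 < d; otherwise N can be
   cancelled. *)
case: N ZN h => [|N] ZN h.
  move: ZN dZ; rewrite leqn0 => /nilP ->; rewrite /column_mass big_nil.
  by move=> /(lt_le_trans d0); rewrite ltxx.
have N0 : 0 < N.+1%:R :> R by rewrite ltr0n.
set q := \sum_(y <- Z) _ in h *.
have h2 : 2 * N.+1%:R * d * d <= 2 * N.+1%:R * d * column_mass Z b.
  by apply: ler_wpM2l => //; rewrite !mulr_ge0 ?ltW.
rewrite -(ler_pM2l N0).
set M := N.+1%:R in N0 h h2 *.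
have -> : M * (M * q) = M ^+ 2 * q by ring.
have -> : M * d ^+ 2 = 2 * M * d * d - M * d ^+ 2 by ring.
lra.
Qed.

(** [choose_signs] works on a finite set fixed in advance, whereas [Z] may depend on the signs. But
    only finitely many sign patterns matter: if each had a sparse [Z] carrying mass d, the union [Y]
    of these sets would be finite, and the signs chosen for [Y] would violate [mass_amgm] as soon as
    n exceeds 3 N / d^2. *)
Lemma signed_average_not_sparse N (d : R) : 0 < d ->
  exists2 n, (0 < n)%N & forall h, injective h -> exists s, forall Z, finite_in Z ->
    (size Z <= N)%N -> column_mass Z (signed_average n h s) < d.
Proof.
move=> d0; have d2 : 0 < d ^+ 2 by rewrite exprn_gt0.
have [n hn] : exists n, 3 * N%:R / d ^+ 2 < n.+1%:R.
  exists (Num.bound (3 * N%:R / d ^+ 2)).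
  have h0 : 0 <= 3 * N%:R / d ^+ 2.
    apply: divr_ge0; last exact: ltW.
    by rewrite mulr_ge0 ?ler0n.
  by apply: lt_trans (archi_boundP h0) _; rewrite ltr_nat.
exists n.+1 => // h hI; apply: contrapT => hs.
have {hs}bad (s : {ffun 'I_n.+1 -> bool}) : exists Z : seq X,
    [/\ finite_in Z, (size Z <= N)%N &
    d <= column_mass Z (signed_average n.+1 h (fun j => s (inord j)))].
  apply: contrapT => hZ; apply: hs; exists (fun j => s (inord j)) => Z fZ sZ.
  by rewrite ltNge; apply/negP => dZ; apply: hZ; exists Z.
have [Zf hZ] := choice bad.
pose Y := undup (flatten [seq Zf s | s <- enum {ffun 'I_n.+1 -> bool}]).
have YP y : y \in Y -> P y.
  rewrite mem_undup => /flattenP[_ /mapP[s _ ->] ys].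
  by have [[_ +] _ _] := hZ s; apply.
have [s hs] := choose_signs n.+1 (fun j y => ev y (a (h j))) Y.
pose t := [ffun j : 'I_n.+1 => s j].
have [[uZ ZP] sZ dZ] := hZ t.
have := mass_amgm sZ dZ d0; apply/negP; rewrite -ltNge.
set b := signed_average _ _ _.
have nR : 0 < n.+1%:R :> R by rewrite ltr0n.
have evb y : y \in Y -> rnorm (ev y b) ^+ 4 =
    n.+1%:R ^- 2 * rnorm (\sum_(j < n.+1) (-1) ^+ s j * ev y (a (h j))) ^+ 4.
  move=> /YP Py; rewrite ev_sum//.
  under eq_bigr => j _ do rewrite evZ// ffunE inord_val -mulrA.
  rewrite -mulr_sumr rnormM rnormC exprMn; congr (_ * _).
  rewrite ger0_norm ?invr_ge0 ?sqrtr_ge0// exprVn -[4%N]/(2 * 2)%N exprM.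
  by rewrite sqr_sqrtr// ltW.
(* By Bessel the variance at y is at most 1, so its square is at most itself. Summed over [Y] and
   then over j, these variances give at most n, since each column has mass at most 1; the
   normalization n^-2 leaves 3 / n. *)
have q1 y : P y -> (\sum_(j < n.+1) rnorm (ev y (a (h j))) ^+ 2) ^+ 2 <=
    \sum_(j < n.+1) rnorm (ev y (a (h j))) ^+ 2.
  move=> Py; have := bessel_column n.+1 hI Py; set q := (X in X <= 1) => q1.
  have q0 : 0 <= q by apply: sumr_ge0 => j _; exact: sqr_ge0.
  by rewrite expr2 -[leRHS]mul1r ler_wpM2r.
have ub : \sum_(y <- Y) rnorm (ev y b) ^+ 4 <= 3 / n.+1%:R.
  rewrite big_seq (eq_bigr _ evb) -big_seq -mulr_sumr.
  have : \sum_(y <- Y) (\sum_(j < n.+1) rnorm (ev y (a (h j))) ^+ 2) ^+ 2 <=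
     n.+1%:R.
    apply: (@le_trans _ _ (\sum_(y <- Y) \sum_(j < n.+1) rnorm (ev y (a (h j))) ^+ 2)).
      by rewrite !big_seq; apply: ler_sum => y /YP; exact: q1.
    rewrite exchange_big/= -[leRHS]mulr_natl mulr1 -[in leRHS](card_ord n.+1) -sum1_card.
    rewrite natr_sum; apply: ler_sum => j _.
    apply: (le_trans (mass_le _ _)); first by split; [exact: undup_uniq|].
    rewrite -rnorm_cs_star_mul a_orthogonal eqxx; exact: rnorm_projection.
  set Q := \sum_(y <- Y) _ => hQ.
  rewrite mulrC ler_pdivrMr ?exprn_gt0// (le_trans hs)//.
  rewrite expr2 mulrA divfK ?gt_eqF//.
  by rewrite ler_wpM2l.
have sub : \sum_(y <- Zf t) rnorm (ev y b) ^+ 4 <= \sum_(y <- Y) rnorm (ev y b) ^+ 4.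
  apply: ler_sum_uniq_sub => //; first exact: undup_uniq.
  - move=> y yZ; rewrite mem_undup; apply/flattenP; exists (Zf t) => //.
    by apply/mapP; exists t => //; rewrite mem_enum.
  - by move=> y; rewrite -[4%N]/(2 * 2)%N exprM sqr_ge0.
apply: (@le_lt_trans _ _ (N%:R * (3 / n.+1%:R))).
  by rewrite ler_wpM2l// (le_trans sub).
move: hn; rewrite ltr_pdivrMr// mulrA ltr_pdivrMr// => hn.
by rewrite mulrC [d ^+ 2 * _]mulrC.
Qed.

(* [t] plays the role of an operator mapping the range of [a k] to the range of
   the k-th signed average; it is a limit of elements [b] with finitely many
   entries per column, which makes the k-th signed average sparser than it can
   be for a suitable choice of signs. *)
Lemma sparse_columns_contradiction (D : set A) (pair : nat -> nat -> nat) :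
  (forall k, injective (pair k)) ->
  (forall x e, 0 < e -> exists2 b, D b & rnorm (x - b) < e) ->
  (forall b, D b -> exists2 Y, finite_in Y & column_support Y b) ->
  (forall b, D b -> exists N, forall Y c, D c -> finite_in Y -> column_support Y c ->
    exists Z, [/\ finite_in Z, (size Z <= N * size Y)%N &
      column_support Z (cs_mul b c)]) ->
  (forall (n : nat -> nat) (s : nat -> nat -> bool), (forall k, (0 < n k)%N) ->
    exists t, forall k, cs_mul t (a k) = signed_average (n k) (pair k) (s k)) ->
  forall y, P y -> ev y p = 0.
Proof.
move=> pairI dense fin sparse amplify y Py; apply: contrapT => yp.
pose c := rnorm (ev y p) ^+ 2.
have c0 : 0 < c by rewrite exprn_gt0// lt_def rnorm_ge0 rnorm_eq0 andbT; apply/eqP.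
(* Since p = r^* r for the average r, [massM] bounds c, the mass of p at y, by 4 times any bound for
   the mass of r; the bound c / 5 is thus impossible. *)
have mass_av n h s : injective h -> (0 < n)%N ->
    exists2 Y, finite_in Y & c / 5 < column_mass Y (signed_average n h s).
  move=> hI n0; apply: contrapT => hY.
  have hY' Y : finite_in Y -> column_mass Y (signed_average n h s) <= c / 5.
    by move=> fY; rewrite leNgt; apply/negP => hc; apply: hY; exists Y.
  have fy : finite_in [:: y] by split => // z; rewrite inE => /eqP ->.
  have := massM (cs_star (signed_average n h s)) hY' fy.
  rewrite signed_average_star_mul// /column_mass big_seq1 -/c rnorm_cs_star.
  rewrite -rnorm_cs_star_mul signed_average_star_mul//.
  have := rnorm_projection; have := rnorm_ge0 p; nra.
have g_ex k : exists gY : A * seq X, [/\ D gY.1, rnorm (a k - gY.1) < k.+1%:R^-1,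
    finite_in gY.2 & column_support gY.2 gY.1].
  have k0 : 0 < k.+1%:R^-1 :> R by rewrite invr_gt0 ltr0n.
  have [g Dg ag] := dense (a k) _ k0.
  by have [Y fY sY] := fin g Dg; exists (g, Y).
have [gY hgY] := choice g_ex; pose g k := (gY k).1; pose v k := size (gY k).2.
have d0 : 0 < c / 40 by rewrite divr_gt0.
(* [k * v k] stands in for N times the size of the support of [g k], as N will be known only after
   [t] has been approximated. *)
have ns k : exists n, (0 < n)%N /\ exists s, forall Z, finite_in Z ->
    (size Z <= k * v k)%N -> column_mass Z (signed_average n (pair k) s) < c / 40.
  by have [n n0 hn] := signed_average_not_sparse (k * v k) d0; exists n; split; auto.
have [n /all_and2[n0 /choice[s hs]]] := choice ns.
have [t ht] := amplify n s n0.
have c1 : c <= 1.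
  have fy : finite_in [:: y] by split => // z; rewrite inE => /eqP ->.
  have := mass_le p fy; rewrite /column_mass big_seq1 -/c.
  have := rnorm_projection; have := rnorm_ge0 p; nra.
(* Chosen so that the error 3 e = c / 10 of [rF] has square at most c / 100, as c <= 1. *)
pose e := c / 30; have e0 : 0 < e by rewrite divr_gt0.
have [b Db tb] := dense t e e0; have [N hN] := sparse b Db.
(* The first summand makes [k * v k] at least [N * v k]; the second makes the error |t| / (k + 1) at
   most e. *)
pose k := (N + Num.bound (rnorm t / e))%N.
have tk : rnorm t / k.+1%:R <= e.
  rewrite ler_pdivrMr ?ltr0n// mulrC -ler_pdivrMr//.
  have /archi_boundP/ltW/le_trans : 0 <= rnorm t / e.
    by rewrite divr_ge0 ?rnorm_ge0// ltW.
  by apply; rewrite ler_nat (leq_trans (leq_addl N _))// leqnSn.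
have [Dg ag fY gS] := hgY k; rewrite -/(g k) in Dg ag gS.
have [Z [fZ sZ bgZ]] := hN _ _ Dg fY gS.
set F := cs_mul b (g k) in bgZ.
have := hs k Z fZ (leq_trans sZ (leq_mul (leq_addr _ _) (leqnn _))).
have [Y fY' hY] := mass_av (n k) (pair k) (s k) (pairI k) (n0 k).
move: hY; rewrite -ht; set r := cs_mul t (a k) => hY hZ.
have a1 : rnorm (a k) <= 1.
  have := rnorm_cs_star_mul (a k); rewrite a_orthogonal eqxx.
  have := rnorm_projection; have := rnorm_ge0 (a k); nra.
have rF : rnorm (r - F) <= 3 * e.
  have -> : r - F = cs_mul t (a k - g k) + cs_mul (t - b) (g k).
    by rewrite cs_mulBl cs_mulBr /r /F addrA subrK.
  apply: (le_trans (ler_rnormD _ _)).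
  have g2 : rnorm (g k) <= 2.
    have -> : g k = a k - (a k - g k) by rewrite opprB addrC subrK.
    apply: (le_trans (ler_rnormD _ _)); rewrite rnormN.
    have k1 : k.+1%:R^-1 <= 1 :> R by rewrite invf_le1 ?ltr0n// ler1n.
    by have := ltW (lt_le_trans ag k1); lra.
  have h1 : rnorm (cs_mul t (a k - g k)) <= e.
    apply: (le_trans (rnorm_cs_mul _ _)); apply: le_trans tk.
    by rewrite ler_wpM2l ?rnorm_ge0// ltW.
  have h2 : rnorm (cs_mul (t - b) (g k)) <= e * 2.
    apply: (le_trans (rnorm_cs_mul _ _)).
    by rewrite ler_pM ?rnorm_ge0// ltW.
  lra.
have rF2 : rnorm (r - F) ^+ 2 <= c / 100.
  have := rnorm_ge0 (r - F); move: rF; rewrite /e; nra.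
have split_mass W x x' : finite_in W ->
    column_mass W x <= 2 * column_mass W x' + 2 * rnorm (x - x') ^+ 2.
  move=> fW; have [_ WP] := fW.
  have := mass_le (x - x') fW => hx.
  have : column_mass W x <= 2 * column_mass W x' + 2 * column_mass W (x - x').
    rewrite /column_mass !mulr_sumr -big_split/= !big_seq; apply: ler_sum => z /WP Pz.
    by rewrite -[in leLHS](subrKC x' x) (evD x' (x - x'))// rnorm_sqrD_le.
  lra.
have h1 := split_mass Y r F fY'.
have h2 := split_mass Z F r fZ.
rewrite rnormB in h2.
(* All nonzero entries of F lie in [Z], so no other finite set can carry more of its mass. *)
have YZ : column_mass Y F <= column_mass Z F.
  rewrite /column_mass (bigID (mem Z))/= [X in _ + X]big1_seq ?addr0.
    rewrite -big_filter; apply: ler_sum_uniq_sub.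
    - by rewrite filter_uniq//; case: fY'.
    - by case: fZ.
    - by move=> z; rewrite mem_filter => /andP[].
    - by move=> z; exact: sqr_ge0.
  move=> z /andP[zZ zY]; rewrite bgZ ?rnorm0 ?expr0n//.
  by case: fY' => _; apply.
(* In terms of masses: c / 5 < r(Y) <= 2 F(Y) + c / 50 <= 2 F(Z) + c / 50 <= 4 r(Z) + 3 c / 50.
   Hence r(Z) > 7 c / 200, which exceeds c / 40. *)
move: hZ; apply/negP; rewrite -leNgt; lra.
Qed.

End SparseColumns.

(** * Hilbert spaces *)

(** Letting m tend to infinity in the hypothesis removes its first term, so the limit is approached
    at the explicit rate 1 / (n + 1). *)
Lemma fast_cauchy_cvg (R : realType) (V : completeNormedModType R[i])
    (u : nat -> V) :
  (forall m n, rnorm (u m - u n) <= m.+1%:R^-1 + n.+1%:R^-1) ->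
  exists l, forall n, rnorm (u n - l) <= n.+1%:R^-1.
Proof.
move=> hu.
have cu : cvgn u.
  apply/cauchy_cvgP/cauchy_ballP => _ /complex_gt0[r r0 ->].
  have r2 : 0 < r / 2 by rewrite divr_gt0.
  have /filter_ex[N hN] : \forall k \near \oo, k.+1%:R^-1 < r / 2.
    exact: near_infty_natSinv_lt (PosNum r2).
  have h (k : nat) : (N <= k)%N -> k.+1%:R^-1 < r / 2.
    move=> Nk; apply: le_lt_trans hN.
    by rewrite lef_pV2 ?posrE ?ltr0n// ler_nat ltnS.
  pose A := u @` [set k | (N <= k)%N].
  exists (A, A).
    by split; exists N => // k /= Nk; exists k.
  move=> [_ _] [/= [m Nm <-] [n Nn <-]].
  rewrite -ball_normE/= rnormE ltcR.
  by apply: le_lt_trans (hu _ _) _; rewrite [ltRHS](splitr r) ltrD// h.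
exists (lim (u @ \oo)) => n.
apply/ler_addgt0Pr => e e0.
have [k [nk hk]] : exists k : nat, k.+1%:R^-1 < e / 2 /\ rnorm (u k - lim (u @ \oo)) < e / 2.
  have e2 : 0 < e / 2 by rewrite divr_gt0.
  have e2C : 0 < (e / 2)%:C%C :> R[i] by rewrite ltcR.
  have /cvgrPdistC_lt/(_ _ e2C) h1 : u @ \oo --> lim (u @ \oo) by [].
  have h2 : \forall k \near \oo, k.+1%:R^-1 < e / 2 by exact: near_infty_natSinv_lt (PosNum e2).
  have [k [hk1 hk2]] := filter_ex (filterI h1 h2).
  by exists k; split => //; move: hk1; rewrite /= rnormE ltcR.
have -> : u n - lim (u @ \oo) = (u n - u k) + (u k - lim (u @ \oo)).
  by rewrite addrA subrK.
apply: (le_trans (ler_rnormD _ _)).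
apply: (le_trans (lerD (hu n k) (ltW hk))).
by rewrite -addrA lerD2l [leRHS](splitr e) lerD2r ltW.
Qed.

Lemma conjcM (R : rcfType) (a b : R[i]) : conjc (a * b) = conjc a * conjc b.
Proof. exact: rmorphM. Qed.

Lemma conjcR (R : rcfType) (r : R) : conjc r%:C%C = r%:C%C.
Proof. exact: conjc_real. Qed.

Section InnerProduct.
Context {R : realType} {H : hilbert_space R}.
Implicit Types x y z : H.

Lemma innerDl x y z : inner (x + y) z = inner x z + inner y z.
Proof. by rewrite -[x]scale1r inner_linear mul1r scale1r. Qed.

Lemma inner0l z : inner 0 z = 0.
Proof. by apply: (addIr (inner 0 z)); rewrite -innerDl !add0r. Qed.

Lemma innerZl a x z : inner (a *: x) z = a * inner x z.
Proof. by rewrite -[a *: x]addr0 inner_linear inner0l addr0. Qed.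

Lemma innerNl x z : inner (- x) z = - inner x z.
Proof. by rewrite -scaleN1r innerZl mulN1r. Qed.

Lemma innerBl x y z : inner (x - y) z = inner x z - inner y z.
Proof. by rewrite innerDl innerNl. Qed.

Lemma innerDr x y z : inner z (x + y) = inner z x + inner z y.
Proof. by rewrite inner_conj innerDl rmorphD/= -!inner_conj. Qed.

Lemma innerZr a x z : inner z (a *: x) = (a^*)%C * inner z x.
Proof. by rewrite inner_conj innerZl rmorphM/= -!inner_conj. Qed.

Lemma inner0r z : inner z 0 = 0.
Proof. by rewrite inner_conj inner0l rmorph0. Qed.

Lemma innerNr x z : inner z (- x) = - inner z x.
Proof. by rewrite inner_conj innerNl rmorphN/= -!inner_conj. Qed.

Lemma innerBr x y z : inner z (x - y) = inner z x - inner z y.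
Proof. by rewrite innerDr innerNr. Qed.

Lemma inner_suml (I : Type) (r : seq I) (P : pred I) (F : I -> H) z :
  inner (\sum_(i <- r | P i) F i) z = \sum_(i <- r | P i) inner (F i) z.
Proof. by apply: (big_morph (fun x => inner x z) _ (inner0l z)) => x y; exact: innerDl. Qed.

Lemma inner_sumr (I : Type) (r : seq I) (P : pred I) (F : I -> H) z :
  inner z (\sum_(i <- r | P i) F i) = \sum_(i <- r | P i) inner z (F i).
Proof. by apply: (big_morph (inner z) _ (inner0r z)) => x y; exact: innerDr. Qed.

Lemma inner_rnorm x : inner x x = (rnorm x ^+ 2)%:C%C.
Proof. by rewrite inner_norm rnormE rmorphXn. Qed.

Lemma rnorm_sqrD x y : rnorm (x + y) ^+ 2 =
  rnorm x ^+ 2 + rnorm y ^+ 2 + 2 * complex.Re (inner x y).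
Proof.
apply: complexI; rewrite -inner_rnorm innerDl !innerDr !rmorphD/= -!inner_rnorm.
rewrite (inner_conj x y).
have -> : (2 * complex.Re (inner x y))%:C%C = inner x y + (inner x y)^*%C.
  by case: (inner x y) => a b; rewrite /= -[RHS]/((a + a) +i* (b - b))%C subrr mulr2n mulrDl mul1r.
by ring.
Qed.

Lemma cauchy_schwarz x y : rnorm (inner x y) <= rnorm x * rnorm y.
Proof.
have [->|y0] := eqVneq y 0; first by rewrite inner0r !rnorm0 mulr0.
have ny : 0 < rnorm y by rewrite lt_def rnorm_ge0 rnorm_eq0 y0.
have ny2 : 0 < rnorm y ^+ 2 by rewrite exprn_gt0.
pose c := ((rnorm y ^+ 2)^-1)%:C%C * inner x y.
have := sqr_ge0 (rnorm (x - c *: y)).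
rewrite rnorm_sqrD rnormN rnormZ innerNr innerZr.
have -> : complex.Re (- ((c^*)%C * inner x y)) = - (rnorm (inner x y) ^+ 2 / rnorm y ^+ 2).
  rewrite /c conjcM conjcR -mulrA [_ * inner x y]mulrC.
  by rewrite -rnorm_sqr_mulJ -rmorphM/= mulrC.
have -> : rnorm c = rnorm (inner x y) / rnorm y ^+ 2.
  by rewrite rnormM rnormC ger0_norm ?invr_ge0 ?ltW// mulrC.
have xy0 := rnorm_ge0 (inner x y); have x0 := rnorm_ge0 x.
set u := rnorm (inner x y) in xy0 *; set v := rnorm y in ny ny2 *; set w := rnorm x in x0 *.
have -> : w ^+ 2 + (u / v ^+ 2 * v) ^+ 2 + 2 * - (u ^+ 2 / v ^+ 2) = w ^+ 2 - u ^+ 2 / v ^+ 2.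
  by field; rewrite gt_eqF.
rewrite subr_ge0 ler_pdivrMr// -exprMn => h.
by rewrite -(@ler_pXn2r _ 2)// ?nnegrE// ?mulr_ge0// ltW.
Qed.

Definition orthonormal_family (I : eqType) (e : I -> H) : Prop :=
  forall i j, inner (e i) (e j) = (i == j)%:R.

Definition total_family (I : eqType) (e : I -> H) : Prop :=
  forall x, (forall i, inner x (e i) = 0) -> x = 0.

Section Orthonormal.
Context (I : eqType) (e : I -> H) (oe : orthonormal_family e).

Lemma inner_comb (c : I -> R[i]) (s : seq I) i : uniq s ->
  inner (\sum_(j <- s) c j *: e j) (e i) = if i \in s then c i else 0.
Proof.
move=> us; rewrite inner_suml; case: ifPn => si.
  rewrite (bigD1_seq i)//= innerZl oe eqxx mulr1 big1_seq ?addr0// => j /andP[ji _].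
  by rewrite innerZl oe (negbTE ji) mulr0.
rewrite big1_seq// => j /andP[_ js]; rewrite innerZl oe.
by case: eqP js si => [-> ->//|]; rewrite mulr0.
Qed.

Lemma rnorm_comb (c : I -> R[i]) (s : seq I) : uniq s ->
  rnorm (\sum_(j <- s) c j *: e j) ^+ 2 = \sum_(j <- s) rnorm (c j) ^+ 2.
Proof.
move=> us; apply: complexI; rewrite -inner_rnorm inner_sumr rmorph_sum/= [LHS]big_seq [RHS]big_seq.
apply: eq_bigr => i si; rewrite innerZr inner_comb// si mulrC.
exact/esym/rnorm_sqr_mulJ.
Qed.

Lemma bessel x (s : seq I) : uniq s ->
  \sum_(j <- s) rnorm (inner x (e j)) ^+ 2 <= rnorm x ^+ 2.
Proof.
move=> us; pose y := \sum_(j <- s) inner x (e j) *: e j.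
rewrite -rnorm_comb// -/y.
have xy : inner x y = (rnorm y ^+ 2)%:C%C.
  rewrite rnorm_comb// rmorph_sum/= /y inner_sumr; apply: eq_bigr => i _.
  by rewrite innerZr mulrC rnorm_sqr_mulJ.
have := sqr_ge0 (rnorm (x - y)); rewrite rnorm_sqrD rnormN innerNr xy -rmorphN/=.
lra.
Qed.

(** The index type may be uncountable, so the sum is not treated as a series. Finite sets [s n]
    whose square sums come within (n + 1)^-2 of the supremum give a Cauchy sequence, since enlarging
    [s n] adds a vector of norm at most 1 / (n + 1). *)
Lemma riesz_fischer (c : I -> R[i]) (M : R) :
  (forall s, uniq s -> \sum_(j <- s) rnorm (c j) ^+ 2 <= M) ->
  exists y, [/\ forall i, inner y (e i) = c i, rnorm y ^+ 2 <= M &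
    forall d : R, 0 < d -> exists2 s, uniq s & rnorm (y - \sum_(j <- s) c j *: e j) < d].
Proof.
move=> hM; pose S := [set t | exists2 s, uniq s & t = \sum_(j <- s) rnorm (c j) ^+ 2].
have S0 : has_sup S.
  split; first by exists 0; exists [::] => //; rewrite big_nil.
  by exists M => _ [s us ->]; exact: hM.
have near_sup (d : R) : 0 < d -> exists2 s, uniq s & sup S - d < \sum_(j <- s) rnorm (c j) ^+ 2.
  move=> d0; have [_ [s us ->] hs] := sup_adherent d0 S0; by exists s.
pose Y s := \sum_(j <- s) c j *: e j.
have tail s t (d : R) : uniq s -> uniq t -> sup S - d < \sum_(j <- s) rnorm (c j) ^+ 2 ->
    {subset s <= t} -> rnorm (Y t - Y s) ^+ 2 <= d.
  move=> us ut hs st.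
  have pst : perm_eq s [seq j <- t | j \in s].
    apply: uniq_perm; rewrite ?filter_uniq// => j; rewrite mem_filter.
    by case: (boolP (j \in s)) => // /st ->.
  have split_t (V : nmodType) (F : I -> V) : \sum_(j <- t) F j =
      \sum_(j <- s) F j + \sum_(j <- [seq j <- t | j \notin s]) F j.
    rewrite (bigID (mem s))/= -[X in X + _]big_filter -[X in _ + X]big_filter.
    by congr (_ + _); rewrite (perm_big _ pst).
  rewrite /Y split_t addrAC subrr add0r rnorm_comb ?filter_uniq//.
  have := sup_upper_bound S0 => /(_ (\sum_(j <- t) rnorm (c j) ^+ 2)) h.
  have {h} : \sum_(j <- t) rnorm (c j) ^+ 2 <= sup S by apply: h; exists t.
  rewrite split_t; move: hs; set a := \sum_(j <- s) _; set b := \sum_(j <- _) _; lra.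
have [s hs] : exists s : nat -> seq I, forall n, uniq (s n) /\
    sup S - n.+1%:R^-1 ^+ 2 < \sum_(j <- s n) rnorm (c j) ^+ 2.
  suff : forall n : nat, exists s : seq I, uniq s /\
    sup S - n.+1%:R^-1 ^+ 2 < \sum_(j <- s) rnorm (c j) ^+ 2 by move=> /choice[s hs]; exists s.
  move=> n; have [|s us h] := near_sup (n.+1%:R^-1 ^+ 2).
    by rewrite exprn_gt0// invr_gt0 ltr0n.
  by exists s.
have tail1 n t : uniq t -> {subset s n <= t} -> rnorm (Y t - Y (s n)) <= n.+1%:R^-1.
  move=> ut st; rewrite -(@ler_pXn2r _ 2)// ?nnegrE ?rnorm_ge0 ?invr_ge0//.
  by case: (hs n) => us hn; exact: tail.
have cauchyY m n : rnorm (Y (s m) - Y (s n)) <= m.+1%:R^-1 + n.+1%:R^-1.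
  pose t := undup (s m ++ s n).
  have -> : Y (s m) - Y (s n) = (Y t - Y (s n)) - (Y t - Y (s m)).
    by rewrite opprB [RHS]addrC addrA subrK.
  apply: (le_trans (ler_rnormD _ _)); rewrite rnormN [leRHS]addrC.
  by apply: lerD; apply: tail1; rewrite /t ?undup_uniq// => j; rewrite mem_undup mem_cat => ->; rewrite ?orbT.
have [y hy] := fast_cauchy_cvg cauchyY.
have approx (d : R) : 0 < d -> exists2 n, n.+1%:R^-1 < d & rnorm (Y (s n) - y) < d.
  move=> d0; have /filter_ex[n hn] : \forall k \near \oo, k.+1%:R^-1 < d.
    exact: near_infty_natSinv_lt (PosNum d0).
  by exists n => //; exact: le_lt_trans (hy n) _.
exists y; split.
- move=> i; apply/eqP; rewrite -subr_eq0 -rnorm_eq0 eq_le rnorm_ge0 andbT.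
  apply/ler_addgt0Pr => d d0; rewrite add0r.
  have d2 : 0 < d / 2 by rewrite divr_gt0.
  have [n n1 n2] := approx _ d2; have [usn _] := hs n.
  (* The index i need not occur in any [s n]; adjoining it moves the partial sum by at most 1 / (n +
     1). *)
  pose t := undup (i :: s n).
  have -> : c i = inner (Y t) (e i).
    by rewrite inner_comb /t ?undup_uniq// mem_undup mem_head.
  rewrite -innerBl.
  have -> : y - Y t = - (Y (s n) - y) - (Y t - Y (s n)).
    by rewrite !opprB addrA subrK.
  apply: (le_trans (cauchy_schwarz _ _)).
  have -> : rnorm (e i) = 1.
    have := inner_rnorm (e i); rewrite oe eqxx => /esym/complexI h.
    by apply/eqP; rewrite -(@eqrXn2 _ 2) ?rnorm_ge0// h expr1n.
  rewrite mulr1; apply: (le_trans (ler_rnormD _ _)); rewrite !rnormN.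
  have h3 : rnorm (Y t - Y (s n)) <= n.+1%:R^-1.
    by apply: tail1; rewrite /t ?undup_uniq// => j js; rewrite mem_undup inE js orbT.
  by rewrite [leRHS](splitr d) lerD// ltW// (le_lt_trans h3).
- have M0 : 0 <= M by have := hM [::] isT; rewrite big_nil.
  have -> : M = Num.sqrt M ^+ 2 by rewrite sqr_sqrtr.
  rewrite ler_pXn2r ?nnegrE ?rnorm_ge0 ?sqrtr_ge0//.
  apply/ler_addgt0Pr => d d0; have [n n1 n2] := approx _ d0; have [usn _] := hs n.
  have -> : y = Y (s n) - (Y (s n) - y) by rewrite opprB addrC subrK.
  apply: (le_trans (ler_rnormD _ _)); rewrite rnormN; apply: lerD; last exact: ltW.
  rewrite -(@ler_pXn2r _ 2)// ?nnegrE ?rnorm_ge0 ?sqrtr_ge0//.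
  by rewrite sqr_sqrtr// rnorm_comb// hM.
- move=> d d0; have [n n1 n2] := approx _ d0; have [usn _] := hs n.
  by exists (s n) => //; rewrite rnormB.
Qed.

End Orthonormal.
End InnerProduct.

Section OrthonormalBasis.
Context {R : realType} {H : hilbert_space R}.

(** A maximal orthonormal set is total, since a nonzero vector orthogonal to it could be normalized
    and adjoined. *)
Lemma orthonormal_basis_exists :
  exists (I : choiceType) (e : I -> H), orthonormal_family e /\ total_family e.
Proof.
pose P (E : set H) := forall x y, E x -> E y -> inner x y = (x == y)%:R.
have [|E [PE maxE]] := @Zorn_bigcup H P.
  move=> F FP Ftot x y [X FX Xx] [Y FY Yy].
  by have [XY|YX] := Ftot _ _ FX FY; [apply: (FP _ FY) => //; exact: XY|
    apply: (FP _ FX) => //; exact: YX].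
exists (set_type E), val; split.
  move=> i j; rewrite PE; [|exact: set_mem (valP i)|exact: set_mem (valP j)].
  by congr ((nat_of_bool _)%:R); exact: (inj_eq val_inj).
move=> x hx; apply: contrapT => /eqP x0.
have xE y : E y -> inner x y = 0.
  by move=> Ey; have := hx (SigSub (mem_set Ey)).
pose x1 := ((rnorm x)^-1)%:C%C *: x.
have nx : rnorm x != 0 by rewrite rnorm_eq0.
have x1E y : E y -> inner x1 y = 0 by move=> Ey; rewrite innerZl xE// mulr0.
have x11 : inner x1 x1 = 1.
  rewrite inner_rnorm rnormZ rnormC ger0_norm ?invr_ge0 ?rnorm_ge0// mulVf//.
  by rewrite expr1n.
have nEx1 : ~ E x1.
  by move=> /x1E; rewrite x11 => /eqP; rewrite oner_eq0.
apply: (maxE (E `|` [set x1])).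
  split; first by move=> y; left.
  by move=> h; apply: nEx1; apply: h; right.
move=> y z [Ey|->] [Ez|->].
- exact: PE.
- rewrite inner_conj x1E// rmorph0; case: eqP => // yx1.
  by move: Ey; rewrite yx1.
- by rewrite x1E//; case: eqP => // yx1; move: Ez; rewrite -yx1.
- by rewrite x11 eqxx.
Qed.

Context (I : choiceType) (e : I -> H) (oe : orthonormal_family e) (te : total_family e).

Lemma coord_inj x y : (forall i, inner x (e i) = inner y (e i)) -> x = y.
Proof.
move=> h; apply/eqP; rewrite -subr_eq0; apply/eqP; apply: te => i.
by rewrite innerBl h subrr.
Qed.

Lemma fourier_approx x (d : R) : 0 < d ->
  exists2 s, uniq s & rnorm (x - \sum_(j <- s) inner x (e j) *: e j) < d.
Proof.
have [y [hy _ ya]] := riesz_fischer oe (bessel oe x).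
have xy : x = y by apply: coord_inj.
by move=> /ya[s us hs]; exists s => //; rewrite {1}xy.
Qed.

Lemma basis_infinite : infinite_dimensional H -> infinite_set [set: I].
Proof.
move=> infH /finite_seqP[s hs].
pose t := undup s.
have [x hx] := infH (size t) (fun k => e (tnth (in_tuple t) k)).
apply: (hx (fun k => inner x (e (tnth (in_tuple t) k)))).
have -> : \sum_(k < size t) inner x (e (tnth (in_tuple t) k)) *: e (tnth (in_tuple t) k)
    = \sum_(j <- t) inner x (e j) *: e j.
  by rewrite [RHS](big_tnth _ _ t).
apply: coord_inj => i; rewrite inner_comb ?undup_uniq//.
have : [set: I] i by [].
by rewrite hs /= mem_undup => ->.
Qed.

End OrthonormalBasis.

(** * Bounded operators and their adjoints *)

Section Adjoint.
Context {R : realType} {H : hilbert_space R}.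
Implicit Types T U : bounded_op H.

Lemma bo_ext T U : (forall x, T x = U x) -> T = U.
Proof.
case: T U => [f fl fb] [k kl kb] /= /funext fk; move: fl fb kl kb.
by rewrite fk => *; congr BoundedOp; exact: Prop_irrelevance.
Qed.

Lemma bo_D T x y : T (x + y) = T x + T y.
Proof. by rewrite -[x]scale1r bo_linear !scale1r. Qed.

Lemma bo_0 T : T 0 = 0.
Proof. by apply: (addIr (T 0)); rewrite -bo_D !add0r. Qed.

Lemma bo_Z T a x : T (a *: x) = a *: T x.
Proof. by rewrite -[a *: x]addr0 bo_linear bo_0 addr0. Qed.

Lemma bo_B T x y : T (x - y) = T x - T y.
Proof. by rewrite -scaleN1r bo_D bo_Z scaleN1r. Qed.

Lemma bo_sum T (J : Type) (r : seq J) (F : J -> H) :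
  T (\sum_(i <- r) F i) = \sum_(i <- r) T (F i).
Proof. by apply: (big_morph T _ (bo_0 T)) => x y; exact: bo_D. Qed.

Lemma bo_rnorm_bound T : exists2 M : R, 0 <= M & forall x, rnorm (T x) <= M * rnorm x.
Proof.
have [M M0 hM] := bo_bound_ge0 T.
have MR : M = (complex.Re M)%:C%C.
  by case: M M0 {hM} => a b; rewrite lecE/= => /andP[/eqP -> _].
exists (complex.Re M); first by rewrite -lecR -MR.
by move=> x; rewrite -lecR rmorphM/= -MR -!rnormE.
Qed.

Lemma bounded_opP (f : H -> H) (M : R) : linear f ->
  (forall x, rnorm (f x) <= M * rnorm x) -> exists T : bounded_op H, forall x, T x = f x.
Proof.
move=> fl fM.
have fb : exists M : R[i], forall x, `|f x| <= M * `|x|.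
  by exists M%:C%C => x; rewrite !rnormE -rmorphM/= lecR.
by exists (BoundedOp fl fb).
Qed.

Lemma inner_nondegenerate (x y : H) : (forall z, inner z x = inner z y) -> x = y.
Proof.
move=> h; apply/eqP; rewrite -subr_eq0 -rnorm_eq0 -sqrf_eq0.
by rewrite -(inj_eq (@complexI R)) -inner_rnorm innerBr h subrr.
Qed.

(** The coordinates of the adjoint are forced: <U y, e_i> = <y, T e_i>. A finite square sum q of
    them equals <y, T z>, where z has these coordinates and |z|^2 = q, so q <= M |y| |z| bounds q
    uniformly. The adjoint relation then holds for finite combinations of basis vectors in the first
    argument, and extends by density. *)
Lemma adjoint_exists T : exists U, is_adjoint T U.
Proof.
have [I [e [oe te]]] := @orthonormal_basis_exists R H.
have [M M0 hM] := bo_rnorm_bound T.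
have bound y s : uniq s -> \sum_(j <- s) rnorm (inner y (T (e j))) ^+ 2 <= (M * rnorm y) ^+ 2.
  move=> us; set q := (X in X <= _).
  have q0 : 0 <= q by apply: sumr_ge0 => j _; exact: sqr_ge0.
  pose z := \sum_(j <- s) inner y (T (e j)) *: e j.
  have zq : rnorm z ^+ 2 = q by rewrite rnorm_comb.
  have yz : inner y (T z) = q%:C%C.
    rewrite bo_sum inner_sumr rmorph_sum/=; apply: eq_bigr => j _.
    by rewrite bo_Z innerZr mulrC -rnorm_sqr_mulJ.
  have := cauchy_schwarz y (T z); rewrite yz rnormC ger0_norm//.
  have := hM z; have := rnorm_ge0 y; have := rnorm_ge0 z; rewrite -zq.
  move: (rnorm z) (rnorm y) (rnorm (T z)) => a b c a0 b0 h1 h2.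
  have [->|a1] := eqVneq a 0; first by rewrite expr0n sqr_ge0.
  have {}a1 : 0 < a by rewrite lt_def a1.
  have : a ^+ 2 <= b * (M * a) by apply: (le_trans h2); rewrite ler_wpM2l.
  rewrite expr2 mulrA ler_pM2r// => h3.
  by rewrite -expr2 ler_pXn2r// ?nnegrE ?mulr_ge0// mulrC.
have ex y : exists u, forall i, inner u (e i) = inner y (T (e i)) /\ rnorm u ^+ 2 <= (M * rnorm y) ^+ 2.
  by have [u [hu hn _]] := riesz_fischer oe (bound y); exists u.
have [U hU] := choice ex.
have Ul : linear U.
  move=> a x y; apply: (coord_inj te) => i.
  by rewrite innerDl innerZl !(hU _ _).1 innerDl innerZl.
have UM y : rnorm (U y) <= M * rnorm y.
  (* [hU] yields the norm bound only in the presence of an index; with no index, totality makes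
     every vector 0. *)
  have [[i _]|I0] := pselect (exists i : I, True).
    rewrite -(@ler_pXn2r _ 2)// ?nnegrE ?rnorm_ge0 ?mulr_ge0 ?rnorm_ge0//.
    by case: (hU y i).
  rewrite (_ : U y = 0) ?rnorm0 ?mulr_ge0 ?rnorm_ge0//.
  by apply: te => i; case: I0; exists i.
have [V hV] := bounded_opP Ul UM.
exists V => x y; rewrite hV.
apply/eqP; rewrite -subr_eq0 -rnorm_eq0 eq_le rnorm_ge0 andbT.
apply/ler_addgt0Pr => d d0; rewrite add0r.
pose K := 2 * M * rnorm y + 1.
have K0 : 0 < K by rewrite ltr_wpDl// !mulr_ge0// rnorm_ge0.
have [s us hs] := fourier_approx oe te x (divr_gt0 d0 K0).
set xs := \sum_(j <- s) _ in hs.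
have -> : inner (T x) y - inner x (U y) = inner (T (x - xs)) y - inner (x - xs) (U y).
  suff e1 : inner (T xs) y = inner xs (U y) by rewrite bo_B !innerBl e1 opprB addrA subrK.
  rewrite bo_sum !inner_suml; apply: eq_bigr => j _.
  by rewrite bo_Z !innerZl [inner (e j) _]inner_conj (hU _ _).1 -inner_conj.
apply: (le_trans (ler_rnormD _ _)); rewrite rnormN.
have h1 : rnorm (inner (T (x - xs)) y) <= M * rnorm (x - xs) * rnorm y.
  by apply: (le_trans (cauchy_schwarz _ _)); rewrite ler_wpM2r ?rnorm_ge0.
have h2 : rnorm (inner (x - xs) (U y)) <= rnorm (x - xs) * (M * rnorm y).
  by apply: (le_trans (cauchy_schwarz _ _)); rewrite ler_wpM2l ?rnorm_ge0.
apply: (le_trans (lerD h1 h2)).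
have -> : M * rnorm (x - xs) * rnorm y + rnorm (x - xs) * (M * rnorm y) =
   rnorm (x - xs) * (2 * M * rnorm y) by ring.
move: hs; rewrite ltr_pdivlMr// => /ltW; apply: le_trans.
by rewrite ler_wpM2l ?rnorm_ge0// /K lerDl.
Qed.

Lemma bo_adjP T : is_adjoint T (bo_adj T).
Proof.
rewrite /bo_adj; case: pselect => [h|[]]; last exact: adjoint_exists.
exact: projT2 (cid h).
Qed.

Lemma bo_adj_unique T U : is_adjoint T U -> bo_adj T = U.
Proof.
move=> h; apply: bo_ext => y; apply: inner_nondegenerate => z.
by rewrite -h bo_adjP.
Qed.

Lemma bo_adj_add T U : bo_adj (bo_add T U) = bo_add (bo_adj T) (bo_adj U).
Proof. by apply: bo_adj_unique => x y /=; rewrite innerDl innerDr !bo_adjP. Qed.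

Lemma bo_adj_scale a T : bo_adj (bo_scale a T) = bo_scale (a^*)%C (bo_adj T).
Proof. by apply: bo_adj_unique => x y /=; rewrite innerZl innerZr conjcK bo_adjP. Qed.

End Adjoint.

(** * Cuntz families of isometries *)

Definition nat_pair (m n : nat) : nat := pickle (m, n).

Lemma nat_pair_inj m n m' n' : nat_pair m n = nat_pair m' n' -> m = m' /\ n = n'.
Proof. by move=> /(pcan_inj pickleK)[-> ->]. Qed.

(* [I] is the disjoint union of a maximal disjoint family of countably infinite
   subsets and a finite set, and the latter can be absorbed by a member of the
   family; hence [I] is in bijection with a product with [nat]. *)
Lemma nat_times_inj (I : choiceType) : infinite_set [set: I] ->
  exists b : nat -> I -> I, forall m n i j, b m i = b n j -> m = n /\ i = j.
Proof.
move=> infI.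
pose F (f : nat -> I) := range f.
have [M [MD Mtriv Mmax]] :=
  ex_maximal_disjoint_subcollection F [set f : nat -> I | injective f].
pose U := \bigcup_(f in M) range f.
(* An infinite complement would contain the range of one more injective sequence, against
   maximality. *)
have finC : finite_set (~` U).
  apply: contrapT => /infiniteP/card_leP[k].
  pose f n : I := val (k (SigSub (mem_set (Logic.I : [set: nat] n)))).
  have finj : injective f.
    move=> m n /val_inj/(inj (f := k)); rewrite !in_setT => /(_ isT isT).
    by move=> /(congr1 val).
  have fU' n : ~ U (f n) by exact: set_mem (valP (k _)).
  have Mf : ~ M f by move=> Mf; apply: (fU' 0%N); exists f => //; exists 0%N.
  apply: (Mmax (M `|` [set f])).
  - split; first by move=> g; left.
    by move=> h; apply: Mf; apply: h; right.
  - by move=> g [/MD//|->].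
  - move=> g h [Mg|->] [Mh|->] // [x [[m _ mx] [n _ nx]]].
    + by apply: (Mtriv g h) => //; exists x; split; [exists m|exists n].
    + by exfalso; apply: (fU' n); rewrite nx; exists g => //; exists m.
    + by exfalso; apply: (fU' m); rewrite mx; exists h => //; exists n.
have [f0 Mf0] : exists f, M f.
  apply: contrapT => M0; apply: infI; suff -> : [set: I] = ~` U by [].
  by apply/seteqP; split => // i _ [f Mf]; case: M0; exists f.
have /finite_seqP[c0 hc0] := finC.
pose c := undup c0; have uc : uniq c by exact: undup_uniq.
have hc i : (i \in c) <-> ~ U i by rewrite mem_undup -[~ U i]/((~` U) i) hc0.
pose q := size c.
(* The member [f0] absorbs the leftover points: its new enumeration lists these q points first and
   then follows [f0] shifted by q. *)
pose dec (f : nat -> I) n :=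
  if `[< f = f0 >] then if (n < q)%N then nth (f0 0%N) c n else f0 (n - q)%N else f n.
have inU f n : M f -> U (f n) by move=> Mf; exists f => //; exists n.
have ncU n : (n < q)%N -> ~ U (nth (f0 0%N) c n).
  by move=> nq; apply/hc; exact: mem_nth.
have same f g m n : M f -> M g -> f m = g n -> f = g /\ m = n.
  move=> Mf Mg fg; have fg' : f = g.
    by apply: (Mtriv f g) => //; exists (f m); split; [exists m|exists n].
  by split => //; move: fg; rewrite -fg' => /(MD _ Mf).
have dec_inj f g m n : M f -> M g -> dec f m = dec g n -> f = g /\ m = n.
  move=> Mf Mg; rewrite /dec; case: asboolP => [->|ff]; case: asboolP => [->|gg].
  - case: ltnP => mq; case: ltnP => nq.
    + by move=> /eqP; rewrite nth_uniq// => /eqP.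
    + by move=> e; case: (ncU _ mq); rewrite e; exact: inU.
    + by move=> e; case: (ncU _ nq); rewrite -e; exact: inU.
    + move=> /(same _ _ _ _ Mf0 Mf0)[_ e]; split => //.
      by rewrite -(subnK mq) -(subnK nq) e.
  - case: ltnP => mq; last by move=> /(same _ _ _ _ Mf0 Mg)[/esym].
    by move=> e; case: (ncU _ mq); rewrite e; exact: inU.
  - case: ltnP => nq; last by move=> /(same _ _ _ _ Mf Mf0)[].
    by move=> e; case: (ncU _ nq); rewrite -e; exact: inU.
  - exact: same.
have dec_surj i : exists fn : (nat -> I) * nat, M fn.1 /\ dec fn.1 fn.2 = i.
  have [[f Mf [n _ <-]]|nU] := pselect (U i).
    have [->|ff] := pselect (f = f0).
      exists (f0, (q + n)%N); split => //=; rewrite /dec asboolT//.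
      by rewrite ltnNge leq_addr/= addKn.
    by exists (f, n); split => //=; rewrite /dec asboolF.
  have ic : i \in c by apply/hc.
  exists (f0, index i c); split => //=; rewrite /dec asboolT//.
  by rewrite index_mem ic nth_index.
have [code hcode] := choice dec_surj.
(* If i is entry n of the sequence f, then its copy number m is entry [nat_pair m n] of the same
   sequence. *)
exists (fun m i => dec (code i).1 (nat_pair m (code i).2)) => m n i j.
move=> /dec_inj[||e /nat_pair_inj[-> e']].
- by case: (hcode i).
- by case: (hcode j).
split => //; have [_ <-] := hcode i; have [_ <-] := hcode j.
by rewrite e e'.
Qed.

Lemma ler_sum_supp (R : numDomainType) (I : eqType) (s L : seq I) (P : pred I)
    (F : I -> R) : uniq s -> uniq L -> (forall i, 0 <= F i) ->
  (forall i, P i -> F i != 0 -> i \in L) ->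
  \sum_(i <- s | P i) F i <= \sum_(i <- L) F i.
Proof.
move=> us uL F0 PL.
have -> : \sum_(i <- s | P i) F i = \sum_(i <- [seq i <- s | P i && (F i != 0)]) F i.
  rewrite big_filter [LHS]big_mkcond [RHS]big_mkcond; apply: eq_bigr => i _.
  by case: (P i); case: eqP.
apply: ler_sum_uniq_sub; rewrite ?filter_uniq// => i.
by rewrite mem_filter => /andP[/andP[Pi Fi] _]; exact: PL.
Qed.

Section WeightedComposition.
Context {R : realType} {H : hilbert_space R} (I : choiceType) (e : I -> H).
Hypotheses (oe : orthonormal_family e) (te : total_family e).

(** The common form of the isometries and of the operator [T] in [orthogonal_isometries]. Grouping
    indices by their value under [f] reduces boundedness to the square sums of the weights over the
    fibres of [f]. *)
Lemma weighted_composition (c : I -> R[i]) (f : I -> I) (M : R) :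
  (forall s j, uniq s -> \sum_(i <- s | f i == j) rnorm (c i) ^+ 2 <= M) ->
  exists T : bounded_op H, forall x i, inner (T x) (e i) = c i * inner x (e (f i)).
Proof.
move=> hM.
have bound x s : uniq s ->
    \sum_(i <- s) rnorm (c i * inner x (e (f i))) ^+ 2 <= M * rnorm x ^+ 2.
  move=> us; pose t := undup (map f s).
  under eq_bigr do rewrite rnormM exprMn.
  have -> : \sum_(i <- s) rnorm (c i) ^+ 2 * rnorm (inner x (e (f i))) ^+ 2 =
      \sum_(j <- t) \sum_(i <- s | f i == j) rnorm (c i) ^+ 2 * rnorm (inner x (e j)) ^+ 2.
    rewrite (exchange_big_dep xpredT)//= big_seq [RHS]big_seq; apply: eq_bigr => i si.
    rewrite -big_filter (_ : [seq j <- t | f i == j] = [:: f i]) ?big_seq1//.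
    have ft : f i \in t by rewrite mem_undup map_f.
    apply/perm_small_eq => //; apply: uniq_perm; rewrite ?filter_uniq ?undup_uniq// => j.
    by rewrite mem_filter inE eq_sym; case: eqP => // ->.
  apply: (@le_trans _ _ (\sum_(j <- t) M * rnorm (inner x (e j)) ^+ 2)).
    by apply: ler_sum => j _; rewrite -mulr_suml ler_wpM2r ?sqr_ge0// hM.
  (* A negative M can only occur when there are no indices, because the empty list gives 0 <= M for
     any j. *)
  have [M0|M0] := leP 0 M.
    by rewrite -mulr_sumr ler_wpM2l// bessel ?undup_uniq.
  have := hM [::]; case: t => [|j t] hM'.
    rewrite big_nil; have [[i _]|I0] := pselect (exists i : I, True).
      by have := hM' i isT; rewrite big_nil => /(lt_le_trans M0); rewrite ltxx.
    rewrite (_ : x = 0) ?rnorm0 ?expr0n ?mulr0//.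
    by apply: te => i; case: I0; exists i.
  by have := hM' j isT; rewrite big_nil => /(lt_le_trans M0); rewrite ltxx.
have ex x : exists y, forall i, inner y (e i) = c i * inner x (e (f i)) /\
    rnorm y ^+ 2 <= M * rnorm x ^+ 2.
  by have [y [hy yM _]] := riesz_fischer oe (bound x); exists y.
have [T hT] := choice ex.
have Tl : linear T.
  move=> a x y; apply: (coord_inj te) => i.
  by rewrite innerDl innerZl !(hT _ _).1 innerDl innerZl mulrDr mulrCA.
have [[i0 _]|I0] := pselect (exists i : I, True); last first.
  have TM x : rnorm (T x) <= 0 * rnorm x.
    rewrite mul0r (_ : T x = 0) ?rnorm0//.
    by apply: te => i; case: I0; exists i.
  by have [U hU] := bounded_opP Tl TM; exists U => x i; rewrite hU (hT x i).1.
have M0 : 0 <= M by have := hM [::] i0 isT; rewrite big_nil.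
have TM x : rnorm (T x) <= Num.sqrt M * rnorm x.
  rewrite -(@ler_pXn2r _ 2)// ?nnegrE ?rnorm_ge0 ?mulr_ge0 ?sqrtr_ge0 ?rnorm_ge0//.
  by rewrite exprMn sqr_sqrtr//; case: (hT x i0).
by have [U hU] := bounded_opP Tl TM; exists U => x i; rewrite hU (hT x i).1.
Qed.

End WeightedComposition.

Section CuntzFamily.
Context {R : realType} {H : hilbert_space R}.

Lemma bo_id_linear : linear (id : H -> H).
Proof. by []. Qed.

Lemma bo_id_bounded : exists M : R[i], forall x : H, `|x| <= M * `|x|.
Proof. by exists 1 => x; rewrite mul1r. Qed.

Definition bo_id : bounded_op H := BoundedOp bo_id_linear bo_id_bounded.

Definition bo_zero : bounded_op H := bo_scale 0 bo_id.

Lemma bo_zeroE x : bo_zero x = 0. Proof. exact: scale0r. Qed.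

(** With an injection b from nat * I to I, [S m] maps e_j to e_(b m j). The coordinate of [T x] at b
    (k, jj) j is the coefficient of S_(k, jj) times the coordinate of x at b k j. Over b k j there
    are n_k indices of squared weight 1 / n_k each, so the square sums over the fibres are bounded
    by 1 for every choice of n and s. *)
Lemma orthogonal_isometries : infinite_dimensional H ->
  exists S : nat -> bounded_op H,
    (forall l m, bo_comp (bo_adj (S l)) (S m) = if l == m then bo_id else bo_zero) /\
    forall (n : nat -> nat) (s : nat -> nat -> bool), (forall k, (0 < n k)%N) ->
      exists T : bounded_op H, forall k x, T (S k x) =
        \sum_(j < n k) (((Num.sqrt (n k)%:R)^-1)%:C%C * (-1) ^+ s k j) *:
          S (nat_pair k j) x.
Proof.
move=> infH.
have [I [e [oe te]]] := @orthonormal_basis_exists R H.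
have [b b_inj] := nat_times_inj (basis_infinite oe te infH).
pose nat_of i := xget (0%N, i) [set mj : nat * I | b mj.1 mj.2 = i].
have bK m j : nat_of (b m j) = (m, j).
  rewrite /nat_of; case: xgetP => [[m' j'] _ /= /b_inj[-> ->]//|/(_ (m, j))[]//].
have b_ext (P : I -> Prop) : (forall m j, P (b m j)) ->
    (forall i, (forall m j, i <> b m j) -> P i) -> forall i, P i.
  move=> h1 h2 i; have [[[m j] /= <-]|h] := pselect (exists mj, b mj.1 mj.2 = i).
    exact: h1.
  by apply: h2 => m j ij; apply: h; exists (m, j).
(* [nat_of] has a default value outside the range of b, where this test fails because i is not in
   that range. *)
pose valid i := b (nat_of i).1 (nat_of i).2 == i.
have valid_b m j : valid (b m j) by rewrite /valid bK eqxx.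
have S_ex m : exists T : bounded_op H, forall x,
    (forall l j, inner (T x) (e (b l j)) = (l == m)%:R * inner x (e j)) /\
    (forall i, (forall l j, i <> b l j) -> inner (T x) (e i) = 0).
  pose c i : R[i] := if valid i && ((nat_of i).1 == m) then 1 else 0.
  have [|T hT] := @weighted_composition _ _ _ e oe te c (fun i => (nat_of i).2) 1.
    move=> s j us; apply: (@le_trans _ _ (\sum_(i <- [:: b m j]) rnorm (c i) ^+ 2)).
      apply: ler_sum_supp => // [i|i /eqP fi]; first exact: sqr_ge0.
      rewrite expf_eq0/= rnorm_eq0 /c; case: ifP; last by rewrite eqxx.
      by move=> /andP[/eqP <- /eqP <-] _; rewrite fi bK inE.
    by rewrite big_seq1 /c valid_b bK eqxx /= (rnormC 1) normr1 expr1n.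
  exists T => x; split.
    by move=> l j; rewrite hT /c valid_b bK/=; case: eqP.
  move=> i hi; rewrite hT /c; case: ifP; last by rewrite mul0r.
  by move=> /andP[/eqP/esym/hi].
have [S hS] := choice S_ex; exists S; split.
  (* That is, [S m] maps e_j to e_(b m j); [b_ext] checks the coordinates in the range of b and
     outside it separately. *)
  have adjS m x j : inner (bo_adj (S m) x) (e j) = inner x (e (b m j)).
    rewrite inner_conj -bo_adjP -inner_conj; congr inner.
    apply: (coord_inj te); apply: b_ext => [l j'|i hi].
      rewrite (hS _ _).1 !oe; case: eqP => [->|lm]; rewrite ?mul1r ?mul0r.
        congr ((nat_of_bool _)%:R); apply/eqP/eqP => [->//|]; by move=> /b_inj[].
      by case: eqP => // /b_inj[/esym].
    rewrite (hS _ _).2// oe; case: eqP => // h.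
    by case: (hi _ _ (esym h)).
  move=> l m; apply: bo_ext => x; apply: (coord_inj te) => j /=.
  rewrite adjS (hS _ _).1; case: eqP => _; first by rewrite mul1r.
  by rewrite mul0r bo_zeroE inner0l.
move=> n s n0.
pose unpair l : nat * nat := odflt (0, 0)%N (unpickle l).
have unpairK k jj : unpair (nat_pair k jj) = (k, jj) by rewrite /unpair pickleK.
pose coef k jj : R[i] := ((Num.sqrt (n k)%:R)^-1)%:C%C * (-1) ^+ s k jj.
have coefE k jj : rnorm (coef k jj) ^+ 2 = (n k)%:R^-1.
  rewrite rnormM rnormC /rnorm normr_sign/= mulr1.
  by rewrite ger0_norm ?invr_ge0 ?sqrtr_ge0// exprVn sqr_sqrtr.
pose kk i := unpair (nat_of i).1.
(* The middle test says that the first component of [nat_of i] is the code of a pair, which [unpair]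
   alone cannot tell because of its default value. *)
pose c i : R[i] := if [&& valid i, nat_pair (kk i).1 (kk i).2 == (nat_of i).1 &
  ((kk i).2 < n (kk i).1)%N] then coef (kk i).1 (kk i).2 else 0.
have c_b k jj j : c (b (nat_pair k jj) j) = if (jj < n k)%N then coef k jj else 0.
  by rewrite /c valid_b /kk bK/= unpairK/= eqxx.
have [|T hT] := @weighted_composition _ _ _ e oe te c
    (fun i => b (kk i).1 (nat_of i).2) 1.
  move=> q j' uq; pose k := (nat_of j').1; pose j := (nat_of j').2.
  pose L := [seq b (nat_pair k jj) j | jj <- iota 0 (n k)].
  apply: (@le_trans _ _ (\sum_(i <- L) rnorm (c i) ^+ 2)).
    apply: ler_sum_supp => //.
    - rewrite map_inj_uniq ?iota_uniq// => jj jj' /b_inj[].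
      by move=> /nat_pair_inj[].
    - by move=> i; exact: sqr_ge0.
    - move=> i /eqP fi; rewrite expf_eq0/= rnorm_eq0 /c; case: ifP; last by rewrite eqxx.
      move=> /and3P[/eqP vi /eqP pi ni] _.
      apply/mapP; exists (kk i).2; rewrite /k /j -fi bK/= ?mem_iota//.
      by rewrite pi vi.
  rewrite big_map (eq_big_seq (fun=> (n k)%:R^-1)); last first.
    by move=> jj; rewrite mem_iota/= add0n => jn; rewrite c_b jn coefE.
  rewrite big_const_seq count_predT size_iota iter_addr_0.
  by rewrite -[X in X <= _]mulr_natr mulVf// gt_eqF// ltr0n.
exists T => k x; apply: (coord_inj te); apply: b_ext => [l j|i hi]; last first.
  rewrite hT /c ifF ?mul0r; last by apply/negP => /and3P[/eqP/esym/hi].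
  rewrite inner_suml big1// => jj _; rewrite innerZl (hS _ _).2 ?mulr0//.
have [[[k' jj] /= ->]|nl] := pselect (exists kj : nat * nat, l = nat_pair kj.1 kj.2);
    last first.
  rewrite hT /c ifF ?mul0r; last first.
    apply/negP => /and3P[_ /eqP h _]; apply: nl; exists (kk (b l j)).
    by rewrite h bK.
  rewrite inner_suml big1// => jj _; rewrite innerZl (hS _ _).1.
  by case: eqP => [h|]; [case: nl; exists (k, nat_of_ord jj)|rewrite mul0r mulr0].
rewrite hT c_b /kk bK/= unpairK/= (hS _ _).1 inner_suml.
under eq_bigr do rewrite innerZl (hS _ _).1 -/(coef _ _).
have [<-|kk'] := eqVneq k' k; last first.
  rewrite mul0r mulr0 big1// => i _; case: eqP => [/nat_pair_inj[h]|].
    by rewrite h eqxx in kk'.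
  by rewrite mul0r mulr0.
rewrite mul1r; case: ifPn => jn.
  rewrite (bigD1 (Ordinal jn))//= eqxx mul1r big1 ?addr0// => i ij.
  case: eqP => [/nat_pair_inj[_ h]|]; last by rewrite mul0r mulr0.
  by move: ij; rewrite -val_eqE/= -h eqxx.
rewrite mul0r big1// => i _; case: eqP => [/nat_pair_inj[_ h]|].
  by rewrite h ltn_ord in jn.
by rewrite mul0r mulr0.
Qed.

End CuntzFamily.

(** * Ideals and quotients of B(H) *)

Section Ideals.
Context {R : realType} {H : hilbert_space R}.
Implicit Types T U : bounded_op H.

Lemma op_norm_le T (M : R) : 0 <= M -> (forall x, rnorm (T x) <= M * rnorm x) ->
  op_norm T <= M.
Proof.
move=> M0 hM; apply: ge_sup.
  by exists (rnorm (T 0)); exists 0 => //=; rewrite rnorm0.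
move=> _ [x /= x1 <-]; apply: (le_trans (hM x)).
by rewrite -[leRHS]mulr1 ler_wpM2l.
Qed.

Lemma rnorm_le_op_norm T x : rnorm (T x) <= op_norm T * rnorm x.
Proof.
have [M M0 hM] := bo_rnorm_bound T.
have [->|x0] := eqVneq x 0; first by rewrite bo_0 rnorm0 mulr0.
have nx : 0 < rnorm x by rewrite lt_def rnorm_eq0 x0 rnorm_ge0.
rewrite -ler_pdivrMr// mulrC -{1}[(rnorm x)^-1]ger0_norm ?invr_ge0 ?(ltW nx)//.
rewrite -rnormC -rnormZ -bo_Z.
have ubT : has_ubound [set rnorm (T y) | y in [set y : H | rnorm y <= 1]].
  exists M => _ [y /= y1 <-]; apply: (le_trans (hM y)).
  by rewrite -[leRHS]mulr1 ler_wpM2l.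
have := ub_le_sup ubT; apply.
exists (((rnorm x)^-1)%:C%C *: x) => //=.
by rewrite rnormZ rnormC ger0_norm ?invr_ge0 ?(ltW nx)// mulVf ?gt_eqF.
Qed.

Lemma op_norm_ge0 T : 0 <= op_norm T.
Proof.
have [M M0 hM] := bo_rnorm_bound T.
have ubT : has_ubound [set rnorm (T y) | y in [set y : H | rnorm y <= 1]].
  exists M => _ [y /= y1 <-]; apply: (le_trans (hM y)).
  by rewrite -[leRHS]mulr1 ler_wpM2l.
have := ub_le_sup ubT; apply.
by exists 0; rewrite /= ?bo_0 rnorm0.
Qed.

Lemma bo_adj_bound T (M : R) : (forall x, rnorm (T x) <= M * rnorm x) ->
  forall x, rnorm (bo_adj T x) <= M * rnorm x.
Proof.
move=> hM x; set y := bo_adj T x.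
have : rnorm y ^+ 2 <= M * rnorm y * rnorm x.
  have -> : rnorm y ^+ 2 = rnorm (inner (T y) x).
    by rewrite bo_adjP -/y inner_rnorm rnormC ger0_norm// sqr_ge0.
  by apply: (le_trans (cauchy_schwarz _ _)); rewrite ler_wpM2r ?rnorm_ge0.
have [->|y0] := eqVneq y 0; first by rewrite rnorm0 => _;
  apply: le_trans (hM x); exact: rnorm_ge0.
have ny : 0 < rnorm y by rewrite lt_def rnorm_eq0 y0 rnorm_ge0.
by rewrite mulrAC expr2 ler_pM2r.
Qed.

(* The operators [T^* (1 - T T^* / M^2)^m] tend to 0 and differ from [T^*] by
   elements of the ideal generated by [T]. *)
Lemma ideal_adj (J : set (bounded_op H)) T : norm_closed_ideal J -> J T -> J (bo_adj T).
Proof.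
move=> [_ JD JZ JM Jcl] JT.
have [M M0 hM] : exists2 M : R, 0 < M & forall x, rnorm (T x) <= M * rnorm x.
  have [M M0 hM] := bo_rnorm_bound T; exists (M + 1); first by rewrite ltr_wpDl.
  by move=> x; rewrite (le_trans (hM x))// ler_wpM2r ?rnorm_ge0// lerDl.
have hM' := bo_adj_bound hM; set T' := bo_adj T in hM' *.
pose r : R := M ^- 2; have r0 : 0 < r by rewrite invr_gt0 exprn_gt0.
have rM : r * M ^+ 2 = 1 by rewrite mulVf// gt_eqF// exprn_gt0.
pose B := bo_scale r%:C%C (bo_comp T T').
pose C := bo_sub bo_id B.
have CE x : C x = x - r%:C%C *: T (T' x) by rewrite /= scaleN1r.
have sqrB (x y : H) : rnorm (x - y) ^+ 2 =
    rnorm x ^+ 2 + rnorm y ^+ 2 - 2 * complex.Re (inner x y).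
  by rewrite rnorm_sqrD rnormN innerNr -mulrN; case: (inner x y).
(* Expanding the square gives |x|^2 - 2 r |T' x|^2 + r^2 |T T' x|^2, and r^2 M^2 = r. *)
have contr1 x : rnorm (C x) ^+ 2 <= rnorm x ^+ 2 - r * rnorm (T' x) ^+ 2.
  rewrite CE sqrB innerZr conjcR inner_conj bo_adjP -/T' inner_rnorm conjcR -rmorphM/=.
  rewrite rnormZ rnormC ger0_norm ?(ltW r0)// exprMn.
  have : rnorm (T (T' x)) ^+ 2 <= M ^+ 2 * rnorm (T' x) ^+ 2.
    by rewrite -exprMn ler_pXn2r ?nnegrE ?mulr_ge0 ?rnorm_ge0 ?(ltW M0) ?hM ?hM'.
  move=> /(ler_wpM2l (sqr_ge0 r)).
  have -> : r ^+ 2 * (M ^+ 2 * rnorm (T' x) ^+ 2) = (r * M ^+ 2) * (r * rnorm (T' x) ^+ 2).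
    by ring.
  rewrite rM mul1r; lra.
(* With w = T' x, the vector T' (C x) is w - r T' T w, and the computation of [contr1] applies with
   the roles of T and T' exchanged. *)
have contr2 x : rnorm (T' (C x)) <= rnorm (T' x).
  rewrite -(@ler_pXn2r _ 2)// ?nnegrE ?rnorm_ge0//.
  rewrite CE bo_B bo_Z; set w := T' x.
  rewrite sqrB innerZr conjcR.
  rewrite (_ : inner w (T' (T w)) = (rnorm (T w) ^+ 2)%:C%C) -?rmorphM/=; last first.
    by rewrite -bo_adjP inner_rnorm.
  rewrite rnormZ rnormC ger0_norm ?(ltW r0)// exprMn.
  have : rnorm (T' (T w)) ^+ 2 <= M ^+ 2 * rnorm (T w) ^+ 2.
    by rewrite -exprMn ler_pXn2r ?nnegrE ?mulr_ge0 ?rnorm_ge0 ?(ltW M0) ?hM ?hM'.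
  move=> /(ler_wpM2l (sqr_ge0 r)).
  have -> : r ^+ 2 * (M ^+ 2 * rnorm (T w) ^+ 2) = (r * M ^+ 2) * (r * rnorm (T w) ^+ 2).
    by ring.
  rewrite rM mul1r.
  have : 0 <= r * rnorm (T w) ^+ 2 by rewrite mulr_ge0 ?sqr_ge0 ?(ltW r0).
  lra.
pose X m := iter m (fun V => bo_comp V C) T'.
have XE m x : X m x = T' (iter m C x).
  by elim: m x => //= m IH x; rewrite IH -iterSr.
(* Each step subtracts r X_m T T' from X_m, and this lies in [J] because T does. *)
have JX m : exists2 U, J U & X m = bo_sub T' U.
  elim: m => [|m [U JU XU]].
    exists (bo_scale 0 T); first exact: JZ.
    by apply: bo_ext => x /=; rewrite scale0r scaler0 addr0.
  exists (bo_add U (bo_scale r%:C%C (bo_comp (X m) (bo_comp T T')))).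
    apply: JD => //; apply: JZ; apply: (JM _ _ _).1.
    exact: (JM _ _ JT).2.
  apply: bo_ext => x.
  change (X m (C x) = T' x + -1 *: (U x + r%:C%C *: X m (T (T' x)))).
  by rewrite CE bo_B bo_Z {1}XU /= !scaleN1r opprD addrA.
(* By [contr1] the squared norm of the iterates of [C] drops at step i by at least r |T' C^i x|^2.
   These drops decrease with i by [contr2], so m times the last bounds their sum; this forces |X_m|
   <= M / sqrt m. *)
have decay m x : m%:R * (r * rnorm (T' (iter m C x)) ^+ 2) <=
    rnorm x ^+ 2 - rnorm (iter m C x) ^+ 2.
  elim: m => [|m IH]; first by rewrite mul0r subrr.
  have h1 := contr1 (iter m C x).
  have h2 : r * rnorm (T' (iter m.+1 C x)) ^+ 2 <= r * rnorm (T' (iter m C x)) ^+ 2.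
    rewrite ler_pM2l// ler_pXn2r ?nnegrE ?rnorm_ge0//; exact: contr2.
  have h3 : m%:R * (r * rnorm (T' (iter m.+1 C x)) ^+ 2) <=
            m%:R * (r * rnorm (T' (iter m C x)) ^+ 2) by rewrite ler_wpM2l.
  rewrite -natr1 mulrDl mul1r; rewrite -iterS in h1 *; lra.
apply: Jcl => d d0.
have [m hm] : exists m : nat, M ^+ 2 / (d / 2) ^+ 2 < m%:R.
  exists (Num.bound (M ^+ 2 / (d / 2) ^+ 2)); apply: archi_boundP.
  by rewrite divr_ge0 ?sqr_ge0.
have d2 : 0 < d / 2 by rewrite divr_gt0.
have [U JU XU] := JX m; exists U => //; rewrite -XU.
apply: (@le_lt_trans _ _ (d / 2)); last by lra.
apply: op_norm_le => [|x]; first exact: ltW.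
rewrite -(@ler_pXn2r _ 2)// ?nnegrE ?mulr_ge0 ?rnorm_ge0 ?(ltW d0)//.
rewrite XE; have := decay m x; set t := rnorm (T' _) ^+ 2 => h.
have {}h : m%:R * (r * t) <= rnorm x ^+ 2.
  by apply: (le_trans h); rewrite lerBlDr lerDl sqr_ge0.
move: hm; rewrite ltr_pdivrMr ?exprn_gt0// => hm.
rewrite exprMn.
have m0 : 0 < m%:R :> R.
  rewrite ltr0n lt0n; apply/eqP => m0; move: hm.
  by rewrite m0 mul0r ltNge sqr_ge0.
have h4 : m%:R * t <= M ^+ 2 * rnorm x ^+ 2.
  rewrite -(ler_pM2l r0) mulrCA; apply: (le_trans h).
  by rewrite mulrA rM mul1r.
rewrite -(ler_pM2l m0); apply: (le_trans h4).
by rewrite [leRHS]mulrA ler_wpM2r ?sqr_ge0// ltW.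
Qed.

End Ideals.

(** * Vanishing of homomorphisms on B(H) and its quotients *)

Section StarHomZero.
Context {R : realType} {A : cstar_algebra R} {X : eqType}.

(** What [sparse_columns_contradiction] asks of one column. In the last clause the factor N depends
    on [b] alone, not on the element it multiplies. *)
Definition sparse_column (D : set A) (P : set X) (ev : X -> A -> R[i]) : Prop :=
  [/\ (forall y a b, P y -> ev y (a + b) = ev y a + ev y b) /\
      (forall y c a, P y -> ev y (c *: a) = c * ev y a),
    forall Y a, finite_in P Y -> column_mass ev Y a <= rnorm a ^+ 2,
    forall a b (C : R), (forall Y, finite_in P Y -> column_mass ev Y b <= C) ->
      forall Y, finite_in P Y -> column_mass ev Y (cs_mul a b) <= 4 * (rnorm a ^+ 2 * C),
    forall b, D b -> exists2 Y, finite_in P Y & column_support P ev Y b &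
    forall b, D b -> exists N, forall Y c, D c -> finite_in P Y ->
      column_support P ev Y c -> exists Z, [/\ finite_in P Z, (size Z <= N * size Y)%N &
      column_support P ev Z (cs_mul b c)]].

(** Since phi x = phi x phi(1), it suffices that p = phi(1) is 0; otherwise p has a nonzero entry in
    some column. The relations satisfied by the isometries and by [T] are algebraic, so [phi]
    carries them over to [A]. *)
Lemma star_hom_BH_zero (H : hilbert_space R) (D : set A) :
  infinite_dimensional H ->
  (forall x e, 0 < e -> exists2 b, D b & rnorm (x - b) < e) ->
  (forall a : A, a != 0 -> exists P ev, sparse_column D P ev /\
    exists2 y, P y & ev y a != 0) ->
  every_star_hom_zero (BH H) A.
Proof.
move=> infH dense sep phi [phiD phiZ phiM phiS] x.
have [S [SS ST]] := orthogonal_isometries infH.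
have phi0 : phi (bo_zero : BH H) = 0 by rewrite [LHS]phiZ// scale0r.
(* [BH H] carries bare operations only, so a finite combination is described by its values on
   vectors and recognized by extensionality. *)
have phi_comb (n : nat) (c : nat -> R[i]) (V : nat -> bounded_op H) (U : bounded_op H) :
    (forall z, U z = \sum_(j < n) c j *: V j z) ->
    phi (U : BH H) = \sum_(j < n) c j *: phi (V j : BH H).
  elim: n U => [|n IH] U hU.
    rewrite big_ord0 -phi0; congr phi; apply: bo_ext => z.
    by rewrite hU big_ord0 bo_zeroE.
  pose W := foldr (fun j W => bo_add (bo_scale (c j) (V j)) W) bo_zero (iota 0 n).
  have WE z : W z = \sum_(j < n) c j *: V j z.
    rewrite -(big_mkord xpredT (fun j => c j *: V j z)) /index_iota subn0 /W.
    elim: (iota 0 n) => [|j s IHs]; first by rewrite big_nil bo_zeroE.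
    by rewrite big_cons /= IHs.
  rewrite big_ord_recr /= -(IH W WE) -[c n *: _]phiZ// -[RHS]phiD//.
  by congr phi; apply: bo_ext => z; rewrite /= hU big_ord_recr/= WE.
pose p := phi (bo_id : BH H).
have adj_id : bo_adj (bo_id : bounded_op H) = bo_id by apply: bo_adj_unique.
have comp_id (T : bounded_op H) : bo_comp T bo_id = T by exact: bo_ext.
suff p0 : p = 0.
  by rewrite -[x](comp_id x) [LHS]phiM// -/p p0 cs_mul0r.
apply: contrapT => /eqP /sep[P [ev [[[evD evZ] mass massM fin sparse] [y Py]]]].
apply/negP; rewrite negbK; apply/eqP.
apply: (@sparse_columns_contradiction _ _ _ _ _ evD evZ mass massM p
  (fun m => phi (S m : BH H)) _ _ _ D nat_pair) => //.
- by rewrite -[LHS](phiS (bo_id : BH H))//= adj_id.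
- by rewrite -[LHS](phiM (bo_id : BH H) (bo_id : BH H))//= comp_id.
- move=> l m; rewrite -[cs_star _]phiS// -[LHS]phiM//= SS.
  by case: eqP.
- by move=> k m n /nat_pair_inj[].
- move=> n s n0; have [T hT] := ST n s n0; exists (phi (T : BH H)) => k.
  rewrite -[LHS]phiM//; apply: (phi_comb (n k)
    (fun j => ((Num.sqrt (n k)%:R)^-1)%:C%C * (-1) ^+ s k j) (fun j => S (nat_pair k j))).
  exact: hT.
Qed.

End StarHomZero.

Section Quotients.
Context {R : realType} {H : hilbert_space R} {A : cstar_algebra R}.

Section QuotientHom.
Variable J : set (bounded_op H).
Hypotheses (idealJ : norm_closed_ideal J).

Let J0 : J bo_zero.
Proof.
have [[T JT] _ JZ _ _] := idealJ.
rewrite (_ : bo_zero = bo_scale 0 T); first exact: JZ.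
by apply: bo_ext => x /=; rewrite !scale0r.
Qed.

Let JD T U : J T -> J U -> J (bo_add T U).
Proof. by case: idealJ => _ + _ _ _; apply. Qed.

Let JZ a T : J T -> J (bo_scale a T).
Proof. by case: idealJ => _ _ + _ _; apply. Qed.

Let JMl T U : J T -> J (bo_comp U T).
Proof. by case: idealJ => _ _ _ h _ JT; case: (h T U JT). Qed.

Let JMr T U : J T -> J (bo_comp T U).
Proof. by case: idealJ => _ _ _ h _ JT; case: (h T U JT). Qed.

Lemma quot_classP T U : quot_class J T = quot_class J U <-> J (bo_sub T U).
Proof.
have sym V W : J (bo_sub V W) -> J (bo_sub W V).
  move=> /(JZ (-1)); congr J; apply: bo_ext => x /=.
  by rewrite !scaleN1r opprD opprK addrC.
have trans V W Z : J (bo_sub V W) -> J (bo_sub W Z) -> J (bo_sub V Z).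
  move=> h1 h2; have := JD h1 h2; congr J; apply: bo_ext => x /=.
  by rewrite !scaleN1r addrA subrK.
split=> [[e]|TU].
  have : coset J T T.
    rewrite /coset /=; move: J0; congr J; apply: bo_ext => x /=.
    by rewrite scale0r scaleN1r subrr.
  by rewrite e.
apply: eq_exist; apply/seteqP; split => V /= h; first exact: trans h TU.
exact: trans h (sym _ _ TU).
Qed.

Lemma quot_reprK C : quot_class J (quot_repr C) = C.
Proof.
by case: C => C hC; apply: eq_exist; rewrite /quot_repr /=; case: cid => T /= ->.
Qed.

Lemma quot_reprP T : J (bo_sub (quot_repr (quot_class J T)) T).
Proof. by apply/quot_classP; exact: quot_reprK. Qed.

(** The operations on cosets go through arbitrary representatives, so each clause is a congruence
    modulo [J]; the one for the adjoint rests on [ideal_adj]. The scalar -1 only reverses the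
    differences supplied by [quot_reprP]. *)
Lemma quot_star_hom (phi : BH_quot J -> A) : star_hom phi ->
  star_hom (fun T : BH H => phi (quot_class J T)).
Proof.
move=> [phiD phiZ phiM phiS]; split.
- move=> T U _ _; rewrite -phiD//; congr phi; apply/quot_classP.
  have := JZ (-1) (JD (quot_reprP T) (quot_reprP U)); congr J; apply: bo_ext => x /=.
  rewrite !scaleN1r; set a := quot_repr _ x; set b := quot_repr _ x.
  by rewrite addrACA -opprD opprB.
- move=> a T _; rewrite -phiZ//; congr phi; apply/quot_classP.
  have := JZ (- a) (quot_reprP T); congr J; apply: bo_ext => x /=.
  by rewrite !scaleN1r scaleNr scalerBr opprB.
- move=> T U _ _; rewrite -phiM//; congr phi; apply/quot_classP.
  set V := quot_repr (quot_class J T); set W := quot_repr (quot_class J U).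
  have h1 : J (bo_comp (bo_sub V T) W) by apply: JMr; exact: quot_reprP.
  have h2 : J (bo_comp T (bo_sub W U)) by apply: JMl; exact: quot_reprP.
  have := JZ (-1) (JD h1 h2); congr J; apply: bo_ext => x /=.
  by rewrite !scaleN1r bo_B addrA subrK opprB.
- move=> T _; rewrite -phiS//; congr phi; apply/quot_classP.
  have := JZ (-1) (ideal_adj idealJ (quot_reprP T)); congr J.
  have cN1 : conjc (-1 : R[i]) = -1 by apply/eqP; rewrite eq_complex /= !oppr0 !eqxx.
  by rewrite bo_adj_add bo_adj_scale cN1; apply: bo_ext => x /=; rewrite !scaleN1r opprB.
Qed.

Lemma no_nonzero_image_quot : every_star_hom_zero (BH H) A -> J <> setT ->
  no_nonzero_image (BH_quot J) A.
Proof.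
move=> zero JT.
have zeroJ : every_star_hom_zero (BH_quot J) A.
  move=> phi /quot_star_hom/zero h C; rewrite -[C]quot_reprK; exact: h.
have [T nJT] : exists T, ~ J T.
  apply: contrapT => h; apply: JT; apply/seteqP; split => // T _.
  by apply: contrapT => nJ; apply: h; exists T.
have not_inj (phi : BH_quot J -> A) : star_hom phi -> ~ injective phi.
  move=> /zeroJ h /(_ (quot_class J T) (quot_class J bo_zero)).
  rewrite !h => /(_ erefl)/quot_classP; apply: contra_not nJT; congr J.
  by apply: bo_ext => x /=; rewrite scale0r scaler0 addr0.
split => //; first by case=> phi /not_inj.
by case=> phi /not_inj h /bij_inj.
Qed.

End QuotientHom.

Lemma no_nonzero_image_BH : every_star_hom_zero (BH H) A ->
  infinite_dimensional H -> no_nonzero_image (BH H) A.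
Proof.
move=> zero infH.
have [x x0] : exists x : H, x <> 0.
  (* Infinite dimension, applied to the empty family, yields a nonzero vector; hence the identity
     differs from 0. *)
  have [x hx] := infH 0%N (fun=> 0); exists x => x0; apply: (hx (fun=> 0)).
  by rewrite big_ord0.
have not_inj (phi : BH H -> A) : star_hom phi -> ~ injective phi.
  move=> /zero h /(_ bo_id bo_zero); rewrite !h => /(_ erefl) /(congr1 (fun T : bounded_op H => T x)).
  by rewrite bo_zeroE.
split => //; first by case=> phi /not_inj.
by case=> phi /not_inj h /bij_inj.
Qed.

End Quotients.

Lemma open_rnorm_ball (R : realType) (V : normedModType R[i]) (c : V) (e : R) : open [set x | rnorm (c - x) < e].
Proof.
rewrite (_ : [set x | _] = ball c e%:C%C); first exact: ball_open.
by apply/seteqP; split => x /=; rewrite -ball_normE /ball_ /= rnormE ltcR.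
Qed.

(** * Compact operators *)

Section TotallyBounded.
Context {R : realType} {V : completeNormedModType R[i]}.
Implicit Types A : set V.

Definition totally_bounded A : Prop := forall e : R, 0 < e ->
  exists s : seq V, forall x, A x -> exists2 c, c \in s & rnorm (x - c) < e.

Lemma closure_rnorm A x (e : R) : closure A x -> 0 < e -> exists2 a, A a & rnorm (x - a) < e.
Proof.
move=> Ax e0; have : nbhs x [set y | rnorm (x - y) < e].
  apply: open_nbhs_nbhs; split; first exact: open_rnorm_ball.
  by rewrite /= subrr rnorm0.
by move=> /Ax[a [Aa xa]]; exists a.
Qed.

Lemma compact_totally_bounded A : compact (closure A) -> totally_bounded A.
Proof.
rewrite compact_cover => cA e e0.
have [//|x Ax|D _ hD] := cA V setT (fun c => [set x | rnorm (c - x) < e]).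
- by move=> c _; exact: open_rnorm_ball.
- by exists x => //=; rewrite subrr rnorm0.
exists (enum_fset D) => x Ax; have [c cD xc] := hD x (subset_closure Ax).
by exists c => //; rewrite rnormB.
Qed.

(** An ultrafilter containing a finite union of balls contains one of them, so it has members of
    arbitrarily small diameter; completeness gives the limit. *)
Lemma totally_bounded_compact A : totally_bounded A -> compact (closure A).
Proof.
move=> tA; rewrite compact_ultra => F FU FA.
have ultra_seq (s : seq V) (B : V -> set V) :
    F [set x | exists2 c, c \in s & B c x] -> exists c, F (B c).
  elim: s => [|c s IH] Fs.
    have [x [c]] := filter_ex Fs; by rewrite in_nil.
  have [Fc|FnC] := in_ultra_setVsetC (B c) FU; first by exists c.
  apply: IH; apply: filterS (filterI Fs FnC) => x [[d]].
  rewrite inE => /predU1P[-> //|ds Bd _]; by exists d.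
have cF : cauchy F.
  apply/cauchy_ballP => _ /complex_gt0[e e0 ->].
  have e4 : 0 < e / 4 by rewrite divr_gt0.
  have [s hs] := tA _ e4.
  have [|c Fc] := ultra_seq s (fun c => [set x | rnorm (x - c) < e / 2]).
    apply: filterS FA => x /closure_rnorm /(_ e4)[a /hs[c cs ac] xa].
    exists c => //=; rewrite -(subrK a x) -addrA.
    by apply: le_lt_trans (ler_rnormD _ _) _; lra.
  exists ([set x | rnorm (x - c) < e / 2], [set x | rnorm (x - c) < e / 2]) => //.
  move=> [x y] [/= xc yc]; rewrite -ball_normE /ball_/= rnormE ltcR.
  rewrite -(subrK c x) -addrA; apply: le_lt_trans (ler_rnormD _ _) _.
  by rewrite [rnorm (c - y)]rnormB; lra.
have Fl : F --> lim F by exact: cauchy_cvg.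
exists (lim F); split => //.
apply: (@closed_cvg _ _ F _ id (closure A)) => //.
exact: closed_closure.
Qed.

End TotallyBounded.

Section CompactOperators.
Context {R : realType} {H : hilbert_space R}.
Implicit Types T U : bounded_op H.

Lemma compact_operatorsP T : compact_operators T <->
  totally_bounded (T @` [set x : H | rnorm x <= 1]).
Proof.
split; [exact: compact_totally_bounded|exact: totally_bounded_compact].
Qed.

Lemma compact_operators_compl T U : compact_operators T -> compact_operators (bo_comp U T).
Proof.
move=> /compact_operatorsP tT; apply/compact_operatorsP => e e0.
have [M M0 hM] := bo_rnorm_bound U.
have M1 : 0 < M + 1 by rewrite ltr_wpDl.
have [s hs] := tT (e / (M + 1)) (divr_gt0 e0 M1).
exists (map U s) => _ [x /= x1 <-].
have [c cs hc] := hs (T x) (ex_intro2 _ _ x x1 erefl).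
exists (U c); first exact: map_f.
rewrite -bo_B; apply: le_lt_trans (hM _) _.
move: hc; rewrite ltr_pdivlMr//; apply: le_lt_trans.
by rewrite mulrC ler_wpM2l ?rnorm_ge0// lerDl.
Qed.

Lemma compact_operators_compr T U : compact_operators T -> compact_operators (bo_comp T U).
Proof.
move=> /compact_operatorsP tT; apply/compact_operatorsP => e e0.
have [M M0 hM] := bo_rnorm_bound U.
have M1 : 0 < M + 1 by rewrite ltr_wpDl.
have [s hs] := tT (e / (M + 1)) (divr_gt0 e0 M1).
exists (map (fun c => (M + 1)%:C%C *: c) s) => _ [x /= x1 <-].
(* [U x] may leave the unit ball; rescaling by M + 1 brings it back, and the net is rescaled
   accordingly. *)
pose y := ((M + 1)^-1)%:C%C *: U x.
have y1 : rnorm y <= 1.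
  rewrite rnormZ rnormC ger0_norm ?invr_ge0 ?(ltW M1)// mulrC ler_pdivrMr// mul1r.
  apply: (le_trans (hM x)); apply: (@le_trans _ _ (M * 1)); last by rewrite mulr1 lerDl.
  exact: ler_wpM2l.
have [c cs hc] := hs (T y) (ex_intro2 _ _ y y1 erefl).
exists ((M + 1)%:C%C *: c); first by apply/mapP; exists c.
have -> : T (U x) = (M + 1)%:C%C *: T y.
  rewrite -bo_Z scalerA -rmorphM/= mulfV ?scale1r//.
  by rewrite gt_eqF.
rewrite -scalerBr rnormZ rnormC ger0_norm ?(ltW M1)// mulrC.
by rewrite -ltr_pdivlMr.
Qed.

Lemma compact_operators_ideal : norm_closed_ideal (@compact_operators R H).
Proof.
split.
- exists bo_zero; apply/compact_operatorsP => e e0.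
  exists [:: 0] => _ [x _ <-]; exists 0; first by rewrite mem_head.
  by rewrite bo_zeroE subrr rnorm0.
- move=> T U /compact_operatorsP tT /compact_operatorsP tU.
  apply/compact_operatorsP => e e0; have e2 : 0 < e / 2 by rewrite divr_gt0.
  have [s hs] := tT _ e2; have [t ht] := tU _ e2.
  exists [seq a + b | a <- s, b <- t] => _ [x /= x1 <-].
  have [a sa ha] := hs (T x) (ex_intro2 _ _ x x1 erefl).
  have [b tb hb] := ht (U x) (ex_intro2 _ _ x x1 erefl).
  exists (a + b); first exact: allpairs_f.
  rewrite opprD addrACA; apply: le_lt_trans (ler_rnormD _ _) _; lra.
- move=> a T; rewrite (_ : bo_scale a T = bo_comp (bo_scale a bo_id) T).
    exact: compact_operators_compl.
  exact: bo_ext.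
- by move=> T U cT; split; [exact: compact_operators_compl|exact: compact_operators_compr].
- move=> T hT; apply/compact_operatorsP => e e0.
  have e2 : 0 < e / 2 by rewrite divr_gt0.
  have [U /compact_operatorsP tU TU] := hT _ e2; have [s hs] := tU _ e2.
  exists s => _ [x /= x1 <-].
  have [c cs hc] := hs (U x) (ex_intro2 _ _ x x1 erefl).
  exists c => //; rewrite -(subrK (U x) (T x)) -addrA.
  apply: le_lt_trans (ler_rnormD _ _) _.
  have h : rnorm (T x - U x) <= op_norm (bo_sub T U).
    have := rnorm_le_op_norm (bo_sub T U) x; rewrite /= scaleN1r => /le_trans; apply.
    by rewrite -[leRHS]mulr1 ler_wpM2l// op_norm_ge0.
  lra.
Qed.

(** The identity is not compact: orthonormal vectors are sqrt 2 apart, so no two of them lie within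
    1/2 of the same center, and infinitely many cannot share a finite net. *)
Lemma compact_operators_proper : infinite_dimensional H -> @compact_operators R H <> setT.
Proof.
move=> infH cT.
have [I [e [oe te]]] := @orthonormal_basis_exists R H.
have /infiniteP/card_leP[k] := basis_infinite oe te infH.
pose f n : I := val (k (SigSub (mem_set (Logic.I : [set: nat] n)))).
have finj : injective f.
  move=> m n /val_inj/(inj (f := k)); rewrite !in_setT => /(_ isT isT).
  by move=> /(congr1 val).
have /compact_operatorsP tid : compact_operators (bo_id : bounded_op H) by rewrite cT.
have h2 : 0 < 1 / 2 :> R by rewrite divr_gt0.
have [s hs] := tid _ h2.
have ne n : rnorm (e (f n)) = 1.
  have := inner_rnorm (e (f n)); rewrite oe eqxx => /esym/complexI h.
  by apply/eqP; rewrite -(@eqrXn2 _ 2) ?rnorm_ge0// h expr1n.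
have hc n : exists c : 'I_(size s), rnorm (e (f n) - tnth (in_tuple s) c) < 1 / 2.
  have [|c cs hc] := hs (e (f n)); first by exists (e (f n)) => //=; rewrite ne.
  have := cs; rewrite -index_mem => i; exists (Ordinal i).
  by rewrite (tnth_nth c) /= nth_index.
have [c {}hc] := choice hc.
suff cinj : injective (fun n : 'I_(size s).+1 => c n).
  by have := leq_card _ cinj; rewrite !card_ord ltnn.
move=> m n cmn; apply: ord_inj; apply: contrapT => mn.
have : rnorm (e (f m) - e (f n)) < 1.
  have -> : e (f m) - e (f n) = (e (f m) - tnth (in_tuple s) (c m)) -
      (e (f n) - tnth (in_tuple s) (c n)) by rewrite cmn opprB addrA subrK.
  apply: le_lt_trans (ler_rnormD _ _) _; rewrite rnormN.
  have := hc m; have := hc n; lra.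
have := rnorm_sqrD (e (f m)) (- e (f n)); rewrite rnormN !ne innerNr oe.
case: eqP => [/finj//|_]; rewrite oppr0 /= mulr0 addr0 expr1n => h.
have := rnorm_ge0 (e (f m) - e (f n)); nra.
Qed.

End CompactOperators.

(** * Coordinates on the Fell line bundle *)

Section GroupoidAlgebra.
Context {G : topologicalType} (g : top_groupoid G).

Lemma gmulKV x y : gsrc g x = gsrc g y -> gmul g (gmul g x (ginv g y)) y = x.
Proof.
move=> xy; rewrite -gmulA ?grng_inv ?gsrc_inv//.
by rewrite gmulVx -xy gmul_src.
Qed.

Lemma gmulK x y : gsrc g x = grng g y -> gmul g (gmul g x y) (ginv g y) = x.
Proof. by move=> xy; rewrite -gmulA ?grng_inv// gmulxV -xy gmul_src. Qed.

Lemma gmulVK x y : gsrc g x = grng g y -> gmul g (ginv g x) (gmul g x y) = y.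
Proof. by move=> xy; rewrite gmulA ?gsrc_inv// gmulVx xy gmul_rng. Qed.

Lemma ginv_unique x y : gsrc g y = grng g x -> gmul g y x = gsrc g x -> y = ginv g x.
Proof.
by move=> yx e; rewrite -(gmulK yx) e -grng_inv gmul_rng.
Qed.

Lemma ginvK x : ginv g (ginv g x) = x.
Proof. by apply/esym/ginv_unique; rewrite ?grng_inv// gmulxV gsrc_inv. Qed.

Lemma grng_unit_id u : gunits g u -> grng g u = u.
Proof. by move=> h; rewrite -{1}h grng_src h. Qed.

Lemma gunits_src x : gunits g (gsrc g x). Proof. exact: gsrc_src. Qed.
Lemma gunits_rng x : gunits g (grng g x). Proof. exact: gsrc_rng. Qed.

End GroupoidAlgebra.

Section FellCoordinates.
Context {R : realType} {G S : topologicalType}.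
Context {g : top_groupoid G} {s : top_groupoid S} (t : twist R g s).
Local Notation p := (tproj t).
Local Notation act := (tact t).
Local Notation cls := (Lclass t).

Lemma unit_tproj_inj e f : gunits s e -> gunits s f -> p e = p f -> e = f.
Proof. by move=> /(tiota_unit t) {2}<- /(tiota_unit t) {2}<- ->. Qed.

Lemma composable_tproj x y : gsrc s x = grng s y <-> gsrc g (p x) = grng g (p y).
Proof.
rewrite -tproj_src -tproj_rng; split => [->//|].
by apply: unit_tproj_inj; [exact: gunits_src|exact: gunits_rng].
Qed.

Lemma tproj_unit x : gunits g (p (grng s x)).
Proof. by rewrite tproj_rng; exact: gunits_rng. Qed.

Lemma tiota_rng1 x : tiota t (p (grng s x)) 1 = grng s x.
Proof. by apply: tiota_unit; exact: gunits_rng. Qed.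

Lemma src_iota_rng z x : circle z -> gsrc s (tiota t (p (grng s x)) z) = grng s x.
Proof. by move=> zT; rewrite tiota_src ?tiota_rng1//; exact: tproj_unit. Qed.

Lemma rng_act z x : circle z -> grng s (act z x) = grng s x.
Proof.
move=> zT; rewrite /tact grng_mul ?src_iota_rng//.
by rewrite tiota_rng ?tiota_rng1//; exact: tproj_unit.
Qed.

Lemma tproj_act z x : circle z -> p (act z x) = p x.
Proof.
move=> zT; rewrite /tact tprojM ?src_iota_rng// tproj_iota//; last exact: tproj_unit.
by rewrite tproj_rng gmul_rng.
Qed.

Lemma act_inj z w x : circle z -> circle w -> act z x = act w x -> z = w.
Proof.
move=> zT wT e.
have h v : circle v -> tiota t (p (grng s x)) v = gmul s (act v x) (ginv s x).
  by move=> vT; rewrite /tact gmulK ?src_iota_rng.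
have := h _ zT; rewrite e -h// => /esym.
by move=> /tiota_inj[]//; exact: tproj_unit.
Qed.

Lemma act_mull z x y : circle z -> gsrc s x = grng s y ->
  gmul s (act z x) y = act z (gmul s x y).
Proof.
by move=> zT xy; rewrite /tact -gmulA ?src_iota_rng// grng_mul.
Qed.

Lemma act_mulr z x y : circle z -> gsrc s x = grng s y ->
  gmul s x (act z y) = act z (gmul s x y).
Proof.
move=> zT xy; rewrite -act_mull// [in RHS]/tact [in RHS]tcentral// -gmulA.
- by rewrite xy.
- by rewrite xy tiota_rng ?tiota_rng1//; exact: tproj_unit.
- by rewrite xy src_iota_rng.
Qed.

Lemma tproj_inv x : p (ginv s x) = ginv g (p x).
Proof.
apply: ginv_unique; first by rewrite -tproj_src gsrc_inv tproj_rng.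
by rewrite -tprojM ?gsrc_inv// gmulVx tproj_src.
Qed.

(** The arrow y x^-1 projects to a unit, so [tproj_ker] puts it in the image of [tiota]. *)
Lemma fibre_transitive x y : p x = p y -> exists2 z, circle z & y = act z x.
Proof.
move=> pxy.
have rxy : grng s y = grng s x.
  by apply: unit_tproj_inj; rewrite ?tproj_rng ?pxy//; exact: gunits_rng.
have sxy : gsrc s y = gsrc s x.
  by apply: unit_tproj_inj; rewrite ?tproj_src ?pxy//; exact: gunits_src.
have c : gsrc s y = grng s (ginv s x) by rewrite grng_inv.
have : (p @^-1` gunits g) (gmul s y (ginv s x)).
  by rewrite /= tprojM// tproj_inv pxy gmulxV; exact: gunits_rng.
rewrite tproj_ker => -[[u z] [/= uG zT] e]; exists z => //.
have uE : u = p (grng s x).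
  by rewrite -(tproj_iota t uG zT) e tprojM// tproj_inv pxy gmulxV -tproj_rng rxy.
by rewrite /tact -uE e gmulKV.
Qed.

Lemma Lclass_eq x y a b : cls x a = cls y b <->
  exists2 z, circle z & y = act z x /\ b = conjc z * a.
Proof.
split.
  move=> /eqquotP/asboolP[z zT [-> ->]]; exists z => //.
by case=> z zT [-> ->]; apply/eqquotP/asboolP; exists z.
Qed.

Lemma Lclass_act z x a : circle z -> cls (act z x) a = cls x (z * a).
Proof.
move=> zT; apply/esym/Lclass_eq; exists z => //; split => //.
by rewrite mulrA circle_mulJ// mul1r.
Qed.

Lemma LreprK l : cls (Lrepr l).1 (Lrepr l).2 = l.
Proof. by rewrite /Lclass -surjective_pairing /Lrepr; exact: reprK. Qed.

Lemma Lclass_inj x : injective (cls x).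
Proof.
move=> a b /Lclass_eq[z zT [e ->]].
have -> : z = 1 by apply: (@act_inj _ _ x) => //; [exact: circle1|rewrite -e tact1].
by rewrite rmorph1 mul1r.
Qed.

Lemma Lrepr_class x a : exists2 z, circle z &
  (Lrepr (cls x a)).1 = act z x /\ (Lrepr (cls x a)).2 = conjc z * a.
Proof. by apply/Lclass_eq; rewrite LreprK. Qed.

Lemma Lbase_class x a : Lbase (cls x a) = p x.
Proof. by have [z zT [e _]] := Lrepr_class x a; rewrite /Lbase e tproj_act. Qed.

Lemma Lclass_ex x l : Lbase l = p x -> exists a, l = cls x a.
Proof.
rewrite /Lbase => /esym/fibre_transitive[z zT e].
exists (z * (Lrepr l).2); rewrite -Lclass_act// -e; exact/esym/LreprK.
Qed.

Lemma Lcoord_class x a : Lcoord x (cls x a) = a.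
Proof.
rewrite /Lcoord; case: xgetP => [b _ /Lclass_inj//|].
by move=> /(_ a)[].
Qed.

Lemma Lclass_coord x l : Lbase l = p x -> cls x (Lcoord x l) = l.
Proof. by move=> /Lclass_ex[a ->]; rewrite Lcoord_class. Qed.

Lemma fell_norm_class x a : fell_norm (cls x a) = rnorm a.
Proof.
have [z zT [_ e]] := Lrepr_class x a.
by rewrite /fell_norm e rnormM rnormJ rnorm_circle// mul1r.
Qed.

Lemma Lmul_class x y a b : gsrc s x = grng s y ->
  Lmul (cls x a) (cls y b) = cls (gmul s x y) (a * b).
Proof.
move=> xy; have [z zT [ex ea]] := Lrepr_class x a; have [w wT [ey eb]] := Lrepr_class y b.
rewrite /Lmul ex ea ey eb act_mull ?rng_act// act_mulr// tactM// Lclass_act; last exact: circleM.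
congr (cls _ _); rewrite mulrACA ![_ * (conjc _ * _)]mulrA ![_ * conjc _]mulrC.
by rewrite !circle_mulJ// !mul1r.
Qed.

Lemma Ladd_class x a b : Ladd (cls x a) (cls x b) = cls x (a + b).
Proof.
have [z zT [ex ea]] := Lrepr_class x a.
rewrite /Ladd ex ea.
have -> : cls x b = cls (act z x) (conjc z * b).
  by rewrite Lclass_act// mulrA [_ * conjc _]mulrC circle_mulJ// mul1r.
rewrite Lcoord_class -mulrDr Lclass_act// mulrA [_ * conjc _]mulrC.
by rewrite circle_mulJ// mul1r.
Qed.

Lemma Lscale_class x a c : Lscale c (cls x a) = cls x (c * a).
Proof.
have [z zT [ex ea]] := Lrepr_class x a.
rewrite /Lscale ex ea Lclass_act// mulrCA [z * _]mulrA [z * _]mulrC.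
by rewrite circle_mulJ// mul1r.
Qed.

Lemma tliftK x : p (tlift t x) = x.
Proof. exact: (projT2 (cid (tproj_surj t x))). Qed.

Lemma Lclass0 x : cls x 0 = Lzero t (p x).
Proof.
have [z zT ->] : exists2 z, circle z & x = act z (tlift t (p x)).
  by apply: fibre_transitive; rewrite tliftK.
by rewrite Lclass_act// mulr0 tproj_act// tliftK.
Qed.

Lemma Lcoord0 x : Lcoord x (Lzero t (p x)) = 0.
Proof. by rewrite -Lclass0 Lcoord_class. Qed.

Lemma LcoordD x (l m : fell_bundle t) : Lbase l = p x -> Lbase m = p x ->
  Lcoord x (Ladd l m) = Lcoord x l + Lcoord x m.
Proof. by move=> /Lclass_ex[a ->] /Lclass_ex[b ->]; rewrite Ladd_class !Lcoord_class. Qed.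

Lemma LcoordZ x (l : fell_bundle t) c : Lbase l = p x -> Lcoord x (Lscale c l) = c * Lcoord x l.
Proof. by move=> /Lclass_ex[a ->]; rewrite Lscale_class !Lcoord_class. Qed.

Lemma fell_norm_coord x (l : fell_bundle t) : Lbase l = p x -> fell_norm l = rnorm (Lcoord x l).
Proof. by move=> /Lclass_ex[a ->]; rewrite fell_norm_class Lcoord_class. Qed.

(** The scalar comparing the product of the chosen lifts of x and y with the chosen lift of their
    product; it turns convolution of sections into a twisted convolution of scalar functions. *)
Definition tcocycle (x y : G) : R[i] :=
  Lcoord (tlift t (gmul g x y)) (cls (gmul s (tlift t x) (tlift t y)) 1).

Lemma Lcoord_scale1 x y a : p x = p y -> Lcoord x (cls y a) = a * Lcoord x (cls y 1).
Proof.
move=> xy; rewrite -LcoordZ ?Lbase_class//.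
by rewrite Lscale_class mulr1.
Qed.

Lemma tlift_composable x y : gsrc g x = grng g y ->
  gsrc s (tlift t x) = grng s (tlift t y).
Proof. by move=> xy; apply/composable_tproj; rewrite !tliftK. Qed.

Lemma tproj_tlift_mul x y : gsrc g x = grng g y ->
  p (gmul s (tlift t x) (tlift t y)) = gmul g x y.
Proof. by move=> xy; rewrite tprojM ?tliftK//; exact: tlift_composable. Qed.

Lemma rnorm_tcocycle x y : gsrc g x = grng g y -> rnorm (tcocycle x y) = 1.
Proof.
move=> xy; rewrite /tcocycle -fell_norm_coord ?fell_norm_class.
  by rewrite (rnormC 1) normr1.
by rewrite Lbase_class tproj_tlift_mul// tliftK.
Qed.

(** This trivialization of the line bundle comes from an arbitrary choice of lifts, so it suits
    norms and algebraic identities; continuity is studied through local lifts instead. *)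
Definition coef (f : G -> fell_bundle t) (x : G) : R[i] := Lcoord (tlift t x) (f x).

Section Sections.
Implicit Types f h : G -> fell_bundle t.

Lemma coef_class f x : is_section f -> cls (tlift t x) (coef f x) = f x.
Proof. by move=> sf; rewrite Lclass_coord// tliftK. Qed.

Lemma coef_inj f h : is_section f -> is_section h -> coef f = coef h -> f = h.
Proof.
move=> sf sh fh; apply/funext => x.
by rewrite -(coef_class _ sf) -(coef_class _ sh) fh.
Qed.

Lemma coef_zero x : coef (Lzero t) x = 0.
Proof. by rewrite /coef -{2}(tliftK x) Lcoord0. Qed.

Lemma coef_eq0 f x : is_section f -> coef f x = 0 <-> f x = Lzero t x.
Proof.
move=> sf; split => [c0|f0]; last by rewrite -(coef_zero x) /coef f0.
by rewrite -(coef_class _ sf) c0 Lclass0 tliftK.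
Qed.

Lemma section_zero : is_section (Lzero t).
Proof. by move=> x; rewrite /Lzero Lbase_class tliftK. Qed.

Lemma section_add f h : is_section f -> is_section h -> is_section (sec_add f h).
Proof.
move=> sf sh x; rewrite /sec_add -(coef_class x sf) -(coef_class x sh).
by rewrite Ladd_class Lbase_class tliftK.
Qed.

Lemma section_scale c f : is_section f -> is_section (sec_scale c f).
Proof.
move=> sf x; rewrite /sec_scale -(coef_class x sf).
by rewrite Lscale_class Lbase_class tliftK.
Qed.

Lemma section_conv f h : is_section (sec_conv f h).
Proof. by move=> x; rewrite Lbase_class tliftK. Qed.

Lemma coef_add f h x : is_section f -> is_section h ->
  coef (sec_add f h) x = coef f x + coef h x.
Proof. by move=> sf sh; rewrite /coef LcoordD// tliftK. Qed.

Lemma coef_scale c f x : is_section f -> coef (sec_scale c f) x = c * coef f x.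
Proof. by move=> sf; rewrite /coef LcoordZ// tliftK. Qed.

Lemma fell_norm_coef f x : is_section f -> fell_norm (f x) = rnorm (coef f x).
Proof. by move=> sf; rewrite /coef -fell_norm_coord// tliftK. Qed.

Lemma coef_mul f h x y : is_section f -> is_section h -> gsrc g x = grng g y ->
  Lcoord (tlift t (gmul g x y)) (Lmul (f x) (h y)) = tcocycle x y * (coef f x * coef h y).
Proof.
move=> sf sh xy; rewrite -(coef_class x sf) -(coef_class y sh).
rewrite Lmul_class; last exact: tlift_composable.
by rewrite Lcoord_scale1 ?tproj_tlift_mul ?tliftK// mulrC.
Qed.

End Sections.
End FellCoordinates.

Lemma fsbig_seqE (V : nmodType) (I : choiceType) (A : set I) (r : seq I) (F : I -> V) :
  uniq r -> [set` r] `<=` A -> (forall i, A i -> i \notin r -> F i = 0) ->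
  \sum_(i \in A) F i = \sum_(i <- r) F i.
Proof.
move=> ur rA F0; rewrite (fsbigE r)// [LHS]big_seq_cond [RHS]big_seq.
by apply: eq_bigl => i; case: (boolP (i \in r)) => //= /rA Ai; rewrite mem_set.
Qed.

(** * The reduced norm through finite sums *)

Section ReducedNorm.
Context {R : realType} {G S : topologicalType}.
Context {g : top_groupoid G} {s : top_groupoid S} (t : twist R g s).
Implicit Types (f h xi : G -> fell_bundle t) (u : G) (Y : seq G).

Definition secmass Y f : R := \sum_(y <- Y) rnorm (coef f y) ^+ 2.

(** Extended real sums and suprema are unfolded only here and in [reduced_norm_le]; from then on
    every estimate concerns finite subsets of a source fibre. *)
Lemma l2norm_le u xi (r : R) : 0 <= r -> is_section xi ->
  (l2norm u xi <= r%:E)%E <->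
  forall Y, finite_in (@gfibre G g u) Y -> secmass Y xi <= r ^+ 2.
Proof.
move=> r0 sxi.
have -> : (l2norm u xi <= r%:E)%E =
    (\esum_(x in @gfibre G g u) (fell_norm (xi x) ^+ 2)%:E <= (r ^+ 2)%:E)%E.
  rewrite -(lee_sqrt _ (y := (r ^+ 2)%:E)) ?lee_fin ?sqr_ge0//.
  by rewrite EFin_expe sqrte_sqr gee0_abs.
split=> [h Y [uY YP]|h].
  rewrite -lee_fin; apply: le_trans h; apply: esum_ge.
  exists [set` Y]; first by split; [exact: finite_seq|exact: YP].
  rewrite -fsbig_seq// /secmass -sumEFin.
  by apply: lee_sum => y _; rewrite fell_norm_coef.
apply: ge_ereal_sup => _ [X [finX XP] <-].
rewrite fsbig_finite//= (eq_bigr (fun x => (rnorm (coef xi x) ^+ 2)%:E)).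
  rewrite sumEFin lee_fin; apply: h; split; first exact: fset_uniq.
  by move=> y; rewrite in_fset_set// => /set_mem/XP.
by move=> x _; rewrite fell_norm_coef.
Qed.

Lemma reduced_norm_le f (r : R) : 0 <= r ->
  (reduced_norm f <= r%:E)%E <->
  forall u xi, gunits g u -> is_section xi ->
    (forall Y, finite_in (@gfibre G g u) Y -> secmass Y xi <= 1) ->
    forall Y, finite_in (@gfibre G g u) Y -> secmass Y (lambda u f xi) <= r ^+ 2.
Proof.
move=> r0.
have sl u xi : is_section (lambda u f xi) by move=> x; rewrite Lbase_class tliftK.
split=> [h u xi uG sxi xi1|h].
  apply/(l2norm_le u r0 (sl u xi)); apply: le_trans h.
  rewrite /reduced_norm le_max; apply/orP; right.
  apply: (@le_trans _ _ (lambda_norm u f)).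
    apply: ereal_sup_ubound; exists xi => //; split => //.
    by apply/l2norm_le => //; rewrite expr1n.
  by apply: ereal_sup_ubound; exists u.
rewrite /reduced_norm ge_max lee_fin r0 /=.
apply: ge_ereal_sup => _ [u uG <-]; apply: ge_ereal_sup => _ [xi [sxi xi1] <-].
apply/l2norm_le => //; apply: h => //.
by move: xi1 => /l2norm_le; rewrite expr1n; apply.
Qed.

(** A sum with infinite support is 0 by convention, so a finite set carrying all nonzero terms has
    to be given. *)
Lemma coef_lambda u f xi x Y : is_section f -> is_section xi -> gsrc g x = u ->
  finite_in (@gfibre G g u) Y ->
  (forall y, gsrc g y = u -> y \notin Y ->
     coef f (gmul g x (ginv g y)) = 0 \/ coef xi y = 0) ->
  coef (lambda u f xi) x = \sum_(y <- Y) tcocycle t (gmul g x (ginv g y)) y *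
     (coef f (gmul g x (ginv g y)) * coef xi y).
Proof.
move=> sf sxi xu [uY YP] hY; rewrite /coef Lcoord_class.
have e y : gsrc g y = u ->
  Lcoord (tlift t x) (Lmul (f (gmul g x (ginv g y))) (xi y)) =
  tcocycle t (gmul g x (ginv g y)) y *
     (coef f (gmul g x (ginv g y)) * coef xi y).
  move=> yu; rewrite -coef_mul//; last by rewrite gsrc_mul ?gsrc_inv// grng_inv xu.
  by rewrite gmulKV// xu.
rewrite (fsbig_seqE uY)//; last first.
  by move=> y yu /(hY _ yu)[]; rewrite e// => ->; rewrite ?mul0r !mulr0.
by rewrite !big_seq; apply: eq_bigr => y /YP; exact: e.
Qed.

(** A factorization of x is determined by its right factor, which runs through the source fibre of
    x. *)
Lemma coef_conv f h x Y : is_section f -> is_section h ->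
  finite_in (@gfibre G g (gsrc g x)) Y ->
  (forall y, gsrc g y = gsrc g x -> y \notin Y ->
     coef f (gmul g x (ginv g y)) = 0 \/ coef h y = 0) ->
  coef (sec_conv f h) x = \sum_(y <- Y) tcocycle t (gmul g x (ginv g y)) y *
     (coef f (gmul g x (ginv g y)) * coef h y).
Proof.
move=> sf sh [uY YP] hY; rewrite /coef Lcoord_class.
pose k y := (gmul g x (ginv g y), y).
have kI : injective k by move=> y z [].
have comp y : gsrc g y = gsrc g x -> gsrc g (gmul g x (ginv g y)) = grng g y.
  by move=> yx; rewrite gsrc_mul ?gsrc_inv// grng_inv.
have e y : gsrc g y = gsrc g x ->
  Lcoord (tlift t x) (Lmul (f (k y).1) (h (k y).2)) =
  tcocycle t (gmul g x (ginv g y)) y *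
     (coef f (gmul g x (ginv g y)) * coef h y).
  move=> yx; rewrite /= -coef_mul ?comp//.
  by rewrite gmulKV.
rewrite (@fsbig_seqE _ _ _ (map k Y)).
- by rewrite big_map !big_seq; apply: eq_bigr => y /YP; exact: e.
- by rewrite map_inj_uniq.
- move=> _ /= /mapP[y /YP yx ->] /=; split; first exact: comp.
  by rewrite gmulKV.
- move=> [a b] [/= ab abx] nY.
  have bx : gsrc g b = gsrc g x by rewrite -abx gsrc_mul.
  have ak : (a, b) = k b by rewrite /k -abx gmulK.
  have bY : b \notin Y by apply: contra nY => bY; rewrite ak map_f.
  have := e _ bx; rewrite -ak /= => ->.
  by have [->|->] := hY _ bx bY; rewrite ?mul0r !mulr0.
Qed.

(** Columns have at most N nonzero entries and rows finitely many. The uniform bound on columns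
    controls the supports of products; finite rows make [lambda u f xi] a finite sum at each point
    for every vector xi. *)
Definition fin_fibres f (N : nat) : Prop :=
  (forall u, exists Y, [/\ finite_in (@gfibre G g u) Y, (size Y <= N)%N &
     forall y, gsrc g y = u -> coef f y <> 0 -> y \in Y]) /\
  (forall u, exists Y : seq G,
     forall y, grng g y = u -> coef f y <> 0 -> y \in Y).

Lemma coef_conv_lambda f h x : is_section f -> is_section h ->
  (exists N, fin_fibres h N) ->
  coef (sec_conv f h) x = coef (lambda (gsrc g x) f h) x.
Proof.
move=> sf sh [N [hs _]]; have [Y [fY _ Yh]] := hs (gsrc g x).
have hY y : gsrc g y = gsrc g x -> y \notin Y ->
    coef f (gmul g x (ginv g y)) = 0 \/ coef h y = 0.
  by move=> yx yY; right; apply: contrapT => /(Yh _ yx); rewrite (negbTE yY).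
by rewrite (coef_conv sf sh fY hY) (coef_lambda sf sh erefl fY hY).
Qed.

Lemma tcocycle_unit x : rnorm (tcocycle t x (gsrc g x)) = 1.
Proof. by apply: rnorm_tcocycle; rewrite grng_src. Qed.

(** Test the norm on the unit vector at u, which [lambda u f] maps to the restriction of f to the
    fibre, up to scalars of modulus 1. *)
Lemma secmass_reduced f (r : R) u Y : is_section f -> 0 <= r ->
  (reduced_norm f <= r%:E)%E -> gunits g u -> finite_in (@gfibre G g u) Y ->
  secmass Y f <= r ^+ 2.
Proof.
move=> sf r0 fr uG fY.
pose d : G -> fell_bundle t := fun x => Lclass t (tlift t x) (x == u)%:R.
have sd : is_section d by move=> x; rewrite Lbase_class tliftK.
have cd x : coef d x = (x == u)%:R by rewrite /coef Lcoord_class.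
have rn (b : bool) : rnorm (b%:R : R[i]) ^+ 2 = b%:R.
  by case: b; rewrite ?(rnormC 1) ?normr1 ?expr1n// rnorm0 expr0n.
have d1 Z : finite_in (@gfibre G g u) Z -> secmass Z d <= 1.
  move=> [uZ _]; rewrite /secmass; under eq_bigr do rewrite cd rn.
  rewrite -natr_sum -[leRHS]/(1%:R) ler_nat.
  rewrite (eq_bigr (fun y => if y == u then 1 else 0)%N); last by move=> y _; case: eqP.
  by rewrite -big_mkcond/= sum1_count count_uniq_mem//; case: (u \in Z).
have := (reduced_norm_le f r0).1 fr u d uG sd d1 Y fY; apply: le_trans.
have [_ YP] := fY.
rewrite /secmass !big_seq; apply: ler_sum => x /YP xu.
have fu : finite_in (@gfibre G g u) [:: u] by split => // y; rewrite inE => /eqP ->.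
rewrite (coef_lambda sf sd xu fu); last first.
  by move=> y _; rewrite inE cd => /negbTE ->; right.
have ui : ginv g u = u by apply/esym/ginv_unique; rewrite ?grng_unit_id// -{2}uG gmul_src.
have xuE : gmul g x (ginv g u) = x by rewrite ui -xu gmul_src.
rewrite big_seq1 xuE cd eqxx mulr1 rnormM.
by rewrite -xu tcocycle_unit mul1r.
Qed.

(** Homogeneity: xi is scaled into the unit ball by (C + d)^(-1/2), where d > 0 allows C = 0 and is
    small enough for r^2 d to be absorbed by e. *)
Lemma secmass_lambda f (r C : R) u xi Y : is_section f -> 0 <= r ->
  (exists N, fin_fibres f N) -> (reduced_norm f <= r%:E)%E -> gunits g u ->
  is_section xi -> (forall Y, finite_in (@gfibre G g u) Y -> secmass Y xi <= C) ->
  finite_in (@gfibre G g u) Y -> secmass Y (lambda u f xi) <= r ^+ 2 * C.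
Proof.
move=> sf r0 [N [_ fr]] frr uG sxi xiC fY.
apply/ler_addgt0Pr => e e0.
have C0 : 0 <= C.
  have f0 : finite_in (@gfibre G g u) [::] by [].
  by have := xiC _ f0; rewrite /secmass big_nil.
pose d := e / (r ^+ 2 + 1).
have r1 : 0 < r ^+ 2 + 1 by rewrite ltr_wpDl// sqr_ge0.
have d0 : 0 < d by rewrite divr_gt0.
pose K := C + d; have K0 : 0 < K by rewrite ltr_wpDl.
pose a := Num.sqrt K; have a0 : 0 < a by rewrite sqrtr_gt0.
have a2 : a ^+ 2 = K by rewrite sqr_sqrtr// ltW.
pose xi' := sec_scale (a^-1)%:C%C xi.
have sxi' : is_section xi' by exact: section_scale.
have cxi' y : coef xi' y = (a^-1)%:C%C * coef xi y by rewrite coef_scale.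
have an : rnorm (a^-1)%:C%C ^+ 2 = K^-1.
  by rewrite rnormC ger0_norm ?invr_ge0 ?(ltW a0)// exprVn a2.
have xi1 Z : finite_in (@gfibre G g u) Z -> secmass Z xi' <= 1.
  move=> /xiC h; rewrite /secmass; under eq_bigr do rewrite cxi' rnormM exprMn an.
  rewrite -mulr_sumr mulrC ler_pdivrMr// mul1r; apply: (le_trans h).
  by rewrite lerDl ltW.
have := (reduced_norm_le f r0).1 frr u xi' uG sxi' xi1 Y fY.
have -> : secmass Y (lambda u f xi') = K^-1 * secmass Y (lambda u f xi).
  rewrite /secmass mulr_sumr !big_seq; apply: eq_bigr => x.
  have [_ YP] := fY; move=> /YP xu.
  have [Z0 hZ0] := fr (grng g x).
  (* The y in the fibre for which w = x y^-1 is in the finite row of f, written as y = w^-1 x. *)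
  pose Z := undup [seq z <- [seq gmul g (ginv g z) x | z <- Z0] | gsrc g z == u].
  have fZ : finite_in (@gfibre G g u) Z.
    split; first exact: undup_uniq.
    by move=> y; rewrite mem_undup mem_filter => /andP[/eqP].
  have hZ (zeta : G -> fell_bundle t) y : gsrc g y = u -> y \notin Z ->
      coef f (gmul g x (ginv g y)) = 0 \/ coef zeta y = 0.
    move=> yu yZ; left; apply: contrapT => fy; move: yZ; apply/negP; rewrite negbK.
    rewrite mem_undup mem_filter yu eqxx /=; apply/mapP.
    exists (gmul g x (ginv g y)).
      by apply: hZ0 => //; rewrite grng_mul// grng_inv yu.
    have xy : gsrc g x = gsrc g y by rewrite yu.
    rewrite -[X in gmul _ _ X](gmulKV xy) gmulVK//.
    by rewrite gsrc_mul ?gsrc_inv// grng_inv.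
  rewrite (coef_lambda sf sxi' xu fZ (hZ _)) (coef_lambda sf sxi xu fZ (hZ _)).
  under eq_bigr do rewrite cxi' [_ * (_ * coef xi _)]mulrCA [tcocycle _ _ _ * _]mulrCA.
  by rewrite -mulr_sumr rnormM exprMn an.
rewrite mulrC ler_pdivrMr// => h; apply: (le_trans h).
rewrite /K mulrDr lerD2l /d mulrCA -[leRHS]mulr1 ler_wpM2l ?(ltW e0)//.
by rewrite ler_pdivrMr// mul1r lerDl.
Qed.

End ReducedNorm.

(** Pairwise intersecting compact intervals of the line have a common point, the supremum of their
    left endpoints. This extends a Lipschitz function on a dense set to one more point. *)
Lemma real_interpolation (R : realType) (T : Type) (D : set T) (v n : T -> R) :
  D !=set0 -> (forall f h, D f -> D h -> v f - v h <= n f + n h) ->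
  exists z, forall f, D f -> `|z - v f| <= n f.
Proof.
move=> [f0 Df0] vn; pose B := [set v f - n f | f in D].
have ubB : has_ubound B.
  exists (v f0 + n f0) => _ [f Df <-]; have := vn f f0 Df Df0; lra.
exists (sup B) => f Df; rewrite ler_distl; apply/andP; split.
  by have := ub_le_sup ubB; apply; exists f.
apply: ge_sup; first by exists (v f0 - n f0); exists f0.
by move=> _ [h Dh <-]; have := vn h f Dh Df; lra.
Qed.

(** The condition [e <= 1] allows quadratic errors e^2 to be replaced by e. *)
Lemma le_lim_linear (R : realFieldType) (x y K : R) : 0 <= K ->
  (forall e, 0 < e -> e <= 1 -> x <= y + e * K) -> x <= y.
Proof.
move=> K0 h; apply/ler_addgt0Pr => e e0.
pose d := Num.min 1 (e / (K + 1)).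
have K1 : 0 < K + 1 by rewrite ltr_wpDl.
have d0 : 0 < d by rewrite lt_min ltr01 divr_gt0.
have d1 : d <= 1 by rewrite ge_min lexx.
apply: (le_trans (h d d0 d1)); rewrite lerD2l.
apply: (@le_trans _ _ (e / (K + 1) * K)).
  by rewrite ler_wpM2r// ge_min lexx orbT.
by rewrite mulrAC ler_pdivrMr// ler_wpM2l ?(ltW e0)// lerDl.
Qed.

Lemma normr_Re_le_rnorm (R : realType) (z : R[i]) : `|complex.Re z| <= rnorm z.
Proof.
rewrite -(@ler_pXn2r _ 2)// ?nnegrE ?normr_ge0 ?rnorm_ge0//.
by rewrite rnorm_sqr real_normK ?num_real// lerDl sqr_ge0.
Qed.

Lemma normr_Im_le_rnorm (R : realType) (z : R[i]) : `|complex.Im z| <= rnorm z.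
Proof.
rewrite -(@ler_pXn2r _ 2)// ?nnegrE ?normr_ge0 ?rnorm_ge0//.
by rewrite rnorm_sqr real_normK ?num_real// lerDr sqr_ge0.
Qed.

Lemma rnorm_le_ReIm (R : realType) (z : R[i]) :
  rnorm z <= `|complex.Re z| + `|complex.Im z|.
Proof.
rewrite -(@ler_pXn2r _ 2)// ?nnegrE ?addr_ge0 ?normr_ge0 ?rnorm_ge0//.
rewrite rnorm_sqr sqrrD !real_normK ?num_real// addrAC lerDl.
by rewrite mulrn_wge0// mulr_ge0.
Qed.

(** * Matrix coefficients on the completion *)

Section Completion.
Context {R : realType} {G S : topologicalType}.
Context {g : top_groupoid G} {s : top_groupoid S} (t : twist R g s).
Variables (D : set (G -> fell_bundle t)) (A : cstar_algebra R).
Variable j : (G -> fell_bundle t) -> A.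
Hypothesis D_section : forall f, D f -> is_section f.
Hypothesis D_fin : forall f, D f -> exists N, fin_fibres f N.
Hypothesis D_add : forall f h, D f -> D h -> D (sec_add f h).
Hypothesis D_scale : forall c f, D f -> D (sec_scale c f).
Hypothesis D_conv : forall f h, D f -> D h -> D (sec_conv f h).
Hypothesis jD : forall f h, D f -> D h -> j (sec_add f h) = j f + j h.
Hypothesis jZ : forall c f, D f -> j (sec_scale c f) = c *: j f.
Hypothesis jM : forall f h, D f -> D h -> j (sec_conv f h) = cs_mul (j f) (j h).
Hypothesis jN : forall f, D f -> (rnorm (j f))%:E = reduced_norm f.
Hypothesis j_dense : dense (j @` D).

Lemma approx a (e : R) : 0 < e -> exists2 f, D f & rnorm (a - j f) < e.
Proof.
move=> e0; have [||x [/= ae [f Df fx]]] := j_dense (O := [set x | rnorm (a - x) < e]).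
- by exists a; rewrite /= subrr rnorm0.
- exact: open_rnorm_ball.
by exists f; rewrite // fx.
Qed.

Lemma secmass_le f u Y : D f -> gunits g u -> finite_in (@gfibre G g u) Y ->
  secmass Y f <= rnorm (j f) ^+ 2.
Proof.
move=> Df uG fY; apply: (secmass_reduced (D_section Df) (rnorm_ge0 _) _ uG fY).
by rewrite jN.
Qed.

Lemma finite_in1 (y : G) : finite_in (@gfibre G g (gsrc g y)) [:: y].
Proof. by split => // z; rewrite inE => /eqP ->. Qed.

Lemma coef_le f y : D f -> rnorm (coef f y) <= rnorm (j f).
Proof.
move=> Df; have := secmass_le Df (gunits_src g y) (finite_in1 y).
by rewrite /secmass big_seq1 ler_pXn2r// nnegrE rnorm_ge0.
Qed.

Let sub (f h : G -> fell_bundle t) := sec_add f (sec_scale (-1) h).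

Let D_sub f h : D f -> D h -> D (sub f h).
Proof. by move=> Df Dh; apply: D_add => //; exact: D_scale. Qed.

Let j_sub f h : D f -> D h -> j (sub f h) = j f - j h.
Proof. by move=> Df Dh; rewrite jD ?jZ ?scaleN1r//; exact: D_scale. Qed.

Let coef_sub f h y : D f -> D h -> coef (sub f h) y = coef f y - coef h y.
Proof.
move=> Df Dh; rewrite coef_add ?coef_scale ?mulN1r//; try exact: D_section.
by apply: section_scale; exact: D_section.
Qed.

Lemma coef_lip f h y : D f -> D h -> rnorm (coef f y - coef h y) <= rnorm (j f - j h).
Proof. by move=> Df Dh; rewrite -coef_sub// -j_sub//; apply: coef_le; exact: D_sub. Qed.

(* The continuous extension to [A] of the evaluation at [y]; the factor 2 comes
   from extending the real and imaginary parts separately. *)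
Definition ev (y : G) (a : A) : R[i] :=
  xget 0 [set z | forall f, D f -> rnorm (z - coef f y) <= 2 * rnorm (a - j f)].

Lemma evP y a f : D f -> rnorm (ev y a - coef f y) <= 2 * rnorm (a - j f).
Proof.
rewrite /ev; case: xgetP => [z _ /= hz|nz]; first exact: hz.
exfalso.
(* Evaluation at y is 1-Lipschitz on [D], so the compatibility required by [real_interpolation] is
   the triangle inequality through a. *)
have tri f1 h : rnorm (j f1 - j h) <= rnorm (a - j f1) + rnorm (a - j h).
  rewrite [rnorm (a - j f1)]rnormB -(subrK a (j f1)) -addrA (le_trans (ler_rnormD _ _))//.
  by rewrite subrK.
have D0 : D !=set0 by have [h Dh _] := approx a ltr01; exists h.
have [|z1 h1] := @real_interpolation R _ D (fun f => complex.Re (coef f y))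
    (fun f => rnorm (a - j f)) D0.
  move=> f1 h Df1 Dh; apply: le_trans (tri f1 h); apply: le_trans (coef_lip y Df1 Dh).
  by apply: le_trans (normr_Re_le_rnorm _); rewrite raddfB ler_norm.
have [|z2 h2] := @real_interpolation R _ D (fun f => complex.Im (coef f y))
    (fun f => rnorm (a - j f)) D0.
  move=> f1 h Df1 Dh; apply: le_trans (tri f1 h); apply: le_trans (coef_lip y Df1 Dh).
  by apply: le_trans (normr_Im_le_rnorm _); rewrite raddfB ler_norm.
apply: (nz (z1 +i* z2)%C) => h Dh /=; apply: (le_trans (rnorm_le_ReIm _)).
rewrite !raddfB /=; have := h1 h Dh; have := h2 h Dh; lra.
Qed.

Lemma approx_ev a (e : R) : 0 < e -> exists f, [/\ D f, rnorm (a - j f) < e,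
  rnorm (j f) <= rnorm a + e & forall y, rnorm (ev y a - coef f y) <= 2 * e].
Proof.
move=> e0; have [f Df af] := approx a e0; exists f; split => //.
  rewrite -[j f](subrK a) addrC (le_trans (ler_rnormD _ _))// lerD2l rnormB.
  exact: ltW.
by move=> y; apply: (le_trans (evP _ _ Df)); rewrite ler_wpM2l// ltW.
Qed.

Lemma ev_j f y : D f -> ev y (j f) = coef f y.
Proof.
move=> Df; apply/eqP; rewrite -subr_eq0 -rnorm_eq0 eq_le rnorm_ge0 andbT.
by apply: (le_trans (evP y (j f) Df)); rewrite subrr rnorm0 mulr0.
Qed.

Lemma rnorm_small_eq (V : normedModType R[i]) (x y : V) (K : R) : 0 <= K ->
  (forall e : R, 0 < e -> rnorm (x - y) <= e * K) -> x = y.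
Proof.
move=> K0 h; apply/eqP; rewrite -subr_eq0 -rnorm_eq0 eq_le rnorm_ge0 andbT.
by apply: (@le_lim_linear _ _ _ K) => // e e0 _; rewrite add0r; exact: h.
Qed.

Lemma evD y a b : ev y (a + b) = ev y a + ev y b.
Proof.
apply: (@rnorm_small_eq _ _ _ 8) => // e e0.
have [f [Df af _ ef]] := approx_ev a e0; have [h [Dh ah _ eh]] := approx_ev b e0.
have := evP y (a + b) (D_add Df Dh).
rewrite coef_add ?jD//; try exact: D_section.
move=> h1.
have -> : ev y (a + b) - (ev y a + ev y b) =
    (ev y (a + b) - (coef f y + coef h y)) - (ev y a - coef f y) - (ev y b - coef h y).
  by ring.
apply: (le_trans (ler_rnormD _ _)); rewrite rnormN.
have h2 := ler_rnormD (ev y (a + b) - (coef f y + coef h y)) (- (ev y a - coef f y)).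
rewrite rnormN in h2.
have h3 : rnorm (a + b - (j f + j h)) <= rnorm (a - j f) + rnorm (b - j h).
  by rewrite opprD addrACA ler_rnormD.
have := ef y; have := eh y; lra.
Qed.

Lemma evZ y c a : ev y (c *: a) = c * ev y a.
Proof.
apply: (@rnorm_small_eq _ _ _ (4 * rnorm c)); first by rewrite mulr_ge0 ?rnorm_ge0.
move=> e e0; have [f [Df af _ ef]] := approx_ev a e0.
have := evP y (c *: a) (D_scale c Df).
rewrite coef_scale ?jZ -?scalerBr ?rnormZ//; last exact: D_section.
move=> h1.
have -> : ev y (c *: a) - c * ev y a =
    (ev y (c *: a) - c * coef f y) - c * (ev y a - coef f y) by ring.
apply: (le_trans (ler_rnormD _ _)); rewrite rnormN rnormM.
have := ef y => h2; have := rnorm_ge0 c => c0.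
have h3 : rnorm c * rnorm (ev y a - coef f y) <= rnorm c * (2 * e) by exact: ler_wpM2l.
have h4 : rnorm c * rnorm (a - j f) <= rnorm c * e by apply: ler_wpM2l => //; exact: ltW.
lra.
Qed.

Lemma ev_mass_j f Y : D f -> column_mass ev Y (j f) = secmass Y f.
Proof. by move=> Df; apply: eq_bigr => y _; rewrite ev_j. Qed.

Lemma ev_mass_le u Y a : gunits g u -> finite_in (@gfibre G g u) Y ->
  column_mass ev Y a <= rnorm a ^+ 2.
Proof.
move=> uG fY; pose M := rnorm a + 1.
have a0 := rnorm_ge0 a.
pose n : R := (size Y)%:R; have n0 : 0 <= n by rewrite ler0n.
(* The summand 2 |a| + 1 comes from (|a| + e)^2, and 4 M + 4 from (q + 2 e)^2 <= q^2 + e (4 M + 4)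
   with q <= M, once for each of the n entries. *)
apply: (@le_lim_linear _ _ _ (2 * rnorm a + 1 + n * (4 * M + 4))).
  by rewrite !addr_ge0 ?mulr_ge0 ?addr_ge0 ?mulr_ge0 ?addr_ge0.
move=> e e0 e1; have [f [Df af jf ef]] := approx_ev a e0.
have h1 : column_mass ev Y a <= secmass Y f + e * (n * (4 * M + 4)).
  have -> : e * (n * (4 * M + 4)) = \sum_(y <- Y) e * (4 * M + 4).
    by rewrite big_const_seq count_predT iter_addr_0 -mulr_natr -/n; ring.
  rewrite /column_mass /secmass -big_split/=; apply: ler_sum => y _.
  have h1 := ef y; have h2 := coef_le y Df.
  have h3 : rnorm (ev y a) <= rnorm (ev y a - coef f y) + rnorm (coef f y).
    by rewrite -{1}(subrK (coef f y) (ev y a)) ler_rnormD.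
  have := rnorm_ge0 (ev y a); have c0 := rnorm_ge0 (coef f y).
  have h4 : rnorm (coef f y) <= M by rewrite /M; lra.
  have h5 : rnorm (ev y a) <= rnorm (coef f y) + 2 * e by lra.
  move: (rnorm (ev y a)) (rnorm (coef f y)) h4 h5 c0 => p q h4 h5 c0 p0.
  have : p ^+ 2 <= (q + 2 * e) ^+ 2.
    by rewrite ler_pXn2r ?nnegrE// addr_ge0 ?mulr_ge0 ?(ltW e0).
  have : e * q <= e * M by rewrite ler_wpM2l// ltW.
  have : e * e <= e * 1 by rewrite ler_wpM2l// ltW.
  lra.
have h2 := secmass_le Df uG fY.
have h3 : rnorm (j f) ^+ 2 <= (rnorm a + e) ^+ 2.
  by rewrite ler_pXn2r ?nnegrE ?rnorm_ge0// addr_ge0 ?(ltW e0).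
have : e * e <= e * 1 by rewrite ler_wpM2l// ltW.
lra.
Qed.

Lemma ev_mass_split u Y a b : gunits g u -> finite_in (@gfibre G g u) Y ->
  column_mass ev Y a <= 2 * column_mass ev Y b + 2 * rnorm (a - b) ^+ 2.
Proof.
move=> uG fY; have := ev_mass_le (a - b) uG fY => h.
have : column_mass ev Y a <= 2 * column_mass ev Y b + 2 * column_mass ev Y (a - b).
  rewrite /column_mass !mulr_sumr -big_split/=; apply: ler_sum => z _.
  by rewrite -[in leLHS](subrKC b a) (evD _ b (a - b)) rnorm_sqrD_le.
lra.
Qed.

(** Replacing b by an element of [D] doubles its mass bound, and replacing the product doubles the
    result again; this is the factor 4. *)
Lemma ev_massM u a b (C : R) : gunits g u ->
  (forall Y, finite_in (@gfibre G g u) Y -> column_mass ev Y b <= C) ->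
  forall Y, finite_in (@gfibre G g u) Y ->
    column_mass ev Y (cs_mul a b) <= 4 * (rnorm a ^+ 2 * C).
Proof.
move=> uG bC Y fY.
have C0 : 0 <= C.
  have f0 : finite_in (@gfibre G g u) [::] by [].
  by have := bC _ f0; rewrite /column_mass big_nil.
have a0 := rnorm_ge0 a; have b0 := rnorm_ge0 b.
pose E := rnorm b + rnorm a + 1.
apply: (@le_lim_linear _ _ _ (4 * rnorm a ^+ 2 +
    4 * ((2 * rnorm a + 1) * (C + 1)) + 2 * E ^+ 2)).
  by rewrite !addr_ge0 ?mulr_ge0 ?sqr_ge0 ?addr_ge0 ?mulr_ge0.
move=> e e0 e1; have [f [Df af jf _]] := approx_ev a e0.
have [h [Dh bh _ _]] := approx_ev b e0.
have Dfh := D_conv Df Dh.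
have h1 := ev_mass_split (cs_mul a b) (j (sec_conv f h)) uG fY.
have h2 Z : finite_in (@gfibre G g u) Z -> secmass Z h <= 2 * C + 2 * e ^+ 2.
  move=> fZ; rewrite -ev_mass_j//; apply: (le_trans (ev_mass_split _ b uG fZ)).
  apply: lerD; first by rewrite ler_wpM2l// bC.
  by rewrite ler_wpM2l// ler_pXn2r ?nnegrE ?rnorm_ge0 ?(ltW e0)// rnormB ltW.
have h3 : column_mass ev Y (j (sec_conv f h)) <= rnorm (j f) ^+ 2 * (2 * C + 2 * e ^+ 2).
  rewrite ev_mass_j//.
  have -> : secmass Y (sec_conv f h) = secmass Y (lambda u f h).
    rewrite /secmass !big_seq; apply: eq_bigr => y yY.
    rewrite coef_conv_lambda; [|exact: D_section|exact: D_section|exact: D_fin].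
    by have [_ /(_ y yY) /= ->] := fY.
  apply: (secmass_lambda (D_section Df) (rnorm_ge0 _) (D_fin Df) _ uG (D_section Dh) h2 fY).
  by rewrite jN.
have h4 : rnorm (cs_mul a b - j (sec_conv f h)) <= e * E.
  have -> : cs_mul a b - j (sec_conv f h) =
      cs_mul (a - j f) b + cs_mul (j f) (b - j h).
    by rewrite jM// cs_mulBl cs_mulBr addrA subrK.
  apply: (le_trans (ler_rnormD _ _)).
  have k1 : rnorm (cs_mul (a - j f) b) <= e * rnorm b.
    by apply: (le_trans (rnorm_cs_mul _ _)); rewrite ler_wpM2r// ltW.
  have k2 : rnorm (cs_mul (j f) (b - j h)) <= (rnorm a + 1) * e.
    apply: (le_trans (rnorm_cs_mul _ _)); apply: ler_pM; rewrite ?rnorm_ge0 ?(ltW bh)//.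
    by apply: (le_trans jf); rewrite lerD2l.
  rewrite /E; lra.
have E0 : 0 <= E by rewrite !addr_ge0.
have ee : e * e <= e * 1 by rewrite ler_wpM2l// ltW.
have h5 : rnorm (cs_mul a b - j (sec_conv f h)) ^+ 2 <= e * E ^+ 2.
  apply: (@le_trans _ _ ((e * E) ^+ 2)).
    by rewrite ler_pXn2r ?nnegrE ?rnorm_ge0 ?mulr_ge0// ltW.
  rewrite exprMn ler_wpM2r ?sqr_ge0//; lra.
have h6 : rnorm (j f) ^+ 2 <= rnorm a ^+ 2 + e * (2 * rnorm a + 1).
  apply: (@le_trans _ _ ((rnorm a + e) ^+ 2)); last by lra.
  by rewrite ler_pXn2r ?nnegrE ?rnorm_ge0// addr_ge0 ?(ltW e0).
have h7 : 2 * C + 2 * e ^+ 2 <= 2 * C + 2 * e by lra.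
have h8 : rnorm (j f) ^+ 2 * (2 * C + 2 * e ^+ 2) <=
    (rnorm a ^+ 2 + e * (2 * rnorm a + 1)) * (2 * C + 2 * e).
  apply: ler_pM => //; first exact: sqr_ge0.
  by apply: addr_ge0; apply: mulr_ge0 => //; exact: sqr_ge0.
have h9 : (e * (2 * rnorm a + 1)) * (C + e) <= (e * (2 * rnorm a + 1)) * (C + 1).
  by rewrite ler_wpM2l ?lerD2l// mulr_ge0 ?addr_ge0 ?mulr_ge0 ?(ltW e0).
lra.
Qed.

(** A nonzero entry of the product sits at some w y with y in [Y] and w in the support of f over the
    range of y, which leaves at most N choices of w for each y. *)
Lemma conv_support f N h u Y : D f -> fin_fibres f N -> D h ->
  finite_in (@gfibre G g u) Y ->
  (forall y, gsrc g y = u -> y \notin Y -> coef h y = 0) ->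
  exists Z, [/\ finite_in (@gfibre G g u) Z, (size Z <= N * size Y)%N &
    forall x, gsrc g x = u -> x \notin Z -> coef (sec_conv f h) x = 0].
Proof.
move=> Df [fN _] Dh fY hY; have [uY YP] := fY.
have [W hW] := choice (fun v => fN v).
pose L := flatten [seq [seq gmul g w y | w <- W (grng g y)] | y <- Y].
exists (undup L); split.
- split; first exact: undup_uniq.
  move=> x; rewrite mem_undup => /flattenP[_ /mapP[y yY ->]] /mapP[w wW ->].
  have [[_ Wv] _ _] := hW (grng g y).
  by rewrite /gfibre /= gsrc_mul; [exact: YP|exact: Wv].
- apply: (leq_trans (size_undup _)); rewrite size_flatten /shape -map_comp.
  rewrite sumnE big_map -sum1_size mulnC big_distrl/= leq_sum// => y _.
  by rewrite size_map mul1n; case: (hW (grng g y)).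
- move=> x xu xZ; have hYx : finite_in (@gfibre G g (gsrc g x)) Y by rewrite xu.
  rewrite (coef_conv (D_section Df) (D_section Dh) hYx); last first.
    by move=> y; rewrite xu => yu /(hY _ yu); right.
  rewrite big_seq big1// => y yY; have /= yu := YP y yY.
  have [->|fy] := pselect (coef f (gmul g x (ginv g y)) = 0); first by rewrite mul0r mulr0.
  have sxy : gsrc g (gmul g x (ginv g y)) = grng g y.
    by rewrite gsrc_mul ?gsrc_inv// grng_inv xu yu.
  have [_ _ /(_ _ sxy fy) wW] := hW (grng g y).
  exfalso; move: xZ; rewrite mem_undup => /negP; apply.
  apply/flattenP; exists [seq gmul g w y | w <- W (grng g y)]; first exact: map_f.
  apply/mapP; exists (gmul g x (ginv g y)) => //.
  by rewrite gmulKV// xu yu.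
Qed.

Lemma ev_sparse_column u : gunits g u -> sparse_column (j @` D) (@gfibre G g u) ev.
Proof.
move=> uG; split.
- by split=> [y a b _|y c a _]; [exact: evD|exact: evZ].
- by move=> Y a; exact: ev_mass_le.
- by move=> a b C; exact: ev_massM.
- move=> _ [f Df <-]; have [N [fN _]] := D_fin Df.
  have [Y [fY _ hY]] := fN u; exists Y => // y yu yY.
  by rewrite ev_j//; apply: contrapT => /(hY _ yu); rewrite (negbTE yY).
- move=> _ [f Df <-]; have [N fN] := D_fin Df; exists N => Y _ [h Dh <-] fY hY.
  have [|Z [fZ sZ hZ]] := conv_support Df fN Dh fY.
    by move=> y yu yY; rewrite -ev_j//; exact: hY.
  exists Z; split => // x xu xZ; rewrite -jM// ev_j; last exact: D_conv.
  exact: hZ.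
Qed.

(** Semicontinuity of the norm under convergence of coefficients. On a finite set X, [lambda u f xi]
    involves finitely many entries because rows are finite; there the contribution of h tends to 0
    and that of f - h is at most d. Splitting squares as 2 |v|^2 + 2 |w|^2 gives sqrt 2 d, rounded
    up to 2 d. *)
Lemma small_coef_norm f (d : R) : 0 <= d -> D f ->
  (forall e : R, 0 < e -> exists h, [/\ D h, rnorm (j f - j h) <= d + e &
     forall y, rnorm (coef h y) <= e]) ->
  rnorm (j f) <= 2 * d.
Proof.
move=> d0 Df hf; have [N [fs fr]] := D_fin Df.
rewrite -lee_fin jN//; apply/(reduced_norm_le f); first by rewrite mulr_ge0.
move=> u xi uG sxi xi1 X fX; have [uX XP] := fX.
have [W hW] := choice fr.
pose Y := undup [seq z <- flatten [seq [seq gmul g (ginv g w) x | w <- W (grng g x)] | x <- X]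
  | gsrc g z == u].
have fY : finite_in (@gfibre G g u) Y.
  split; first exact: undup_uniq.
  by move=> y; rewrite mem_undup mem_filter => /andP[/eqP].
have hY x y : x \in X -> gsrc g y = u -> y \notin Y -> coef f (gmul g x (ginv g y)) = 0.
  move=> xX yu yY; apply: contrapT => fy; move: yY; apply/negP; rewrite negbK.
  have xu : gsrc g x = gsrc g y by rewrite yu; exact: XP.
  rewrite mem_undup mem_filter yu eqxx /=; apply/flattenP.
  exists [seq gmul g (ginv g w) x | w <- W (grng g x)]; first exact: map_f.
  apply/mapP; exists (gmul g x (ginv g y)).
    by apply: hW => //; rewrite grng_mul// grng_inv.
  rewrite -[X in gmul _ _ X](gmulKV xu) gmulVK//.
  by rewrite gsrc_mul ?gsrc_inv// grng_inv.
(* Truncation to [Y] leaves [lambda u f xi] unchanged on X, and makes the sums for h, whose support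
   is unrelated to [Y], run over [Y] as well. *)
pose xi' : G -> fell_bundle t := fun y => if y \in Y then xi y else Lzero t y.
have sxi' : is_section xi' by move=> y; rewrite /xi'; case: ifP => _; [|exact: section_zero].
have cxi' y : coef xi' y = if y \in Y then coef xi y else 0.
  by rewrite /coef /xi'; case: ifP => // _; exact: coef_zero.
have xi'1 Z : finite_in (@gfibre G g u) Z -> secmass Z xi' <= 1.
  move=> /xi1; apply: le_trans; apply: ler_sum => y _; rewrite cxi'.
  by case: ifP => // _; rewrite rnorm0 expr0n sqr_ge0.
have coefL k x : is_section k -> x \in X -> coef (lambda u k xi') x =
    \sum_(y <- Y) tcocycle t (gmul g x (ginv g y)) y *
      (coef k (gmul g x (ginv g y)) * coef xi' y).
  move=> sk xX; apply: coef_lambda => //; first exact: XP.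
  by move=> y _ yY; right; rewrite cxi' (negbTE yY).
have lamE x : x \in X -> coef (lambda u f xi) x = coef (lambda u f xi') x.
  move=> xX; rewrite coefL//; last exact: D_section.
  rewrite (coef_lambda (D_section Df) sxi (XP x xX) fY).
    by rewrite [LHS]big_seq [RHS]big_seq; apply: eq_bigr => y yY; rewrite cxi' yY.
  by move=> y yu yY; left; exact: hY.
have -> : secmass X (lambda u f xi) = secmass X (lambda u f xi').
  by rewrite /secmass !big_seq; apply: eq_bigr => x /lamE ->.
pose n : R := (size Y)%:R; pose m : R := (size X)%:R.
have n0 : 0 <= n by rewrite ler0n.
have m0 : 0 <= m by rewrite ler0n.
have bound (h : G -> fell_bundle t) (e : R) x : D h -> 0 < e ->
    (forall y, rnorm (coef h y) <= e) -> x \in X ->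
    rnorm (coef (lambda u h xi') x) <= n * e.
  move=> Dh e0 he xX; rewrite coefL//; last exact: D_section.
  apply: (le_trans (rnorm_sum _ _ _)).
  have -> : n * e = \sum_(y <- Y) e.
    by rewrite big_const_seq count_predT iter_addr_0 mulr_natl.
  rewrite !big_seq; apply: ler_sum => y yY; have [_ /(_ y yY) /= yu] := fY.
  have xu := XP x xX; rewrite /gfibre /= in xu.
  rewrite rnormM rnorm_tcocycle ?mul1r; last first.
    by rewrite gsrc_mul ?gsrc_inv// grng_inv xu yu.
  rewrite rnormM -[leRHS]mulr1; apply: ler_pM; rewrite ?rnorm_ge0//.
  have fy1 : finite_in (@gfibre G g u) [:: y] by split => // z; rewrite inE => /eqP ->.
  have := xi'1 _ fy1; rewrite /secmass big_seq1.
  by rewrite -[X in _ <= X](expr1n _ 2) ler_pXn2r ?nnegrE ?rnorm_ge0.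
apply: (@le_trans _ _ (2 * d ^+ 2)); last first.
  by rewrite exprMn; have := sqr_ge0 d; lra.
apply: (@le_lim_linear _ _ _ (2 * (2 * d + 1) + 2 * (m * n ^+ 2))).
  by rewrite !addr_ge0 ?mulr_ge0 ?addr_ge0 ?mulr_ge0 ?sqr_ge0.
move=> e e0 e1; have [h [Dh fh he]] := hf e e0.
have Dk := D_sub Df Dh.
have h1 : secmass X (lambda u (sub f h) xi') <= (d + e) ^+ 2.
  apply: (@le_trans _ _ (rnorm (j (sub f h)) ^+ 2)).
    have nk : (reduced_norm (sub f h) <= (rnorm (j (sub f h)))%:E)%E by rewrite jN.
    exact: (reduced_norm_le (sub f h) (rnorm_ge0 _)).1 nk u xi' uG sxi' xi'1 X fX.
  by rewrite ler_pXn2r ?nnegrE ?rnorm_ge0 ?addr_ge0 ?(ltW e0)// j_sub.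
have h2 : secmass X (lambda u h xi') <= m * (n * e) ^+ 2.
  have -> : m * (n * e) ^+ 2 = \sum_(x <- X) (n * e) ^+ 2.
    by rewrite big_const_seq count_predT iter_addr_0 mulr_natl.
  rewrite /secmass !big_seq; apply: ler_sum => x xX.
  by rewrite ler_pXn2r ?nnegrE ?rnorm_ge0 ?mulr_ge0 ?(ltW e0)//; exact: bound.
have h3 : secmass X (lambda u f xi') <=
    2 * secmass X (lambda u (sub f h) xi') + 2 * secmass X (lambda u h xi').
  rewrite /secmass !mulr_sumr -big_split/= !big_seq; apply: ler_sum => x xX.
  apply: le_trans (rnorm_sqrD_le _ _).
  rewrite !coefL//; try exact: D_section.
  rewrite -big_split/= le_eqVlt; apply/orP; left; apply/eqP; congr (rnorm _ ^+ 2).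
  by apply: eq_bigr => y _; rewrite coef_sub//; ring.
have ee : e * e <= e * 1 by rewrite ler_wpM2l// ltW.
have h4 : (m * n ^+ 2) * (e * e) <= (m * n ^+ 2) * e.
  by apply: ler_wpM2l; [rewrite mulr_ge0 ?sqr_ge0|lra].
lra.
Qed.

(** If all coefficients of a vanish, good approximants of a have uniformly small coefficients.
    [small_coef_norm] then bounds any approximant within e of a by 2 e, hence a by 3 e. *)
Lemma ev_separates a : a != 0 -> exists y, ev y a != 0.
Proof.
move=> a0; apply: contrapT => h; move: a0; apply/negP; rewrite negbK; apply/eqP.
have ev0 y : ev y a = 0 by apply: contrapT => /eqP ya; apply: h; exists y.
apply: (@rnorm_small_eq _ _ _ 3) => // e e0; rewrite subr0.
have [f [Df af _ _]] := approx_ev a e0.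
have : rnorm (j f) <= 2 * e.
  apply: small_coef_norm => // [|d d0]; first exact: ltW.
  have d2 : 0 < d / 2 by rewrite divr_gt0.
  have [k [Dk ak _ ek]] := approx_ev a d2; exists k; split => //.
    rewrite -(subrK a (j f)) -addrA (le_trans (ler_rnormD _ _))//.
    by rewrite rnormB; lra.
  by move=> y; have := ek y; rewrite ev0 sub0r rnormN; lra.
have := ler_rnormD (a - j f) (j f); rewrite subrK; lra.
Qed.

Lemma completion_star_hom_zero (H : hilbert_space R) :
  infinite_dimensional H -> every_star_hom_zero (BH H) A.
Proof.
move=> infH; apply: (star_hom_BH_zero (D := j @` D)) => //.
  by move=> x e /(approx x)[f Df xf]; exists (j f) => //; exists f.
move=> a /ev_separates[y ya]; exists (@gfibre G g (gsrc g y)), ev; split.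
  by apply: ev_sparse_column; exact: gunits_src.
by exists y.
Qed.

End Completion.

(** * Limits and finite covers *)

Section ComplexLimits.
Context {R : realType}.

Lemma cvg_rnormP (V : normedModType R[i]) (T : Type) (F : set_system T) {FF : Filter F}
    (u : T -> V) (l : V) :
  u @ F --> l <-> forall e : R, 0 < e -> \forall x \near F, rnorm (l - u x) < e.
Proof.
split=> [/cvgrPdist_lt h e e0|h].
  have e0C : 0 < e%:C%C :> R[i] by rewrite ltcR.
  by apply: filterS (h _ e0C) => x /=; rewrite rnormE ltcR.
apply/cvgrPdist_lt => -[e e']; rewrite ltcE/= => /andP[/eqP -> e0].
by apply: filterS (h _ e0) => x /=; rewrite rnormE -ltcR.
Qed.

Lemma complex_cvgD (T : Type) (F : set_system T) {FF : Filter F} (u v : T -> R[i])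
    (a b : R[i]) :
  u @ F --> a -> v @ F --> b -> (fun x => u x + v x) @ F --> a + b.
Proof.
move=> /cvg_rnormP ua /cvg_rnormP vb; apply/cvg_rnormP => e e0.
have e2 : 0 < e / 2 by rewrite divr_gt0.
apply: filterS2 (ua _ e2) (vb _ e2) => x ux vx.
rewrite opprD addrACA; apply: le_lt_trans (ler_rnormD _ _) _; lra.
Qed.

Lemma complex_cvgM (T : Type) (F : set_system T) {FF : Filter F} (u v : T -> R[i])
    (a b : R[i]) :
  u @ F --> a -> v @ F --> b -> (fun x => u x * v x) @ F --> a * b.
Proof.
move=> /cvg_rnormP ua /cvg_rnormP vb; apply/cvg_rnormP => e e0.
pose K := rnorm a + rnorm b + 1.
have a0 := rnorm_ge0 a; have b0 := rnorm_ge0 b.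
have K0 : 0 < K by rewrite ltr_wpDl// addr_ge0.
pose d := Num.min 1 (e / K).
have d0 : 0 < d by rewrite lt_min ltr01 divr_gt0.
apply: filterS2 (ua _ d0) (vb _ d0) => x ux vx.
have d1 : d <= 1 by rewrite ge_min lexx.
have dK : d * K <= e by rewrite -ler_pdivlMr// ge_min lexx orbT.
have -> : a * b - u x * v x = (a - u x) * b + u x * (b - v x) by ring.
have hu : rnorm (u x) <= rnorm a + rnorm (a - u x).
  have -> : u x = a - (a - u x) by ring.
  by apply: (le_trans (ler_rnormD _ _)); rewrite rnormN subKr.
apply: le_lt_trans (ler_rnormD _ _) _; rewrite !rnormM.
have := rnorm_ge0 (b - v x); have := rnorm_ge0 (a - u x); have := rnorm_ge0 (u x).
move: (rnorm (u x)) (rnorm (a - u x)) (rnorm (b - v x)) hu ux vx => p q r hu ux vx p0 q0 r0.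
have h1 : q * rnorm b <= d * rnorm b by rewrite ler_wpM2r// ltW.
have p1 : p < rnorm a + 1 by lra.
have h2 : p * r <= (rnorm a + 1) * r by rewrite ler_wpM2r// ltW.
have h3 : (rnorm a + 1) * r < (rnorm a + 1) * d by rewrite ltr_pM2l// ltr_wpDl.
rewrite /K in dK; lra.
Qed.

End ComplexLimits.

Lemma within_continuous_cvg (X Y : topologicalType) (T : Type) (B : set X) (f : X -> Y)
    (F : set_system T) {FF : Filter F} (h : T -> X) (x : X) :
  {within B, continuous f} -> B x -> (\forall a \near F, B (h a)) ->
  h @ F --> x -> f (h a) @[a --> F] --> f x.
Proof.
move=> /subspace_continuousP fc Bx FB hx; apply: cvg_comp (fc x Bx) => U /= wU.
have : F [set a | B (h a) -> U (h a)] by exact: (hx _ wU).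
by move=> FU; apply: filterS2 FU FB => a; apply.
Qed.

Lemma compact_open_cover (T : topologicalType) (K : set T) (P : set T -> Prop) :
  compact K -> (forall x, K x -> exists U, [/\ open U, U x & P U]) ->
  exists l : seq (set T), (forall U, List.In U l -> open U /\ P U) /\
    forall x, K x -> exists2 U, List.In U l & U x.
Proof.
move=> cK hP.
have hP' x : exists U, K x -> [/\ open U, U x & P U].
  by have [/hP[U hU]|nK] := pselect (K x); [exists U|exists setT].
have [U hU] := choice hP'.
have [[x0 _]|K0] := pselect (K !=set0); last first.
  by exists [::]; split => // x Kx; case: K0; exists x.
(* The cover form of compactness is stated for pointed spaces; a point of the nonempty [K] supplies
   that structure. *)
pose Tp : ptopologicalType := HB.pack (Topological.sort T) (isPointed.Build T x0).
have : cover_compact (K : set Tp) by rewrite -compact_cover.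
move=> /(_ T K U)[x Kx|x Kx|D DK hD].
- by case: (hU x Kx).
- by exists x => //; case: (hU x Kx).
exists (map U (enum_fset D)); split.
  move=> V /List.in_map_iff[x [<- xD]].
  have Kx : K x.
    apply: set_mem; apply: DK.
    suff : x \in enum_fset D by [].
    elim: (enum_fset D) xD => //= z s IH [->|/IH xs]; rewrite inE ?eqxx//.
    by rewrite xs orbT.
  by case: (hU x Kx).
move=> x /hD[y yD Uy]; exists (U y) => //.
apply/List.in_map_iff; exists y; split => //.
have : y \in enum_fset D by [].
elim: (enum_fset D) => //= z s IH; rewrite inE => /predU1P[->|/IH]; first by left.
by right.
Qed.

Lemma open_list_bigcup (T : topologicalType) (l : seq (set T)) : (forall U, List.In U l -> open U) ->
  open [set x | exists2 U, List.In U l & U x].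
Proof.
move=> hl; rewrite openE => x [W Wl Wx].
apply: (@filterS _ (nbhs x) _ W); first by move=> y Wy; exists W.
by apply: open_nbhs_nbhs; split => //; exact: hl.
Qed.

(** * Open bisections *)

Section Bisections.
Context {G : topologicalType} (g : top_groupoid G).

Lemma gmul_cvg (T : Type) (F : set_system T) {FF : Filter F} (a b : T -> G) x y :
  a @ F --> x -> b @ F --> y -> gsrc g x = grng g y ->
  (\forall c \near F, gsrc g (a c) = grng g (b c)) ->
  gmul g (a c) (b c) @[c --> F] --> gmul g x y.
Proof.
move=> ax by_ xy ab.
have h : (fun c => (a c, b c)) @ F --> (x, y) by exact: cvg_pair.
exact: (@within_continuous_cvg _ _ _ _ (fun x : G * G => gmul g x.1 x.2) F FF
  (fun c => (a c, b c)) (x, y) (@gmul_continuous G g) xy ab h).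
Qed.

(** Continuity of the source follows from that of the operations, as s(x) = x^-1 x. *)
Lemma gsrc_continuous : continuous (gsrc g).
Proof.
move=> x; rewrite /continuous_at.
under eq_cvg do rewrite -gmulVx.
rewrite -gmulVx; apply: gmul_cvg.
- exact: ginv_continuous.
- exact: cvg_id.
- exact: gsrc_inv.
- by near=> c; exact: gsrc_inv.
Unshelve. all: by end_near.
Qed.

(** The saturation s^-1(s(W)): its openness in G says that s(W) is open, without passing to the
    subspace of units. *)
Definition src_sat (W : set G) : set G := [set x | exists2 w, W w & gsrc g w = gsrc g x].

Definition sbisection (V : set G) : Prop :=
  [/\ open V, set_inj V (gsrc g) & forall W, open W -> W `<=` V -> open (src_sat W)].

Lemma sbisection_sub V W : sbisection V -> open W -> W `<=` V -> sbisection W.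
Proof.
move=> [oV iV hV] oW WV; split => //.
  by move=> x y /set_mem/WV/mem_set xV /set_mem/WV/mem_set yV; exact: iV.
by move=> W' oW' W'W; apply: hV => // x /W'W/WV.
Qed.

Lemma gsrc0_continuous : continuous (gsrc0 g).
Proof.
apply: continuous_comp_initial.
exact: gsrc_continuous.
Qed.

Lemma etale_sbisection : etale g -> forall x, exists V, [/\ open V, V x & sbisection V].
Proof.
move=> eg x; have [U [oU Ux cU iU hU]] := eg x; exists U; split => //; split => //.
  move=> y z yU zU yz; apply: iU => //.
  exact: val_inj.
move=> W oW WU; have -> : src_sat W = gsrc0 g @^-1` (gsrc0 g @` W).
  apply/seteqP; split => y [w Ww e]; exists w => //.
    exact: val_inj.
  exact: (congr1 (fun z : set_type (gunits g) => val z) e).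
apply: open_comp; last exact: hU.
by move=> y _; exact: gsrc0_continuous.
Qed.

(** The source map followed by the inverse of its restriction to V, with default x outside
    [src_sat V]. *)
Definition src_lift (V : set G) (x : G) : G := xget x [set v | V v /\ gsrc g v = gsrc g x].

Lemma src_liftP V x : src_sat V x -> V (src_lift V x) /\ gsrc g (src_lift V x) = gsrc g x.
Proof.
by move=> [v Vv vx]; rewrite /src_lift; case: xgetP => [w _ //|/(_ v)[]].
Qed.

Lemma src_lift_eq V x y : sbisection V -> V y -> gsrc g y = gsrc g x -> src_lift V x = y.
Proof.
move=> [_ iV _] Vy yx; have [|Vl e] := @src_liftP V x; first by exists y.
by apply: iV; [exact: mem_set|exact: mem_set|rewrite e].
Qed.

Lemma src_lift_continuous V x : sbisection V -> src_sat V x ->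
  {for x, continuous (src_lift V)}.
Proof.
move=> bV xV U /= nU; have [oV iV hV] := bV; have [Vl el] := src_liftP xV.
pose W := U^° `&` V.
have oW : open W by apply: openI => //; exact: open_interior.
have nW : nbhs x (src_sat W).
  apply: open_nbhs_nbhs; split; first by apply: hV => // y [].
  by exists (src_lift V x) => //; split => //; exact: nU.
apply: filterS nW => y [w [Uw Vw] wy].
by rewrite /= (src_lift_eq bV Vw wy); exact: interior_subset.
Qed.

Lemma src_sat_open V : sbisection V -> open (src_sat V).
Proof. by move=> [oV _ hV]; exact: hV. Qed.

Hypothesis g_etale : etale g.

(** A set on which the source is injective meets each source fibre at most once, so N is the number
    of such open sets needed to cover [K]. *)
Lemma compact_source_fibres (K : set G) : compact K ->
  exists N, forall u, exists Y, [/\ finite_in (@gfibre G g u) Y, (size Y <= N)%N &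
     forall y, K y -> gsrc g y = u -> y \in Y].
Proof.
move=> cK; have [l [lB lK]] := compact_open_cover cK (fun x _ => etale_sbisection g_etale x).
exists (size l) => u.
have [Y [sY YP YK]] : exists Y : seq G, [/\ (size Y <= size l)%N,
   forall y, y \in Y -> gsrc g y = u &
   forall y U, List.In U l -> U y -> gsrc g y = u -> y \in Y].
  elim: l lB {lK} => [|U l IH] lB; first by exists [::]; split => // y; rewrite in_nil.
  have [|Y [sY YP YK]] := IH; first by move=> V Vl; apply: lB; right.
  have [oU [_ iU _]] : open U /\ sbisection U by apply: lB; left.
  have [[y0 [Uy0 y0u]]|nU] := pselect (exists y, U y /\ gsrc g y = u).
    exists (y0 :: Y); split => //.
      by move=> y; rewrite inE => /predU1P[->//|/YP].
    move=> y V [<-|Vl] Vy yu; rewrite inE; last by rewrite (YK y V Vl Vy yu) orbT.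
    by apply/orP; left; apply/eqP; apply: iU; [exact: mem_set|exact: mem_set|rewrite yu].
  exists Y; split => //; first exact: leq_trans sY _.
  by move=> y V [<-|Vl] Vy yu; [case: nU; exists y|exact: YK Vl Vy yu].
exists (undup Y); split.
- by split; [exact: undup_uniq|move=> y; rewrite mem_undup; exact: YP].
- exact: leq_trans (size_undup _) sY.
- by move=> y /lK[U Ul Uy] yu; rewrite mem_undup; exact: YK Ul Uy yu.
Qed.

Lemma compact_range_fibres (K : set G) : compact K ->
  forall u, exists Y : seq G, forall y, K y -> grng g y = u -> y \in Y.
Proof.
move=> cK u; have cK' : compact (ginv g @` K).
  by apply: continuous_compact => //; apply: continuous_subspaceT; exact: ginv_continuous.
have [N /(_ u)[Y [_ _ YK]]] := compact_source_fibres cK'.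
exists (map (ginv g) Y) => y Ky yu; rewrite -(ginvK g y); apply: map_f.
by apply: YK; [exists y | rewrite gsrc_inv].
Qed.

End Bisections.

Section Products.
Context {G : topologicalType} (g : top_groupoid G).
Hypotheses (g_etale : etale g) (G0_hausdorff : hausdorff_space (set_type (gunits g))).

Lemma src_sat_open_all W : open W -> open (src_sat g W).
Proof.
move=> oW; rewrite openE => x [w Ww wx].
have [V [oV Vw [_ _ hV]]] := etale_sbisection g_etale w.
apply: (@filterS _ (nbhs x) _ (src_sat g (V `&` W))).
  by move=> y [v [_ Wv] vy]; exists v.
apply: open_nbhs_nbhs; split; last by exists w.
by apply: hV; [exact: openI|move=> y []].
Qed.

Lemma sbisectionE V : sbisection g V <-> open V /\ set_inj V (gsrc g).
Proof.
split=> [[]//|[oV iV]]; split => // W oW _.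
exact: src_sat_open_all.
Qed.

(** Two continuous maps into the Hausdorff unit space agree on a closed set; the range of y is the
    source of y^-1. This makes products of compact sets compact although G need not be Hausdorff. *)
Lemma composable_closed : closed [set x : G * G | gsrc g x.1 = grng g x.2].
Proof.
rewrite -openC openE => -[a b] /= ab.
move: G0_hausdorff; rewrite open_hausdorff => hh.
have ab' : gsrc0 g a != gsrc0 g (ginv g b).
  by apply/eqP => /(congr1 (fun z : set_type (gunits g) => val z)); rewrite /= gsrc_inv.
have [W12] := hh _ _ ab'; case: W12 => W1 W2 /= [/set_mem aO /set_mem bO] [oO1 oO2 /eqP O12].
have c1 : {for (a, b), continuous (fun x : G * G => gsrc0 g x.1)}.
  apply: (@continuous_comp _ _ _ fst (gsrc0 g)); first exact: cvg_fst.
  exact: gsrc0_continuous.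
have c2 : {for (a, b), continuous (fun x : G * G => gsrc0 g (ginv g x.2))}.
  apply: (@continuous_comp _ _ _ (ginv g \o snd) (gsrc0 g)); last exact: gsrc0_continuous.
  by apply: continuous_comp; [exact: cvg_snd|exact: ginv_continuous].
have n1 : nbhs (a, b) [set x | W1 (gsrc0 g x.1)] by exact: c1 _ (open_nbhs_nbhs (conj oO1 aO)).
have n2 : nbhs (a, b) [set x | W2 (gsrc0 g (ginv g x.2))]
  by exact: c2 _ (open_nbhs_nbhs (conj oO2 bO)).
change (nbhs (a, b) (~` [set x : G * G | gsrc g x.1 = grng g x.2])).
have n3 := @filterI _ _ (nbhs_filter (a, b)) _ _ n1 n2; apply: (@filterS _ (nbhs (a, b)) (nbhs_filter (a, b)) _ _ _ n3) => -[x y] /= [x1 y2] xy.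
have e : gsrc0 g x = gsrc0 g (ginv g y) by apply: eq_exist; rewrite gsrc_inv.
have : (W1 `&` W2) (gsrc0 g x) by split => //; rewrite e.
by rewrite O12.
Qed.

Definition gset_mul (K K' : set G) : set G :=
  [set gmul g x.1 x.2 | x in (K `*` K') `&` [set x | gsrc g x.1 = grng g x.2]].

Lemma compact_gset_mul K K' : compact K -> compact K' -> compact (gset_mul K K').
Proof.
move=> cK cK'; apply: continuous_compact; last first.
  exact: compact_closedI (compact_setX cK cK') composable_closed.
apply: continuous_subspaceW (@gmul_continuous G g).
by move=> x [].
Qed.

Section ProductOfBisections.
Variables (V V' : set G).
Hypotheses (bV : sbisection g V) (bV' : sbisection g V').

(** If x = a b with a in V and b in V', then s(b) = s(x) determines b within V', and a = x b^-1.
    Both factors are thus continuous functions of x. *)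
Definition right_factor (x : G) : G := src_lift g V' x.
Definition left_factor (x : G) : G := gmul g x (ginv g (right_factor x)).
(** The product set V V', described so that its openness follows from continuity of the factors. *)
Definition bis_mul : set G := src_sat g V' `&` [set x | V (left_factor x)].

Lemma right_factorP x : src_sat g V' x -> V' (right_factor x) /\ gsrc g (right_factor x) = gsrc g x.
Proof. exact: src_liftP. Qed.

Lemma factors_composable x : src_sat g V' x ->
  gsrc g (left_factor x) = grng g (right_factor x).
Proof.
move=> /right_factorP[_ e]; rewrite gsrc_mul ?gsrc_inv//.
by rewrite grng_inv e.
Qed.

Lemma left_right_factor x : src_sat g V' x ->
  gmul g (left_factor x) (right_factor x) = x.
Proof. by move=> /right_factorP[_ e]; rewrite gmulKV// e. Qed.

Lemma factors_mul a b : V' b -> gsrc g a = grng g b ->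
  [/\ src_sat g V' (gmul g a b), right_factor (gmul g a b) = b & left_factor (gmul g a b) = a].
Proof.
move=> bV1 ab; have sb : gsrc g b = gsrc g (gmul g a b) by rewrite gsrc_mul.
have rb : right_factor (gmul g a b) = b by exact: src_lift_eq.
split => //; first by exists b.
by rewrite /left_factor rb gmulK.
Qed.

Lemma right_factor_continuous x : src_sat g V' x -> {for x, continuous right_factor}.
Proof. exact: src_lift_continuous. Qed.

Lemma left_factor_continuous x : src_sat g V' x -> {for x, continuous left_factor}.
Proof.
move=> xV; rewrite /left_factor; apply: gmul_cvg.
- exact: cvg_id.
- by apply: cvg_comp (right_factor_continuous xV) _; exact: ginv_continuous.
- by rewrite grng_inv; have [_ ->] := right_factorP xV.
- have : nbhs x (src_sat g V').
    by apply: open_nbhs_nbhs; split => //; exact: src_sat_open.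
  by apply: filterS => y /right_factorP[_ e]; rewrite grng_inv e.
Qed.

Lemma bis_mul_bisection : sbisection g bis_mul.
Proof.
have [oV iV _] := bV.
apply/sbisectionE; split.
  rewrite openE => x [xV' xV].
  have n1 : nbhs x (src_sat g V').
    by apply: open_nbhs_nbhs; split => //; exact: src_sat_open.
  have n2 := left_factor_continuous xV' (open_nbhs_nbhs (conj oV xV)).
  exact: filterI n1 n2.
move=> x y /set_mem[xV' xV] /set_mem[yV' yV] xy.
have rxy : right_factor x = right_factor y.
  have [_ iV' _] := bV'; have [Vx ex] := right_factorP xV'; have [Vy ey] := right_factorP yV'.
  by apply: iV'; [exact: mem_set|exact: mem_set|rewrite ex ey].
have lxy : left_factor x = left_factor y.
  apply: iV; [exact: mem_set|exact: mem_set|].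
  by rewrite !factors_composable// rxy.
by rewrite -(left_right_factor xV') -(left_right_factor yV') lxy rxy.
Qed.

End ProductOfBisections.
End Products.

(** * Sections supported on open bisections *)

Section ElementarySections.
Context {R : realType} {G S : topologicalType}.
Context {g : top_groupoid G} {s : top_groupoid S} (t : twist R g s).
Local Notation p := (tproj t).
Local Notation act := (tact t).
Local Notation cls := (Lclass t).
Implicit Types (f h : G -> fell_bundle t) (sg : G -> S) (b : G -> R[i]).

Lemma fell_open (W : set (fell_bundle t)) :
  open [set x : S * R[i] | W (cls x.1 x.2)] -> open W.
Proof.
move=> oW; rewrite /open /= /quotient_open.
rewrite (_ : _ @^-1` W = [set x : S * R[i] | W (cls x.1 x.2)])//.
by apply/seteqP; split => -[x a].
Qed.

Lemma open_fell (W : set (fell_bundle t)) :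
  open W -> open [set x : S * R[i] | W (cls x.1 x.2)].
Proof.
rewrite /open /= /quotient_open => oW.
rewrite (_ : [set x : S * R[i] | W (cls x.1 x.2)] = \pi_({eq_quot (fell_equiv t)})%qT @^-1` W)//.
by apply/seteqP; split => -[x a].
Qed.

Definition lifting sg : Prop := forall x, p (sg x) = x.

Definition cont_on (Y : topologicalType) (U : set G) (f : G -> Y) : Prop :=
  forall x, U x -> {for x, continuous f}.

(* [c] is the coordinate of the trivialization determined by [sg]. *)
Definition local_lift (U : set G) sg (c : S -> R[i]) : Prop :=
  [/\ lifting sg, cont_on U sg,
      forall y, U (p y) -> {for y, continuous c} &
      forall y, U (p y) -> circle (c y) /\ y = act (c y) (sg (p y))].

Lemma local_lift_sub U V sg c : V `<=` U -> local_lift U sg c -> local_lift V sg c.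
Proof.
by move=> VU [h1 h2 h3 h4]; split => // [x /VU|y /VU|y /VU]; [exact: h2|exact: h3|exact: h4].
Qed.

Lemma local_lift_exists x : exists U, [/\ open U, U x & exists sg c, local_lift U sg c].
Proof.
have [U [f [c [[oU Ux] fc cc [fcK cfK] fact]]]] := tlocally_trivial t x.
exists U; split => //.
(* Outside U an arbitrary lift is used, which makes [sg] a lifting on all of G. *)
pose sg a := if `[< U a >] then f a 1 else tlift t a.
have sgE a : U a -> sg a = f a 1 by move=> Ua; rewrite /sg asboolT.
exists sg, c; split.
- move=> a; rewrite /sg; case: asboolP => [Ua|_]; last exact: tliftK.
  by have [-> _] := fcK a 1 Ua circle1.
- move=> a Ua; change (sg @ a --> sg a); rewrite (sgE a Ua).
  have nU : nbhs a U by apply: open_nbhs_nbhs.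
  apply: cvg_trans (_ : f a' 1 @[a' --> a] --> f a 1).
    apply: near_eq_cvg; apply: filterS nU => a' /sgE ->//.
  apply: (@within_continuous_cvg _ _ _ _ (fun a : G * R[i] => f a.1 a.2) _ _
    (fun a' => (a', 1)) (a, 1) fc).
  + by split => //; exact: circle1.
  + by apply: filterS nU => a' Ua'; split => //; exact: circle1.
  + exact: (cvg_pair cvg_id (cvg_cst _)).
- move=> y Uy; have oV : open (p @^-1` U).
    by apply: open_comp => // z _; exact: tproj_continuous.
  by move: cc; rewrite continuous_open_subspace// => /(_ y); apply; exact: mem_set.
- move=> y Uy; have [cy e] := cfK y Uy; split => //.
  by rewrite sgE// /tact -fact ?mulr1//; exact: circle1.
Qed.

Section Coordinates.
Variables (U : set G) (sg : G -> S) (c : S -> R[i]).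
Hypotheses (oU : open U) (Ll : local_lift U sg c).

Lemma Lcoord_lift y a : U (p y) -> Lcoord (sg (p y)) (cls y a) = c y * a.
Proof.
move=> Uy; have [_ _ _ /(_ y Uy)[cy e]] := Ll.
by rewrite [in cls y a]e Lclass_act// Lcoord_class.
Qed.

Definition lcoord (l : fell_bundle t) : R[i] := Lcoord (sg (Lbase l)) l.

(** Openness for the quotient topology is tested on S * C, where the class of (y, a) has coordinate
    c y * a. *)
Lemma lcoord_open (W : set R[i]) : open W ->
  open [set l : fell_bundle t | U (Lbase l) /\ W (lcoord l)].
Proof.
move=> oW; apply: fell_open.
have -> : [set x : S * R[i] | [set l : fell_bundle t | U (Lbase l) /\ W (lcoord l)] (cls x.1 x.2)] =
    [set x : S * R[i] | U (p x.1) /\ W (c x.1 * x.2)].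
  apply/seteqP; split => -[y a] /=; rewrite /lcoord Lbase_class => -[Uy];
    by rewrite Lcoord_lift.
rewrite openE => -[y a] /= [Uy Wy].
have h1 : {for (y, a), continuous (fun x : S * R[i] => p x.1)}.
  by apply: (@continuous_comp _ _ _ fst p); [exact: cvg_fst|exact: tproj_continuous].
have hc : {for (y, a), continuous (fun x : S * R[i] => c x.1)}.
  have [_ _ /(_ y Uy) cy _] := Ll.
  by apply: (@continuous_comp _ _ _ fst c); [exact: cvg_fst|exact: cy].
have h2 : {for (y, a), continuous (fun x : S * R[i] => c x.1 * x.2)}.
  exact: (complex_cvgM hc cvg_snd).
have n1 : nbhs (y, a) [set x : S * R[i] | U (p x.1)].
  by apply: h1; apply: open_nbhs_nbhs.
have n2 : nbhs (y, a) [set x : S * R[i] | W (c x.1 * x.2)].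
  by apply: h2; apply: open_nbhs_nbhs.
exact: (@filterI _ _ (nbhs_filter (y, a)) _ _ n1 n2).
Qed.

Lemma lcoord_cvg (T : Type) (F : set_system T) {FF : Filter F} (u : T -> fell_bundle t) l :
  u @ F --> l -> U (Lbase l) -> (fun x => lcoord (u x)) @ F --> lcoord l.
Proof.
move=> ul Ul W /= nW.
have nl : nbhs l [set m : fell_bundle t | U (Lbase m) /\ W° (lcoord m)].
  apply: open_nbhs_nbhs; split; first by apply: lcoord_open; exact: open_interior.
  by split.
have n : F [set x | U (Lbase (u x)) /\ W° (lcoord (u x))] by exact: ul _ nl.
move: n; apply: (@filterS _ F FF) => x; case=> _ /=; exact: interior_subset.
Qed.

End Coordinates.

Lemma cls_cvg (T : Type) (F : set_system T) {FF : Filter F} (u : T -> S) (v : T -> R[i]) y a :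
  u @ F --> y -> v @ F --> a -> (fun x => cls (u x) (v x)) @ F --> cls y a.
Proof.
move=> uy va W /= nW.
pose W' := W°; have oW' : open W' by exact: open_interior.
have Wc : W' (cls y a) by exact: nW.
have h : (fun x => (u x, v x)) @ F --> (y, a) by exact: (cvg_pair uy va).
have n : nbhs (y, a) [set x : S * R[i] | W' (cls x.1 x.2)].
  by apply: open_nbhs_nbhs; split => //; exact: open_fell.
have n' : F [set x | W' (cls (u x) (v x))] by exact: h _ n.
by move: n'; apply: (@filterS _ F FF) => x /=; exact: interior_subset.
Qed.

Lemma Lzero_lift sg x : lifting sg -> cls (sg x) 0 = Lzero t x.
Proof. by move=> lsg; rewrite Lclass0 lsg. Qed.

Lemma Lzero_continuous : continuous (Lzero t).
Proof.
move=> x; have [U [oU Ux [sg [c [lsg csg _ _]]]]] := local_lift_exists x.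
change (Lzero t @ x --> Lzero t x).
have -> : Lzero t = (fun x => cls (sg x) 0) by apply/funext => y; rewrite Lzero_lift.
by apply: cls_cvg; [exact: csg|exact: cvg_cst].
Qed.

(* [reg] is the regularity required of the coefficient function: continuity for
   Cc, Borel measurability for Bc. *)
Definition elementary (reg : set G -> (G -> R[i]) -> Prop) f : Prop :=
  exists V sg b, [/\ sbisection g V, lifting sg, cont_on V sg, reg V b &
    f = fun x => cls (sg x) (b x)].

Inductive sec_span (P : set (G -> fell_bundle t)) : set (G -> fell_bundle t) :=
| sec_span0 : sec_span P (Lzero t)
| sec_spanD f h : P f -> sec_span P h -> sec_span P (sec_add f h).

Lemma elementary_section reg f : elementary reg f -> is_section f.
Proof. by case=> V [sg [b [_ lsg _ _ ->]]] x; rewrite Lbase_class. Qed.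

Lemma elementary_scale (reg : set G -> (G -> R[i]) -> Prop) a f :
  (forall V b, reg V b -> reg V (fun x => a * b x)) ->
  elementary reg f -> elementary reg (sec_scale a f).
Proof.
move=> hreg [V [sg [b [bV lsg csg rb ->]]]].
exists V, sg, (fun x => a * b x); split => //; first exact: hreg.
by apply/funext => x; rewrite /sec_scale Lscale_class.
Qed.

Hypotheses (g_etale : etale g).

Lemma compact_support_fin_fibres f (K : set G) : compact K ->
  (forall x, ~ K x -> coef f x = 0) -> exists N, fin_fibres f N.
Proof.
move=> cK fK; have [N hN] := compact_source_fibres g_etale cK.
have hK y : coef f y <> 0 -> K y by move=> fy; apply: contrapT => /fK.
exists N; split=> u.
  have [Y [fY sY YK]] := hN u; exists Y; split => // y yu /hK Ky; exact: YK.
have [Y YK] := compact_range_fibres g_etale cK u.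
by exists Y => y yu /hK Ky; exact: YK.
Qed.

(** At most one factorization of x contributes, so over V V' the convolution is the product of the
    values at the two factors, with the product of their lifts as lift. What remains, [regM],
    concerns scalar functions and differs between the continuous and the Borel case. *)
Lemma elementary_conv (reg : set G -> (G -> R[i]) -> Prop) f h :
  (forall V b, reg V b -> forall x, ~ V x -> b x = 0) ->
  (forall V V' b b', sbisection g V -> sbisection g V' -> reg V b -> reg V' b' ->
     reg (bis_mul g V V') (fun x => if `[< bis_mul g V V' x >] then
       b (left_factor g V' x) * b' (right_factor g V' x) else 0)) ->
  elementary reg f -> elementary reg h -> elementary reg (sec_conv f h).
Proof.
move=> reg0 regM ef eh.
have sf := elementary_section ef; have sh := elementary_section eh.
case: ef => V [sg [b [bV lsg csg rb fE]]]; case: eh => V' [sg' [b' [bV' lsg' csg' rb' hE]]].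
pose W := bis_mul g V V'; pose l := left_factor g V'; pose r := right_factor g V'.
have lr x : src_sat g V' x -> gsrc g (l x) = grng g (r x) by exact: factors_composable.
have lrE x : src_sat g V' x -> gmul g (l x) (r x) = x by exact: left_right_factor.
have comp x : src_sat g V' x -> gsrc s (sg (l x)) = grng s (sg' (r x)).
  by move=> /lr e; apply/(composable_tproj t); rewrite lsg lsg'.
pose sg2 x := if `[< W x >] then gmul s (sg (l x)) (sg' (r x)) else tlift t x.
have lsg2 : lifting sg2.
  move=> x; rewrite /sg2; case: asboolP => [[Vx _]|_]; last exact: tliftK.
  by rewrite tprojM ?comp// lsg lsg' lrE.
have bW : sbisection g W by exact: bis_mul_bisection.
have [oW _ _] := bW.
exists W, sg2, (fun x => if `[< W x >] then b (l x) * b' (r x) else 0); split => //.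
- move=> x Wx; change (sg2 @ x --> sg2 x).
  have -> : sg2 x = gmul s (sg (l x)) (sg' (r x)) by rewrite /sg2 asboolT.
  have nW : nbhs x W by apply: open_nbhs_nbhs.
  apply: cvg_trans (_ : gmul s (sg (l y)) (sg' (r y)) @[y --> x] --> gmul s (sg (l x)) (sg' (r x))).
    by apply: near_eq_cvg; apply: filterS nW => y Wy; rewrite /sg2 asboolT.
  have [xV' xV] := Wx.
  apply: gmul_cvg.
  + apply: (@continuous_comp _ _ _ l sg); [exact: left_factor_continuous|exact: csg].
  + apply: (@continuous_comp _ _ _ r sg'); [exact: right_factor_continuous|].
    by apply: csg'; case: (right_factorP xV').
  + exact: comp.
  + by apply: filterS nW => y [yV' _]; exact: comp.
- exact: regM.
apply: coef_inj; [exact: section_conv|by move=> x; rewrite Lbase_class lsg2|].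
have coefh y : ~ V' y -> coef h y = 0.
  by move=> nV; apply/coef_eq0 => //; rewrite hE (reg0 _ _ rb')// Lzero_lift.
have coeff y : ~ V y -> coef f y = 0.
  by move=> nV; apply/coef_eq0 => //; rewrite fE (reg0 _ _ rb)// Lzero_lift.
apply/funext => x.
(* Three cases: x has no right factor in V', its left factor is outside V, or x is in V V'. In the
   first two both sides vanish. *)
have [xV'|xV'] := pselect (src_sat g V' x); last first.
  rewrite (@coef_conv _ _ _ _ _ _ _ _ x [::] sf sh)//; last first.
    move=> y yx _; right; apply: coefh => Vy; apply: xV'; by exists y.
  rewrite big_nil /coef asboolF; last by case.
  by rewrite Lclass0 lsg2 -[X in Lzero t X](tliftK t x) Lcoord0.
have [V'r rx] := right_factorP xV'.
have fx : finite_in (@gfibre G g (gsrc g x)) [:: r x].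
  by split => // y; rewrite inE => /eqP ->.
rewrite (@coef_conv _ _ _ _ _ _ _ _ x [:: r x] sf sh fx); last first.
  move=> y yx; rewrite inE => /eqP yr; right; apply: coefh => Vy; apply: yr.
  by apply/esym; exact: src_lift_eq.
rewrite big_seq1 -/(l x) -coef_mul ?lr// lrE//.
have [xV|xV] := pselect (V (l x)); last first.
  rewrite [RHS]/coef asboolF; last by case.
  rewrite -[X in Lcoord _ X = _](_ : Lzero t (p (tlift t x)) = _) ?Lcoord0.
    by rewrite Lclass0 lsg2 -[X in Lzero t X](tliftK t x) Lcoord0.
  rewrite fE hE Lmul_class ?comp// (reg0 _ _ rb _ xV) mul0r Lclass0.
  by rewrite tprojM ?comp// lsg lsg' lrE// tliftK.
have Wx : W x by [].
rewrite fE hE Lmul_class ?comp// /coef /sg2 !asboolT//.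
Qed.

Lemma fin_fibres_zero : fin_fibres (Lzero t) 0.
Proof.
split=> u; exists [::]; last by move=> y _; rewrite coef_zero.
by split => // y _; rewrite coef_zero.
Qed.

Lemma fin_fibres_add f h : is_section f -> is_section h ->
  (exists N, fin_fibres f N) -> (exists N, fin_fibres h N) ->
  exists N, fin_fibres (sec_add f h) N.
Proof.
move=> sf sh [N [f1 f2]] [M [h1 h2]]; exists (N + M)%N.
have nz y : coef (sec_add f h) y <> 0 -> coef f y <> 0 \/ coef h y <> 0.
  rewrite coef_add//; have [->|fy] := pselect (coef f y = 0); last by left.
  by rewrite add0r; right.
split=> u.
  have [Y [[uY YP] sY YK]] := f1 u; have [Z [[uZ ZP] sZ ZK]] := h1 u.
  exists (undup (Y ++ Z)); split.
  - split; first exact: undup_uniq.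
    by move=> y; rewrite mem_undup mem_cat => /orP[/YP|/ZP].
  - by apply: (leq_trans (size_undup _)); rewrite size_cat leq_add.
  - move=> y yu /nz[/(YK _ yu)|/(ZK _ yu)] yY; rewrite mem_undup mem_cat yY ?orbT//.
have [Y YK] := f2 u; have [Z ZK] := h2 u; exists (Y ++ Z) => y yu.
by move=> /nz[/(YK _ yu)|/(ZK _ yu)] yY; rewrite mem_cat yY ?orbT.
Qed.

Lemma sec_addA f h k : is_section f -> is_section h -> is_section k ->
  sec_add (sec_add f h) k = sec_add f (sec_add h k).
Proof.
move=> sf sh sk; have sfh := section_add sf sh; have shk := section_add sh sk.
apply: coef_inj; [exact: section_add|exact: section_add|].
by apply/funext => x; rewrite !coef_add// addrA.
Qed.

Lemma sec_add0 f : is_section f -> sec_add (Lzero t) f = f.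
Proof.
move=> sf; have s0 := section_zero t; apply: coef_inj => //; first exact: section_add.
by apply/funext => x; rewrite coef_add// coef_zero add0r.
Qed.

Section Span.
Variable P : set (G -> fell_bundle t).
Hypothesis P_fin : forall f, P f -> is_section f /\ exists N, fin_fibres f N.
Hypothesis P_conv : forall f h, P f -> P h -> P (sec_conv f h).

Lemma sec_span_fin f : sec_span P f -> is_section f /\ exists N, fin_fibres f N.
Proof.
elim=> [|f1 f2 /P_fin[s1 n1] _ [s2 n2]].
  by split; [exact: section_zero|exists 0%N; exact: fin_fibres_zero].
by split; [exact: section_add|exact: fin_fibres_add].
Qed.

Lemma sec_span_add f h : sec_span P f -> sec_span P h -> sec_span P (sec_add f h).
Proof.
move=> sf /[dup] /sec_span_fin[sh _] hh; elim: sf => [|f1 f2 Pf1 sf2 IH].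
  by rewrite sec_add0.
have [s1 _] := P_fin Pf1; have [s2 _] := sec_span_fin sf2.
by rewrite sec_addA//; exact: sec_spanD.
Qed.

Lemma coef_conv_seq f h x : is_section f -> is_section h -> (exists N, fin_fibres h N) ->
  exists2 Y, finite_in (@gfibre G g (gsrc g x)) Y &
    forall y, gsrc g y = gsrc g x -> y \notin Y -> coef h y = 0.
Proof.
move=> sf sh [N [hN _]]; have [Y [fY _ YK]] := hN (gsrc g x); exists Y => // y yx yY.
by apply: contrapT => /(YK _ yx); rewrite (negbTE yY).
Qed.

Lemma sec_convDl f1 f2 h : is_section f1 -> is_section f2 -> is_section h ->
  (exists N, fin_fibres h N) ->
  sec_conv (sec_add f1 f2) h = sec_add (sec_conv f1 h) (sec_conv f2 h).
Proof.
move=> s1 s2 sh nh; have s12 := section_add s1 s2.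
have c1 := section_conv f1 h; have c2 := section_conv f2 h.
apply: coef_inj; [exact: section_conv|exact: section_add|].
apply/funext => x; rewrite coef_add//.
have [Y fY hY] := coef_conv_seq x s1 sh nh.
rewrite !(coef_conv _ sh fY)//; try by move=> y yx yY; right; exact: hY.
by rewrite -big_split/=; apply: eq_bigr => y _; rewrite coef_add// mulrDl mulrDr.
Qed.

Lemma sec_convDr f h1 h2 : is_section f -> is_section h1 -> is_section h2 ->
  (exists N, fin_fibres h1 N) -> (exists N, fin_fibres h2 N) ->
  sec_conv f (sec_add h1 h2) = sec_add (sec_conv f h1) (sec_conv f h2).
Proof.
move=> sf s1 s2 n1 n2; have s12 := section_add s1 s2.
have c1 := section_conv f h1; have c2 := section_conv f h2.
apply: coef_inj; [exact: section_conv|exact: section_add|].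
apply/funext => x; rewrite coef_add//.
have [Y [uY YP] hY] := coef_conv_seq x sf s1 n1; have [Z [uZ ZP] hZ] := coef_conv_seq x sf s2 n2.
pose W := undup (Y ++ Z).
have fW : finite_in (@gfibre G g (gsrc g x)) W.
  split; first exact: undup_uniq.
  by move=> y; rewrite mem_undup mem_cat => /orP[/YP|/ZP].
have hW y : gsrc g y = gsrc g x -> y \notin W -> coef h1 y = 0 /\ coef h2 y = 0.
  move=> yx; rewrite mem_undup mem_cat negb_or => /andP[yY yZ].
  by split; [exact: hY|exact: hZ].
rewrite (coef_conv sf s12 fW); last first.
  by move=> y yx yW; right; rewrite coef_add//; have [-> ->] := hW y yx yW; rewrite addr0.
rewrite (coef_conv sf s1 fW); last by move=> y yx yW; right; case: (hW y yx yW).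
rewrite (coef_conv sf s2 fW); last by move=> y yx yW; right; case: (hW y yx yW).
by rewrite -big_split/=; apply: eq_bigr => y _; rewrite coef_add// !mulrDr.
Qed.

Lemma sec_conv0l h : is_section h -> (exists N, fin_fibres h N) ->
  sec_conv (Lzero t) h = Lzero t.
Proof.
move=> sh nh; have s0 := section_zero t.
apply: coef_inj => //; first exact: section_conv.
apply/funext => x; have [Y fY hY] := coef_conv_seq x s0 sh nh.
rewrite (coef_conv s0 sh fY); last by move=> y yx yY; right; exact: hY.
by rewrite coef_zero big1// => y _; rewrite coef_zero mul0r mulr0.
Qed.

Lemma sec_conv0r f : is_section f -> sec_conv f (Lzero t) = Lzero t.
Proof.
move=> sf; have s0 := section_zero t.
apply: coef_inj => //; first exact: section_conv.
apply/funext => x; have f0 : finite_in (@gfibre G g (gsrc g x)) [::] by [].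
rewrite (coef_conv sf s0 f0); last by move=> y yx yY; right; rewrite coef_zero.
by rewrite coef_zero big_nil.
Qed.

Lemma sec_span_conv f h : sec_span P f -> sec_span P h -> sec_span P (sec_conv f h).
Proof.
move=> hf hh; have [sh nh] := sec_span_fin hh.
elim: hf => [|f1 f2 Pf1 hf2 IH]; first by rewrite sec_conv0l//; exact: sec_span0.
have [s1 _] := P_fin Pf1; have [s2 _] := sec_span_fin hf2.
rewrite sec_convDl//; apply: sec_span_add => //.
elim: hh {sh nh IH} => [|h1 h2 Ph1 hh2 IH]; first by rewrite sec_conv0r//; exact: sec_span0.
have [t1 m1] := P_fin Ph1; have [t2 m2] := sec_span_fin hh2.
by rewrite sec_convDr//; apply: sec_spanD => //; exact: P_conv.
Qed.

End Span.
End ElementarySections.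

Lemma lifting_cover (R : realType) (G S : topologicalType) (g : top_groupoid G)
    (s : top_groupoid S) (t : twist R g s) (K : set G) : etale g -> compact K -> exists l : seq (set G),
  (forall V, List.In V l -> open V /\ (sbisection g V /\ exists sg c, local_lift t V sg c)) /\
  forall x, K x -> exists2 V, List.In V l & V x.
Proof.
move=> g_etale cK; apply: compact_open_cover => // x _.
have [V [oV Vx bV]] := etale_sbisection g_etale x.
have [V' [oV' V'x [sg [c Ll]]]] := local_lift_exists t x.
exists (V `&` V'); split => //; first exact: openI.
split; first by apply: sbisection_sub bV _ _; [exact: openI|move=> y []].
by exists sg, c; apply: local_lift_sub Ll => y [].
Qed.


(** * Cut-off functions on bisections *)

Section LocallyCompactUrysohn.
Context {R : realType} {X : topologicalType}.
Hypotheses (lcX : locally_compact_space X) (hX : hausdorff_space X).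

(** Complete regularity gives such a function near each point of K. Multiplying functions with
    values in [0, 1] keeps them small where one factor is small, and equal to 1 where all are, so
    the property passes to finite unions. *)
Lemma locally_compact_separation (K O : set X) : compact K -> open O -> K `<=` O ->
  exists (psi : X -> R) (N : set X), [/\ continuous psi, forall x, 0 <= psi x <= 1,
    compact N, N `<=` O & (forall x, K x -> psi x < 1 / 2) /\ forall x, ~ N x -> psi x = 1].
Proof.
move=> cK oO KO.
have lcX' : locally_compact [set: X].
  move=> x _; have [C [nC cC _]] := lcX (@filterT _ (nbhs x) _).
  exists C; first by apply: filterS nC => y Cy _.
  by split => //; exact: compact_closed.
have cr := @locally_compact_completely_regular X R lcX' hX.
pose P (U : set X) := exists (psi : X -> R) (N : set X), [/\ continuous psi,
    forall x, 0 <= psi x <= 1,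
    compact N, N `<=` O & (forall x, U x -> psi x < 1 / 2) /\ forall x, ~ N x -> psi x = 1].
have [x Kx|l [lP lK]] := @compact_open_cover X K P cK.
  have nO : nbhs x O by apply: open_nbhs_nbhs; split => //; exact: KO.
  have [N [nN cN NO]] := lcX nO.
  have [|f [cf f01 fx fN]] := (@uniform_separatorP X R [set x] (~` N°)).1.
    apply: cr; first by apply: open_closedC; exact: open_interior.
    by apply; exact: nN.
  exists (f @^-1` [set r | r < 1 / 2]); split.
  - by apply: open_comp => [y _|]; [exact: cf|exact: open_lt].
  - have fx0 : f x = 0 := fx (f x) (ex_intro2 _ _ x erefl erefl).
    by rewrite /preimage /= fx0 divr_gt0.
  - exists f, N; split => //.
      by move=> y; have := f01 (f y) (ex_intro2 _ _ y I erefl); rewrite /= in_itv/=.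
    split => // y nNy; apply: fN; exists y => // Ny.
    by apply: nNy; exact: interior_subset Ny.
suff [psi [N [h1 h2 h3 h4 [h5 h6]]]] : P [set x | exists2 U, List.In U l & U x].
  by exists psi, N; split => //; split => // x /lK; exact: h5.
elim: l lP {lK} => [|U l IH] lP.
  exists (fun=> 1), set0; split => //.
  - by move=> x; exact: cvg_cst.
  - by move=> x; rewrite ler01 lexx.
  - exact: compact0.
  - by split => // x [].
have [|psi [N [h1 h2 h3 h4 [h5 h6]]]] := IH; first by move=> V Vl; apply: lP; right.
have [_ [psi' [N' [k1 k2 k3 k4 [k5 k6]]]]] := lP U (or_introl erefl).
exists (fun x => psi' x * psi x), (N' `|` N); split.
- by move=> x; apply: cvgM; [exact: k1|exact: h1].
- move=> x; have /andP[a0 a1] := h2 x; have /andP[b0 b1] := k2 x.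
  by rewrite mulr_ge0//= mulr_ile1.
- exact: compactU.
- by move=> x [/k4|/h4].
- split=> x.
    have /andP[a0 a1] := h2 x; have /andP[b0 b1] := k2 x.
    move=> [V [<- /k5 Ux|Vl Vx]].
      by apply: le_lt_trans Ux; rewrite -[leRHS]mulr1 ler_wpM2l.
    have : psi x < 1 / 2 by apply: h5; exists V.
    by apply: le_lt_trans; rewrite -[leRHS]mul1r ler_wpM2r.
  by move=> /not_orP[/k6 -> /h6 ->]; rewrite mulr1.
Qed.

End LocallyCompactUrysohn.

Section Cutoff.
Context {R : realType} {G : topologicalType} (g : top_groupoid G).
Hypotheses (G0_lc : locally_compact_space (set_type (gunits g)))
  (G0_hausdorff : hausdorff_space (set_type (gunits g))).

(** As G need not be Hausdorff, the cut-off is built on the unit space and pulled back along the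
    source of V. Extension by 0 makes it continuous on V only; [C] is the copy inside V of a compact
    set of units. *)
Lemma bisection_cutoff (V K : set G) : sbisection g V -> compact K -> K `<=` V ->
  exists (chi : G -> R) (O C : set G), [/\ open O, K `<=` O, compact C, C `<=` V &
    [/\ cont_on V chi, forall x, ~ C x -> chi x = 0 & forall x, O x -> chi x = 1]].
Proof.
move=> bV cK KV; have [oV iV hV] := bV.
pose s0 := gsrc0 g.
have cs0 : continuous s0 by exact: gsrc0_continuous.
pose O1 := [set u : set_type (gunits g) | src_sat g V (val u)].
have oO1 : open O1.
  apply: (@open_comp _ _ (val : set_type (gunits g) -> G)); last exact: src_sat_open.
  by move=> u _; exact: initial_continuous.
have valE x : val (s0 x) = gsrc g x by [].
have sV x : V x -> O1 (s0 x) by move=> Vx; exists x => //; rewrite valE gsrc_src.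
have cK0 : compact (s0 @` K).
  by apply: continuous_compact => //; exact: continuous_subspaceT.
have [|psi [N [cpsi psi01 cN NO [psiK psiN]]]] :=
    @locally_compact_separation R _ G0_lc G0_hausdorff _ _ cK0 oO1.
  by move=> _ [x /KV Vx <-]; exact: sV.
pose th (u : set_type (gunits g)) : G := src_lift g V (val u).
have thP (u : set_type (gunits g)) : O1 u -> V (th u) /\ s0 (th u) = u.
  move=> /src_liftP[Vt et]; split => //; apply: val_inj; rewrite valE et.
  exact: set_mem (valP u).
pose C := th @` N.
have cC : compact C.
  apply: continuous_compact => //; apply: continuous_in_subspaceT => u /set_mem/NO O1u.
  change {for u, continuous (src_lift g V \o (val : set_type (gunits g) -> G))}.
  apply: continuous_comp; first exact: initial_continuous.
  exact: src_lift_continuous.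
(* The truncation makes [chi] equal to 1 where psi < 1/2, an open neighbourhood of K in V, and 0
   where psi = 1. *)
pose chi x : R := if `[< V x >] then Num.min 1 (2 * (1 - psi (s0 x))) else 0.
exists chi, (V `&` (psi \o s0) @^-1` [set r | r < 1 / 2]), C; split => //.
- apply: openI => //; apply: open_comp; last exact: open_lt.
  by move=> x _; apply: continuous_comp; [exact: cs0|exact: cpsi].
- by move=> x Kx; split; [exact: KV|apply: psiK; exists x].
- by move=> _ [u /NO O1u <-]; case: (thP u O1u).
split.
- move=> x Vx; change (chi @ x --> chi x).
  have nV : nbhs x V by apply: open_nbhs_nbhs.
  have -> : chi x = Num.min 1 (2 * (1 - psi (s0 x))) by rewrite /chi asboolT.
  apply: cvg_trans (_ : Num.min 1 (2 * (1 - psi (s0 y))) @[y --> x] -->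
    Num.min 1 (2 * (1 - psi (s0 x)))).
    by apply: near_eq_cvg; apply: filterS nV => y Vy; rewrite /chi asboolT.
  have cp : psi (s0 y) @[y --> x] --> psi (s0 x).
    by apply: (@continuous_comp _ _ _ s0 psi); [exact: cs0|exact: cpsi].
  apply: (@continuous_comp _ _ _ (fun y => 2 * (1 - psi (s0 y))) (fun r : R => Num.min 1 r)).
    by apply: cvgM; [exact: cvg_cst|apply: cvgB; [exact: cvg_cst|exact: cp]].
  by apply: continuous_min; [exact: cvg_cst|exact: cvg_id].
- move=> x nC; rewrite /chi; case: asboolP => // Vx.
  rewrite psiN ?subrr ?mulr0; first by rewrite minEle ler10.
  move=> Nx; apply: nC; exists (s0 x) => //.
  by apply: src_lift_eq => //; rewrite valE gsrc_src.
- move=> x [Vx /= px]; rewrite /chi asboolT// minEle ifT//; lra.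
Qed.

End Cutoff.

Lemma continuous_at_eq_on (X Y : topologicalType) (W : set X) (f k : X -> Y) (x : X) :
  open W -> W x -> (forall y, W y -> f y = k y) ->
  {for x, continuous k} -> {for x, continuous f}.
Proof.
move=> oW Wx fk ck; change (f @ x --> f x); rewrite (fk _ Wx).
apply: cvg_trans ck; apply: near_eq_cvg.
have nW : nbhs x W by apply: open_nbhs_nbhs.
by apply: filterS nW => y /fk.
Qed.

(** * The algebra Cc *)

Section CcAlgebra.
Context {R : realType} {G S : topologicalType}.
Context {g : top_groupoid G} {s : top_groupoid S} (t : twist R g s).
Local Notation p := (tproj t).
Local Notation cls := (Lclass t).
Hypotheses (g_etale : etale g) (G0_lc : locally_compact_space (set_type (gunits g)))
  (G0_hausdorff : hausdorff_space (set_type (gunits g))).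
Implicit Types (f h : G -> fell_bundle t) (b : G -> R[i]).

(** Supports are controlled by a compact subset of V rather than by a closure, which in G may be
    neither compact nor contained in V. *)
Definition reg_cont (V : set G) b : Prop :=
  cont_on V b /\ exists K, [/\ compact K, K `<=` V & forall x, ~ K x -> b x = 0].

Lemma reg_cont_out V b : reg_cont V b -> forall x, ~ V x -> b x = 0.
Proof. by move=> [_ [K [_ KV b0]]] x nV; apply: b0 => /KV. Qed.

Lemma reg_cont_scale V b (a : R[i]) : reg_cont V b -> reg_cont V (fun x => a * b x).
Proof.
move=> [cb [K [cK KV b0]]]; split.
  by move=> x Vx; apply: complex_cvgM; [exact: cvg_cst|exact: cb].
by exists K; split => // x /b0 ->; rewrite mulr0.
Qed.

Lemma reg_cont_mul V V' b b' : sbisection g V -> sbisection g V' ->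
  reg_cont V b -> reg_cont V' b' ->
  reg_cont (bis_mul g V V') (fun x => if `[< bis_mul g V V' x >] then
    b (left_factor g V' x) * b' (right_factor g V' x) else 0).
Proof.
move=> bV bV' [cb [K [cK KV b0]]] [cb' [K' [cK' KV' b0']]].
have [oW _ _] := bis_mul_bisection g_etale bV bV'.
split.
  move=> x Wx; have [xV' xV] := Wx.
  apply: (continuous_at_eq_on oW Wx
    (k := fun y => b (left_factor g V' y) * b' (right_factor g V' y))).
    by move=> y Wy; rewrite asboolT.
  apply: complex_cvgM.
  - apply: (@continuous_comp _ _ _ (left_factor g V') b); last exact: cb.
    exact: left_factor_continuous.
  - apply: (@continuous_comp _ _ _ (right_factor g V') b').
      exact: right_factor_continuous.
    by apply: cb'; case: (right_factorP xV').
exists (gset_mul g K K'); split.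
- exact: compact_gset_mul.
- move=> _ [[a c] [/= [Ka K'c] ac] <-].
  have [h1 h2 h3] := factors_mul bV' (KV' _ K'c) ac.
  by split => //; rewrite /= h3; exact: KV.
- move=> x nK; case: asboolP => // -[xV' _].
  have [Kl|/b0 ->] := pselect (K (left_factor g V' x)); last by rewrite mul0r.
  have [Kr|/b0' ->] := pselect (K' (right_factor g V' x)); last by rewrite mulr0.
  case: nK; exists (left_factor g V' x, right_factor g V' x) => /=.
    by split => //=; exact: factors_composable.
  exact: left_right_factor.
Qed.

Lemma sbisection_hausdorff V : sbisection g V -> hausdorff_space (set_type V).
Proof.
move=> [_ iV _]; rewrite open_hausdorff => x y xy.
have xy' : gsrc0 g (val x) != gsrc0 g (val y).
  apply: contra xy => /eqP /(congr1 (fun u : set_type (gunits g) => val u)) /= e.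
  by apply/eqP/val_inj; apply: iV => //; exact: valP.
move: G0_hausdorff; rewrite open_hausdorff => /(_ _ _ xy')[W12].
case: W12 => W1 W2 /= [/set_mem xW /set_mem yW] [oW1 oW2 /eqP W0].
have cv : continuous (gsrc0 g \o (val : set_type V -> G)).
  by move=> z; apply: continuous_comp; [exact: initial_continuous|exact: gsrc0_continuous].
exists ((gsrc0 g \o val) @^-1` W1, (gsrc0 g \o val) @^-1` W2).
  by split; exact/mem_set.
split => /=; [exact: open_comp|exact: open_comp|].
by rewrite -preimage_setI W0 preimage_set0.
Qed.

(** Compact sets need not be closed in G, but they are relatively closed in V: s(K) is compact,
    hence closed, in the unit space, and s is injective on V. *)
Lemma sbisection_compact_closed V K x : sbisection g V -> compact K -> K `<=` V ->
  V x -> closure K x -> K x.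
Proof.
move=> [_ iV _] cK KV Vx clx.
have cK0 : compact (gsrc0 g @` K).
  apply: continuous_compact => //; apply: continuous_subspaceT; exact: gsrc0_continuous.
have : (gsrc0 g @` K) (gsrc0 g x).
  rewrite [gsrc0 g @` K](closure_id _).1; last exact: compact_closed.
  move=> W /gsrc0_continuous /clx[y [Ky Wy]].
  by exists (gsrc0 g y); split => //; exists y.
move=> [y Ky /(congr1 (fun u : set_type (gunits g) => val u)) /= e].
by rewrite -(iV _ _ (mem_set (KV _ Ky)) (mem_set Vx) e).
Qed.

Lemma elementary_generator f : elementary reg_cont f -> Cc_generator f.
Proof.
move=> ef; split; first exact: elementary_section ef.
case: ef => V [sg [b [bV lsg csg rb ->]]]; have [oV _ _] := bV.
have [cb [K [cK KV b0]]] := rb.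
have f0 x : b x = 0 -> cls (sg x) (b x) = Lzero t x by move=> ->; exact: Lzero_lift.
exists V; split => //.
- exact: sbisection_hausdorff.
- rewrite continuous_open_subspace// => x /set_mem Vx.
  by apply: cls_cvg; [exact: csg|exact: cb].
- by move=> x nV; apply: f0; exact: reg_cont_out rb x nV.
set B := [set x | _].
have BK : B `<=` K by move=> x [_ nz]; apply: contrapT => /b0 /f0.
rewrite (_ : V `&` closure B = K `&` closure B).
  by apply: compact_closedI => //; exact: closed_closure.
apply/seteqP; split=> x [Vx clx]; split => //; last exact: KV.
exact: (sbisection_compact_closed bV cK KV Vx (closure_subset BK clx)).
Qed.

Lemma Cc_section f : Cc f -> is_section f.
Proof.
elim=> [|a f1 h [s1 _] _ sh]; first exact: section_zero.
by apply: section_add => //; exact: section_scale.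
Qed.

Lemma Cc_add f h : Cc f -> Cc h -> Cc (sec_add f h).
Proof.
move=> cf ch; have sh := Cc_section ch.
elim: cf => [|a f1 f2 gf1 cf2 IH]; first by rewrite sec_add0.
rewrite sec_addA//; first exact: Cc_step.
- by apply: section_scale; case: gf1.
- exact: Cc_section.
Qed.

Lemma sec_scale0 a : sec_scale a (Lzero t) = Lzero t.
Proof.
have s0 := section_zero t; apply: coef_inj => //; first exact: section_scale.
by apply/funext => x; rewrite coef_scale// coef_zero mulr0.
Qed.

Lemma Cc_scale a f : Cc f -> Cc (sec_scale a f).
Proof.
elim=> [|c f1 f2 gf1 cf2 IH]; first by rewrite sec_scale0; exact: Cc_zero.
have s1 : is_section f1 by case: gf1.
have s2 := Cc_section cf2.
have sc1 := section_scale c s1.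
rewrite (_ : sec_scale a _ = sec_add (sec_scale (a * c) f1) (sec_scale a f2)).
  exact: Cc_step.
apply: coef_inj.
- by apply: section_scale; exact: section_add.
- by apply: section_add; exact: section_scale.
apply/funext => x; rewrite coef_scale ?coef_add ?coef_scale//; first by rewrite mulrDr mulrA.
- exact: section_scale.
- exact: section_scale.
- exact: section_add.
Qed.

Lemma Cc_generator_support f : Cc_generator f -> exists U K, [/\ open U,
  hausdorff_space (set_type U), cont_on U f, compact K & K `<=` U /\ forall x, ~ K x -> f x = Lzero t x].
Proof.
move=> [sf [U [oU hU cU fU cK]]]; exists U; eexists; split; [exact: oU|exact: hU| |exact: cK|].
  move=> x Ux; move: cU; rewrite continuous_open_subspace// => /(_ x); apply.
  exact: mem_set.
split; first by move=> x [].
move=> x nK; have [Ux|/fU//] := pselect (U x).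
apply: contrapT => fx; apply: nK; split => //.
exact: subset_closure.
Qed.

(** [C] is closed in the Hausdorff space U: cover it by finitely many open sets, each disjoint from
    a neighbourhood of x, and intersect these neighbourhoods. *)
Lemma hausdorff_sub_separate (U C : set G) x : open U -> hausdorff_space (set_type U) ->
  compact C -> C `<=` U -> U x -> ~ C x -> \forall y \near x, ~ C y.
Proof.
move=> oU hU cC CU Ux nCx.
pose P (B : set G) := exists A, nbhs x A /\ A `&` B = set0.
have [c Cc0|l [lP lC]] := @compact_open_cover G C P cC.
  have Uc := CU _ Cc0.
  pose x' : set_type U := SigSub (mem_set Ux); pose c' : set_type U := SigSub (mem_set Uc).
  have xc : x' != c' by apply/eqP => /(congr1 val) /= e; apply: nCx; rewrite e.
  move: hU; rewrite open_hausdorff => /(_ _ _ xc)[W12].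
  case: W12 => W1 W2 /= [/set_mem xW /set_mem cW] [oW1 oW2 /eqP W0].
  move: oW1 oW2 => [Q1 oQ1 Q1W] [Q2 oQ2 Q2W].
  exists (Q2 `&` U); split; first exact: openI.
    by split => //; move: cW; rewrite -Q2W.
  exists (Q1 `&` U); split.
    apply: open_nbhs_nbhs; split; first exact: openI.
    by split => //; move: xW; rewrite -Q1W.
  rewrite -subset0 => y [[Q1y Uy] [Q2y _]].
  have : (W1 `&` W2) (SigSub (mem_set Uy)) by rewrite -Q1W -Q2W.
  by rewrite W0.
suff : exists2 A, nbhs x A & forall B, List.In B l -> A `&` B = set0.
  move=> [A nA hA]; apply: filterS nA => y Ay /lC[B Bl By].
  by have : (A `&` B) y by []; rewrite hA.
elim: l lP {lC} => [|B l IH] lP; first by exists setT => //; exact: filterT.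
have [|A nA hA] := IH; first by move=> B' Bl; apply: lP; right.
have [_ [A' [nA' hA']]] := lP B (or_introl erefl).
exists (A `&` A'); first exact: filterI.
move=> B' [<-|/hA hB]; rewrite -subset0 => y [[Ay A'y] By].
  by have : (A' `&` B) y by []; rewrite hA'.
by have : (A `&` B') y by []; rewrite hB.
Qed.

(** A partition of unity made one bisection at a time. [K1] is the part of K that only the first set
    covers, and chi is 1 near it, so (1 - chi) f is supported where the remaining sets cover.
    Staying inside one open Hausdorff U keeps the remainder continuous. *)
Lemma cutoff_decomposition (l : seq (set G)) (U : set G) f (K : set G) :
  (forall V, List.In V l -> open V /\
     (sbisection g V /\ exists sg c, local_lift t V sg c)) ->
  open U -> hausdorff_space (set_type U) -> is_section f -> cont_on U f ->
  compact K -> K `<=` U -> (forall x, ~ K x -> f x = Lzero t x) ->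
  (forall x, K x -> exists2 V, List.In V l & V x) ->
  sec_span (elementary reg_cont) f.
Proof.
move=> lP oU hU; elim: l lP f K => [|V0 l IH] lP f K sf cf cK KU f0 Kl.
  suff -> : f = Lzero t by exact: sec_span0.
  by apply/funext => x; apply: f0 => /Kl[].
have [oV0 [bV0 [sg [c Ll0]]]] := lP V0 (or_introl erefl).
pose V := V0 `&` U.
have oV : open V by exact: openI.
have bV : sbisection g V by apply: sbisection_sub bV0 oV _ => x [].
have Ll : local_lift t V sg c by apply: local_lift_sub Ll0 => x [].
have [lsg csg _ _] := Ll.
pose K1 := K `&` ~` [set x | exists2 W, List.In W l & W x].
have cK1 : compact K1.
  apply: compact_closedI => //; apply: open_closedC; apply: open_list_bigcup => W Wl.
  by have [] := lP W (or_intror Wl).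
have K1V : K1 `<=` V.
  move=> x [Kx nl]; split; last exact: KU.
  by have [W [<-//|Wl Wx]] := Kl x Kx; case: nl; exists W.
have [chi [W1 [C [oO K1O cC CV [cchi chi0 chi1]]]]] :=
  @bisection_cutoff R G g G0_lc G0_hausdorff V K1 bV cK1 K1V.
pose fc x := Lcoord (sg x) (f x).
have fE x : f x = cls (sg x) (fc x) by rewrite /fc Lclass_coord// sf lsg.
have cfc : cont_on V fc.
  move=> x Vx; have [_ Ux] := Vx.
  have VL : V (Lbase (f x)) by rewrite sf.
  have -> : fc = lcoord sg \o f by apply/funext => y; rewrite /fc /lcoord /= sf.
  exact: (lcoord_cvg oV Ll (FF := nbhs_filter x) (cf x Ux) VL).
pose f1 x := cls (sg x) ((chi x)%:C%C * fc x).
pose f2 x := cls (sg x) ((1 - (chi x)%:C%C) * fc x).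
have s1 : is_section f1 by move=> x; rewrite Lbase_class.
have s2 : is_section f2 by move=> x; rewrite Lbase_class.
have cchiC : cont_on V (fun x => (chi x)%:C%C : R[i]).
  move=> x Vx; apply/cvg_rnormP => e e0.
  have /cvgrPdist_lt/(_ _ e0) := cchi x Vx; apply: filterS => y.
  by rewrite -rmorphB/= rnormC.
have -> : f = sec_add f1 f2.
  apply/funext => x; rewrite /sec_add /f1 /f2 Ladd_class -mulrDl addrC subrK mul1r.
  exact: fE.
apply: sec_spanD.
  exists V, sg, (fun x => (chi x)%:C%C * fc x).
  split; [exact: bV|exact: lsg|exact: csg| |reflexivity]; split.
    by move=> x Vx; apply: complex_cvgM; [exact: cchiC|exact: cfc].
  by exists C; split => // x /chi0 ->; rewrite mul0r.
have f2out x : ~ C x -> f2 x = f x.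
  by move=> /chi0 cx; rewrite /f2 cx subr0 mul1r fE.
apply: (IH _ f2 (K `&` ~` W1)) => //.
- by move=> W Wl; apply: lP; right.
- move=> x Ux; have [Vx|nV] := pselect (V x).
    apply: cls_cvg; first exact: csg.
    apply: complex_cvgM; last exact: cfc.
    apply: complex_cvgD; first exact: cvg_cst.
    have := cchiC x Vx => h; apply/cvg_rnormP => e e0.
    have /cvg_rnormP/(_ e e0) := h; apply: filterS => y.
    by rewrite -opprD rnormN.
  (* Extension by 0 may make chi discontinuous outside V, but within U the compact set [C] is
     closed, so near x the remainder coincides with f. *)
  have nCx : ~ C x by move=> /CV.
  have := hausdorff_sub_separate oU hU cC (subset_trans CV (@subIsetr _ _ _)) Ux nCx.
  move=> nC; change (f2 @ x --> f2 x); rewrite (f2out _ nCx).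
  apply: cvg_trans (cf x Ux); apply: near_eq_cvg.
  by apply: filterS nC => y nCy; rewrite f2out.
- by apply: compact_closedI => //; exact: open_closedC.
- by move=> x [/KU].
- move=> x nK; have [Ox|nO] := pselect (W1 x).
    by rewrite /f2 (chi1 _ Ox) subrr mul0r Lzero_lift.
  have nKx : ~ K x by move=> Kx; apply: nK.
  have fc0 : fc x = 0.
    by apply: (@Lclass_inj _ _ _ _ _ t (sg x)); rewrite -fE f0// Lzero_lift.
  by rewrite /f2 fc0 mulr0 Lzero_lift.
- move=> x [Kx nO]; apply: contrapT => nl; apply: nO; apply: K1O.
  by split.
Qed.

Lemma reg_cont_fin f : elementary reg_cont f -> exists N, fin_fibres f N.
Proof.
move=> ef; have sf := elementary_section ef.
case: ef => V [sg [b [_ lsg _ [_ [K [cK _ b0]]] fE]]].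
apply: (compact_support_fin_fibres g_etale cK) => x /b0 bx.
by apply/coef_eq0 => //; rewrite fE bx Lzero_lift.
Qed.

Lemma Cc_span f : Cc f <-> sec_span (elementary reg_cont) f.
Proof.
have el_fin h : elementary reg_cont h -> is_section h /\ exists N, fin_fibres h N.
  by move=> eh; split; [exact: elementary_section eh|exact: reg_cont_fin].
split; last first.
  elim=> [|f1 f2 ef1 _ cf2]; first exact: Cc_zero.
  have -> : f1 = sec_scale 1 f1.
    have s1 := elementary_section ef1; apply: coef_inj => //; first exact: section_scale.
    by apply/funext => x; rewrite coef_scale// mul1r.
  by apply: Cc_step => //; exact: elementary_generator.
elim=> [|a f1 f2 gf1 _ sf2]; first exact: sec_span0.
apply: (sec_span_add el_fin) => //.
have sf1 : is_section f1 by case: gf1.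
have [U [K [oU hU cU cK [KU f0]]]] := Cc_generator_support gf1.
have [l [lP lK]] := lifting_cover t g_etale cK.
have := cutoff_decomposition lP oU hU sf1 cU cK KU f0 lK.
elim=> [|k1 k2 ek1 hk2 IH]; first by rewrite sec_scale0; exact: sec_span0.
have t1 := elementary_section ek1; have [t2 _] := sec_span_fin el_fin hk2.
rewrite (_ : sec_scale a _ = sec_add (sec_scale a k1) (sec_scale a k2)).
  by apply: sec_spanD => //; apply: elementary_scale ek1 => V b; exact: reg_cont_scale.
have u12 := section_add t1 t2; have u1 := section_scale a t1; have u2 := section_scale a t2.
apply: coef_inj; [exact: section_scale|exact: section_add|].
by apply/funext => x; rewrite coef_scale// !coef_add// !coef_scale// mulrDr.
Qed.

Lemma Cc_fin f : Cc f -> exists N, fin_fibres f N.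
Proof.
move=> /Cc_span; elim=> [|f1 f2 ef1 hf2 n2]; first by exists 0%N; exact: fin_fibres_zero.
have s1 := elementary_section ef1.
apply: fin_fibres_add => //; first by apply: Cc_section; apply/Cc_span.
exact: reg_cont_fin.
Qed.

Lemma Cc_conv f h : Cc f -> Cc h -> Cc (sec_conv f h).
Proof.
move=> /Cc_span cf /Cc_span ch; apply/Cc_span; apply: sec_span_conv => //.
  by move=> k ek; split; [exact: elementary_section ek|exact: reg_cont_fin].
move=> f1 h1 ef1 eh1; apply: (elementary_conv g_etale) => //.
  exact: reg_cont_out.
exact: reg_cont_mul.
Qed.

End CcAlgebra.

(** * The algebra Bc *)

Section Borel.
Context {T : topologicalType}.
Implicit Types B E : set T.

Lemma borel_open B : open B -> borel B.
Proof. by move=> oB; exact: sub_sigma_algebra. Qed.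

Lemma borelC B : borel B -> borel (~` B).
Proof.
have [_ hC _] := smallest_sigma_algebra setT [set U : set T | open U].
by move=> /hC; rewrite setTD.
Qed.

Lemma borel_bigcup (F : nat -> set T) : (forall n, borel (F n)) -> borel (\bigcup_n F n).
Proof. by have [_ _] := smallest_sigma_algebra setT [set U : set T | open U]; apply. Qed.

Lemma borel0 : borel (@set0 T).
Proof. by apply: borel_open; exact: open0. Qed.

Lemma borelU B E : borel B -> borel E -> borel (B `|` E).
Proof.
move=> bB bE; rewrite (_ : B `|` E = \bigcup_n (if n is 0%N then B else E)).
  by apply: borel_bigcup; case.
apply/seteqP; split => [x [Bx|Ex]|x [[|n] _]]; [by exists 0%N|by exists 1%N|by left|by right].
Qed.

Lemma borelI B E : borel B -> borel E -> borel (B `&` E).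
Proof.
move=> bB bE; rewrite -[B `&` E]setCK setCI; apply: borelC.
by apply: borelU; exact: borelC.
Qed.

Lemma borel_countable_bigcup (I : countType) (F : I -> set T) :
  (forall i, borel (F i)) -> borel (\bigcup_i F i).
Proof.
move=> bF; pose F' n := if (choice.unpickle n : option I) is Some i then F i else set0.
rewrite (_ : \bigcup_i F i = \bigcup_n F' n).
  by apply: borel_bigcup => n; rewrite /F'; case: (choice.unpickle n : option I) => [i|]; [exact: bF|exact: borel0].
apply/seteqP; split => x [i _ Fi].
  by exists (choice.pickle i) => //; rewrite /F' choice.pickleK.
by move: Fi; rewrite /F'; case: (choice.unpickle i : option I) => // j Fj; exists j.
Qed.

Lemma borel_ind (P : set (set T)) : (forall B, open B -> P B) -> (forall B, P B -> P (~` B)) ->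
  (forall F : nat -> set T, (forall n, P (F n)) -> P (\bigcup_n F n)) ->
  forall B, borel B -> P B.
Proof.
move=> Po PC PU; apply: smallest_sub => //; split => [|B|//].
- by apply: Po; exact: open0.
- by rewrite setTD; exact: PC.
Qed.

End Borel.

Lemma borel_funP (X Y : topologicalType) (f : X -> Y) :
  (forall W, open W -> borel (f @^-1` W)) -> borel_fun f.
Proof.
move=> hf; apply: borel_ind => //.
  by move=> B; rewrite preimage_setC; exact: borelC.
by move=> F bF; rewrite preimage_bigcup; exact: borel_bigcup.
Qed.

Lemma borel_preimage_on (X Y : topologicalType) (W : set X) (f : X -> Y) (B : set Y) :
  open W -> (forall x, W x -> {for x, continuous f}) -> borel B -> borel (W `&` f @^-1` B).
Proof.
move=> oW cf; move: B; apply: borel_ind => [B oB|B bB|F bF].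
- apply: borel_open; rewrite openE => x [Wx Bx].
  have n1 : nbhs x W by apply: open_nbhs_nbhs.
  have n2 : nbhs x (f @^-1` B) by apply: (cf x Wx); apply: open_nbhs_nbhs.
  exact: (@filterI _ _ (nbhs_filter x) _ _ n1 n2).
- rewrite (_ : W `&` _ = W `&` ~` (W `&` f @^-1` B)).
    by apply: borelI; [exact: borel_open|exact: borelC].
  apply/seteqP; split=> x [Wx nB]; split => //.
    by case=> _ /nB.
  by move=> Bx; apply: nB.
- rewrite preimage_bigcup setI_bigcupr; exact: borel_bigcup.
Qed.

Section ComplexBase.
Context {R : realType}.

Definition rational_ball (i : rat * rat * nat) : set R[i] :=
  [set z | rnorm ((ratr i.1.1 +i* ratr i.1.2)%C - z) < i.2.+1%:R^-1].

Lemma rational_ball_open i : open (rational_ball i).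
Proof. exact: (@open_rnorm_ball R R[i]). Qed.

Lemma rational_ball_base (z : R[i]) (e : R) : 0 < e ->
  exists i, rational_ball i z /\ forall w, rational_ball i w -> rnorm (z - w) < e.
Proof.
move=> e0; have e2 : 0 < e / 2 by rewrite divr_gt0.
have /filter_ex[n hn] : \forall k \near \oo, k.+1%:R^-1 < e / 2.
  exact: near_infty_natSinv_lt (PosNum e2).
pose d : R := n.+1%:R^-1; have d0 : 0 < d by rewrite invr_gt0 ltr0n.
have rat_near (x : R) : exists q : rat, `|ratr q - x| < d / 2.
  have : x - d / 2 < x + d / 2 by lra.
  move=> /rat_in_itvoo[q]; rewrite in_itv/= => /andP[q1 q2]; exists q.
  by rewrite ltr_norml; apply/andP; split; lra.
have [q1 h1] := rat_near (complex.Re z); have [q2 h2] := rat_near (complex.Im z).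
have hz : rational_ball (q1, q2, n) z.
  apply: le_lt_trans (rnorm_le_ReIm _) _; rewrite !raddfB/=.
  by rewrite -/d; lra.
exists (q1, q2, n); split => // w hw.
rewrite -(subrK (ratr q1 +i* ratr q2)%C z) -addrA.
apply: le_lt_trans (ler_rnormD _ _) _.
move: hz hw; rewrite /rational_ball /= -/d rnormB => hz hw.
have : d < e / 2 by [].
lra.
Qed.

(* An open subset of a product with [C] is a countable union of open boxes. *)
Lemma borel_pair (X P : topologicalType) (E : set X) (b1 : X -> P) (b2 : X -> R[i])
    (W : set (P * R[i])) :
  (forall V, open V -> borel (E `&` b1 @^-1` V)) ->
  (forall V, open V -> borel (E `&` b2 @^-1` V)) ->
  open W -> borel (E `&` [set x | W (b1 x, b2 x)]).
Proof.
move=> h1 h2 oW.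
(* Only the complex factor has a countable base, so the boxes are grouped by their ball and the
   union in the first factor, of any size, is again open. *)
pose V i := \bigcup_(A in [set A : set P | open A /\ A `*` rational_ball i `<=` W]) A.
have oV i : open (V i) by apply: bigcup_open => A [].
rewrite (_ : E `&` _ = \bigcup_i ((E `&` b1 @^-1` V i) `&` (E `&` b2 @^-1` rational_ball i))).
  apply: borel_countable_bigcup => i; apply: borelI; first exact: h1.
  by apply: h2; exact: rational_ball_open.
apply/seteqP; split=> x.
  move=> [Ex Wx]; move: oW; rewrite openE => /(_ _ Wx).
  rewrite /interior => -[[A1 A2] /= [nA1 nA2] A12].
  have nA2' : nbhs (b2 x) A2 by exact: nA2.
  have [e e0 he] : exists2 e : R, 0 < e & forall w, rnorm (b2 x - w) < e -> A2 w.
    move: nA2'; rewrite -nbhs_ballE => -[e' /= e0 he].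
    have [r r0 er] := complex_gt0 e0.
    exists r => // w hw; apply: he; rewrite -ball_normE /ball_ /= rnormE er ltcR//.
  have [i [ix hi]] := rational_ball_base (b2 x) e0.
  exists i => //; split; split => //.
  exists A1°; last by exact: nA1.
  split; first exact: open_interior.
  move=> [q w] [/= qA iw]; apply: A12; split => /=; first exact: interior_subset.
  by apply: he; exact: hi.
move=> [i _ [[Ex [A [_ AW] Ax]] [_ ix]]]; split => //=.
by apply: AW; split.
Qed.

End ComplexBase.

Section BorelOn.
Context {X : topologicalType}.
Implicit Types E : set X.

Definition borel_on (Y : topologicalType) E (f : X -> Y) : Prop :=
  forall W, open W -> borel (E `&` f @^-1` W).

Lemma borel_on_eq (Y : topologicalType) E (f k : X -> Y) :
  (forall x, E x -> f x = k x) -> borel_on E f -> borel_on E k.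
Proof.
move=> fk bf W /bf; rewrite (_ : E `&` f @^-1` W = E `&` k @^-1` W)//.
by apply/seteqP; split=> x [Ex] /=; [rewrite fk|rewrite -fk].
Qed.

Lemma borel_on_cst (Y : topologicalType) E (y : Y) : borel E -> borel_on E (fun=> y).
Proof.
move=> bE W _; have [Wy|nW] := pselect (W y).
  by rewrite (_ : _ `&` _ = E)//; apply/seteqP; split => [x []|].
by rewrite (_ : _ `&` _ = set0); [exact: borel0|rewrite -subset0 => x []].
Qed.

Lemma cont_borel_on (Y : topologicalType) E (f : X -> Y) :
  open E -> (forall x, E x -> {for x, continuous f}) -> borel_on E f.
Proof.
by move=> oE cf W oW; apply: borel_preimage_on => //; exact: borel_open.
Qed.

Lemma borel_on_setC (Y : topologicalType) E (f : X -> Y) W : borel E ->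
  borel_on E f -> borel_on (~` E) f -> open W -> borel (f @^-1` W).
Proof.
move=> bE f1 f2 oW; rewrite -[f @^-1` W]setTI -(setUv E) setIUl.
by apply: borelU; [exact: f1|exact: f2].
Qed.

Lemma borel_on_complexD (R : realType) E (b1 b2 : X -> R[i]) :
  borel_on E b1 -> borel_on E b2 -> borel_on E (fun x => b1 x + b2 x).
Proof.
move=> h1 h2 W oW.
apply: (borel_pair (W := [set z : R[i] * R[i] | W (z.1 + z.2)]) h1 h2).
have c (z : R[i] * R[i]) : {for z, continuous (fun z : R[i] * R[i] => z.1 + z.2)}.
  by apply: complex_cvgD; [exact: cvg_fst|exact: cvg_snd].
by apply: open_comp => // z _; exact: c.
Qed.

Lemma borel_on_complexM (R : realType) E (b1 b2 : X -> R[i]) :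
  borel_on E b1 -> borel_on E b2 -> borel_on E (fun x => b1 x * b2 x).
Proof.
move=> h1 h2 W oW.
apply: (borel_pair (W := [set z : R[i] * R[i] | W (z.1 * z.2)]) h1 h2).
have c (z : R[i] * R[i]) : {for z, continuous (fun z : R[i] * R[i] => z.1 * z.2)}.
  by apply: complex_cvgM; [exact: cvg_fst|exact: cvg_snd].
by apply: open_comp => // z _; exact: c.
Qed.

End BorelOn.

Section BcAlgebra.
Context {R : realType} {G S : topologicalType}.
Context {g : top_groupoid G} {s : top_groupoid S} (t : twist R g s).
Local Notation p := (tproj t).
Local Notation cls := (Lclass t).
Hypotheses (g_etale : etale g) (G0_hausdorff : hausdorff_space (set_type (gunits g))).
Implicit Types (f h : G -> fell_bundle t) (b : G -> R[i]) (sg : G -> S).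

Lemma borel_on_class V sg b : open V -> cont_on V sg -> borel_on V b ->
  borel_on V (fun x => cls (sg x) (b x)).
Proof.
move=> oV csg bb W /open_fell oW.
apply: (borel_pair (b1 := sg) (b2 := b) (W := [set x : S * R[i] | W (cls x.1 x.2)])) => //.
exact: cont_borel_on.
Qed.

Lemma borel_on_zero (E : set G) : borel E -> borel_on E (Lzero t).
Proof.
move=> bE W oW; apply: borelI => //; apply: borel_open.
by apply: open_comp => // x _; exact: Lzero_continuous.
Qed.

Lemma borel_on_coord U sg c f : open U -> local_lift t U sg c -> is_section f ->
  borel_fun f -> borel_on U (fun x => Lcoord (sg x) (f x)).
Proof.
move=> oU Ll sf bf W oW.
have := bf _ (borel_open (lcoord_open oU Ll oW)).
rewrite (_ : f @^-1` _ = U `&` (fun x => Lcoord (sg x) (f x)) @^-1` W)//.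
by apply/seteqP; split=> x; rewrite /= /lcoord sf.
Qed.

Lemma borel_on_bigcup (l : seq (set G)) (Y : topologicalType) (f : G -> Y) W : open W ->
  (forall U, List.In U l -> borel_on U f) ->
  borel ([set x | exists2 U, List.In U l & U x] `&` f @^-1` W).
Proof.
move=> oW; elim: l => [|U l IH] hl.
  rewrite (_ : _ `&` _ = set0); first exact: borel0.
  by rewrite -subset0 => x [[V]].
rewrite (_ : _ `&` _ = (U `&` f @^-1` W) `|`
    ([set x | exists2 U, List.In U l & U x] `&` f @^-1` W)).
  by apply: borelU; [apply: hl => //; left|apply: IH => V Vl; apply: hl; right].
apply/seteqP; split=> x.
  by move=> [[V [<-|Vl] Vx] fx]; [left|right; split => //; exists V].
move=> [[Ux fx]|[[V Vl Vx] fx]]; split => //.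
  by exists U => //; left.
by exists V => //; right.
Qed.

(** Measurability is local only for countable covers; compactness gives a finite one by trivializing
    sets, and off it f is the zero section, which is continuous. *)
Lemma borel_section f K : is_section f -> compact K -> (forall x, ~ K x -> f x = Lzero t x) ->
  (forall U sg c, open U -> local_lift t U sg c ->
     borel_on U (fun x => Lcoord (sg x) (f x))) -> borel_fun f.
Proof.
move=> sf cK f0 fU; apply: borel_funP => W oW.
have [l [lP lK]] := lifting_cover t g_etale cK.
pose E := [set x | exists2 U, List.In U l & U x].
have bE : borel E by apply: borel_open; apply: open_list_bigcup => U /lP[].
rewrite -[f @^-1` W]setTI -(setUv E) setIUl; apply: borelU.
  apply: borel_on_bigcup => // U /lP[oU [_ [sg [c Ll]]]].
  have [lsg csg _ _] := Ll.
  apply: borel_on_eq (borel_on_class oU csg (fU U sg c oU Ll)) => x _.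
  by rewrite Lclass_coord// sf lsg.
apply: (borel_on_eq _ (borel_on_zero (borelC bE))) => // x nE.
by rewrite f0// => /lK.
Qed.

Lemma Bc_section f : Bc f -> is_section f. Proof. by case. Qed.

Lemma Bc_fin f : Bc f -> exists N, fin_fibres f N.
Proof.
move=> [sf _ _ [K cK f0]]; apply: (compact_support_fin_fibres g_etale cK) => x /f0 fx.
exact/coef_eq0.
Qed.

Lemma Bc_add f h : Bc f -> Bc h -> Bc (sec_add f h).
Proof.
move=> [sf bf [M fM] [K cK f0]] [sh bh [N hN] [L cL h0]].
have sfh := section_add sf sh.
have fh0 x : ~ (K `|` L) x -> sec_add f h x = Lzero t x.
  move=> nKL; rewrite /sec_add f0 => [|Kx]; last by apply: nKL; left.
  rewrite h0 => [|Lx]; last by apply: nKL; right.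
  by rewrite Ladd_class addr0.
have cKL : compact (K `|` L) by exact: compactU.
split => //; last by exists (K `|` L).
  apply: (borel_section sfh cKL fh0) => U sg c oU Ll; have [lsg _ _ _] := Ll.
  apply: borel_on_eq (borel_on_complexD (borel_on_coord oU Ll sf bf)
    (borel_on_coord oU Ll sh bh)) => x _.
  by rewrite -LcoordD// ?sf ?sh lsg.
exists (M + N) => x; rewrite fell_norm_coef// coef_add//.
by apply: le_trans (ler_rnormD _ _) _; rewrite -!fell_norm_coef// lerD.
Qed.

Lemma Bc_scale a f : Bc f -> Bc (sec_scale a f).
Proof.
move=> [sf bf [M fM] [K cK f0]]; have saf := section_scale a sf.
have af0 x : ~ K x -> sec_scale a f x = Lzero t x.
  by move=> nK; rewrite /sec_scale f0// Lscale_class mulr0.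
split => //; last by exists K.
  apply: (borel_section saf cK af0) => U sg c oU Ll; have [lsg _ _ _] := Ll.
  apply: borel_on_eq (borel_on_complexM (borel_on_cst a (borel_open oU))
    (borel_on_coord oU Ll sf bf)) => x _.
  by rewrite -LcoordZ// sf lsg.
exists (rnorm a * M) => x; rewrite fell_norm_coef// coef_scale// rnormM.
by rewrite -fell_norm_coef// ler_wpM2l// rnorm_ge0.
Qed.

(** Unlike in [reg_cont], the compact set may leave V: cutting a Borel section down to V does not
    move its compact set inside V. *)
Definition reg_borel (V : set G) b : Prop :=
  [/\ borel_on V b, exists M : R, forall x, rnorm (b x) <= M,
      exists2 K, compact K & forall x, ~ K x -> b x = 0 & forall x, ~ V x -> b x = 0].

Lemma reg_borel_mul V V' b b' : sbisection g V -> sbisection g V' ->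
  reg_borel V b -> reg_borel V' b' ->
  reg_borel (bis_mul g V V') (fun x => if `[< bis_mul g V V' x >] then
    b (left_factor g V' x) * b' (right_factor g V' x) else 0).
Proof.
move=> bV bV' [bb [M bM] [K cK b0] _] [bb' [M' bM'] [K' cK' b0'] _].
have [oW _ _] := bis_mul_bisection g_etale bV bV'.
have on_factor (U : set G) (k : G -> G) (d : G -> R[i]) : borel_on U d ->
    (forall x, bis_mul g V V' x -> U (k x) /\ {for x, continuous k}) ->
    borel_on (bis_mul g V V') (fun x => d (k x)).
  move=> bd hk O oO; rewrite (_ : _ `&` _ = bis_mul g V V' `&` k @^-1` (U `&` d @^-1` O)).
    apply: borel_preimage_on => //; last exact: bd.
    by move=> x /hk[].
  by apply/seteqP; split=> x [Wx] /=; [case: (hk x Wx)|case].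
split.
- apply: (borel_on_eq (f := fun x => b (left_factor g V' x) * b' (right_factor g V' x))).
    by move=> x Wx; rewrite asboolT.
  apply: borel_on_complexM.
    apply: (on_factor V) => // x [xV' xV]; split => //.
    exact: left_factor_continuous.
  apply: (on_factor V') => // x [xV' xV]; split; first by case: (right_factorP xV').
  exact: right_factor_continuous.
- exists (M * M') => x; case: asboolP => _; last first.
    by rewrite rnorm0 mulr_ge0// (le_trans (rnorm_ge0 _) (bM x), le_trans (rnorm_ge0 _) (bM' x)).
  by rewrite rnormM ler_pM// rnorm_ge0.
- exists (gset_mul g K K'); first exact: compact_gset_mul.
  move=> x nK; case: asboolP => // -[xV' _].
  have [Kl|/b0 ->] := pselect (K (left_factor g V' x)); last by rewrite mul0r.
  have [Kr|/b0' ->] := pselect (K' (right_factor g V' x)); last by rewrite mulr0.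
  case: nK; exists (left_factor g V' x, right_factor g V' x) => /=.
    by split => //=; exact: factors_composable.
  exact: left_right_factor.
- by move=> x nW; rewrite asboolF.
Qed.

Lemma elementary_Bc f : elementary reg_borel f -> Bc f.
Proof.
move=> ef; have sf := elementary_section ef; split => //; case: ef => V [sg [b [bV lsg csg rb ->]]];
  have [oV _ _] := bV; have [bb [M bM] [K cK b0] bV0] := rb.
- apply: borel_funP => W oW; apply: (borel_on_setC (borel_open oV)) oW.
    exact: borel_on_class.
  apply: (borel_on_eq _ (borel_on_zero (borelC (borel_open oV)))) => x nV.
  by rewrite bV0// Lzero_lift.
- by exists M => x; rewrite fell_norm_class.
- by exists K => // x /b0 ->; rewrite Lzero_lift.
Qed.

(** Indicator functions are Borel, so f is simply cut along V, and the remainder vanishes on V. *)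
Lemma borel_decomposition (l : seq (set G)) f :
  (forall V, List.In V l -> open V /\
     (sbisection g V /\ exists sg c, local_lift t V sg c)) ->
  Bc f -> (forall x, f x <> Lzero t x -> exists2 V, List.In V l & V x) ->
  sec_span (elementary reg_borel) f.
Proof.
elim: l f => [|V l IH] f lP Bf fl.
  suff -> : f = Lzero t by exact: sec_span0.
  by apply/funext => x; apply: contrapT => /fl[].
have [sf bf [M fM] [K' cK f0]] := Bf.
have [oV [bV [sg [c Ll]]]] := lP V (or_introl erefl).
have [lsg csg _ _] := Ll.
pose fc x := Lcoord (sg x) (f x).
have fE x : f x = cls (sg x) (fc x) by rewrite /fc Lclass_coord// sf lsg.
pose b1 x := if `[< V x >] then fc x else 0.
pose b2 x := if `[< V x >] then 0 else fc x.
pose f1 x := cls (sg x) (b1 x); pose f2 x := cls (sg x) (b2 x).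
have e1 : elementary reg_borel f1.
  exists V, sg, b1; split => //; split.
  - apply: (borel_on_eq _ (borel_on_coord oV Ll sf bf)) => x Vx.
    by rewrite /b1 asboolT.
  - exists (`|M|) => x; rewrite /b1; case: asboolP => _; last by rewrite rnorm0.
    by apply: le_trans (ler_norm _); rewrite /fc -fell_norm_coord// sf lsg.
  - exists K' => // x /f0 fx; rewrite /b1; case: asboolP => // _.
    by apply: (@Lclass_inj _ _ _ _ _ t (sg x)); rewrite -fE fx Lzero_lift.
  - by move=> x nV; rewrite /b1 asboolF.
have -> : f = sec_add f1 f2.
  apply/funext => x; rewrite /sec_add /f1 /f2 Ladd_class /b1 /b2.
  by case: asboolP => _; rewrite ?addr0 ?add0r.
apply: sec_spanD => //.
have s1 := elementary_section e1.
have f2E : f2 = sec_add f (sec_scale (-1) f1).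
  apply/funext => x; rewrite /sec_add /sec_scale /f1 /f2 Lscale_class fE Ladd_class /b1 /b2.
  by case: asboolP => _; rewrite mulN1r ?subrr ?oppr0 ?addr0.
apply: IH => [W Wl||x f2x]; first by apply: lP; right.
  by rewrite f2E; apply: Bc_add => //; apply: Bc_scale; exact: elementary_Bc.
have nV : ~ V x by move=> Vx; apply: f2x; rewrite /f2 /b2 asboolT// Lzero_lift.
have [|W [WV|Wl] Wx] := fl x; last by exists W.
  by move: f2x; rewrite /f2 /b2 asboolF// -fE.
by case: nV; rewrite WV.
Qed.

Lemma Bc_span f : Bc f <-> sec_span (elementary reg_borel) f.
Proof.
split=> [Bf|].
  have [_ _ _ [K cK f0]] := Bf; have [l [lP lK]] := lifting_cover t g_etale cK.
  by apply: (borel_decomposition lP) => // x fx; apply: lK; apply: contrapT => /f0.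
elim=> [|f1 f2 ef1 _ cf2]; last by apply: Bc_add => //; exact: elementary_Bc.
split; first exact: section_zero.
- by apply: borel_funP => W oW; rewrite -[_ @^-1` _]setTI; apply: borel_on_zero => //;
    apply: borel_open; exact: openT.
- by exists 0 => x; rewrite fell_norm_class rnorm0.
- by exists set0 => //; exact: compact0.
Qed.

Lemma Bc_conv f h : Bc f -> Bc h -> Bc (sec_conv f h).
Proof.
move=> /Bc_span cf /Bc_span ch; apply/Bc_span; apply: sec_span_conv => //.
  by move=> k /elementary_Bc Bk; split; [exact: Bc_section|exact: Bc_fin].
move=> f1 h1 ef1 eh1; apply: (elementary_conv g_etale) => //.
  by move=> V b [].
exact: reg_borel_mul.
Qed.

End BcAlgebra.

Theorem corollary3p8 (R : realType) (G S : topologicalType)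
    (g : top_groupoid G) (s : top_groupoid S) (t : twist R g s)
    (G_locally_compact : locally_compact_space G)
    (G_etale : etale g)
    (G0_locally_compact : locally_compact_space (set_type (gunits g)))
    (G0_hausdorff : hausdorff_space (set_type (gunits g)))
    (H : hilbert_space R) (H_infinite : infinite_dimensional H)
    (A : cstar_algebra R) :
  is_reduced_Cstar t A \/ is_reduced_Bstar t A ->
  [/\ no_nonzero_image (BH H) A,
      no_nonzero_image (calkin H) A
    & forall J : set (bounded_op H), norm_closed_ideal J -> J <> setT ->
        no_nonzero_image (BH_quot J) A].
Proof.
move=> tA; have BH0 : every_star_hom_zero (BH H) A.
  (* The two algebras differ only in the dense *-algebra of sections; both are closed under the
     operations and consist of sections with finite fibres. *)
  case: tA => -[j [[jD jZ jM _] jN j_dense]].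
    apply: (completion_star_hom_zero _ _ _ _ _ jD jZ jM jN j_dense) => //.
    - exact: Cc_section.
    - exact: Cc_fin.
    - by move=> f h; exact: Cc_add.
    - by move=> c f; exact: Cc_scale.
    - exact: Cc_conv.
  apply: (completion_star_hom_zero _ _ _ _ _ jD jZ jM jN j_dense) => //.
  - exact: Bc_section.
  - exact: Bc_fin.
  - exact: Bc_add.
  - by move=> c f; exact: Bc_scale.
  - exact: Bc_conv.
split; first exact: no_nonzero_image_BH.
  apply: no_nonzero_image_quot => //; first exact: compact_operators_ideal.
  exact: compact_operators_proper.
by move=> J idJ; exact: no_nonzero_image_quot.
Qed.
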